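(* There exist $\varepsilon_0>0$ and a neighbourhood $\mathcal{U}$ of $0$ in $H^2_{per}([0,2\pi],\mathbb{R}^2)$ such that for all $\varepsilon\in[0,\varepsilon_0)$ and all $\omega\in I_E=[-\frac14,\frac14]$ the following holds. Put $b=\varepsilon^2$ and $k=\frac{2\varepsilon\omega+\sqrt{4\varepsilon^2\omega^2+1}}{2}$. There is a unique small solution $\tilde u_{\varepsilon,\omega}\in\mathcal{U}$ of $N(b,k,\tilde u)=0$ which is even in $\xi$ and whose first component is positive at $\xi=0$ (in the degenerate cases $\varepsilon=0$ or $\omega=\pm\frac14$ this is replaced by: $\tilde u_{\varepsilon,\omega}\equiv 0$), and it has the expansion $$\tilde u_{\varepsilon,\omega}(\xi)=\sqrt{\tfrac{2}{3}(1-16\omega^2)}\,\cos\xi\begin{pmatrix}2\\-1\end{pmatrix}\varepsilon+\left(-\tfrac{4}{3}\,\omega\sqrt{\tfrac{2}{3}(1-16\omega^2)}\,\cos\xi\begin{pmatrix}1\\-2\end{pmatrix}-\tfrac{5}{9}\,\omega\sqrt{\tfrac{2}{3}(1-16\omega^2)}\,\cos\xi\begin{pmatrix}2\\-1\end{pmatrix}\right)\varepsilon^2+\mathcal{O}(\varepsilon^3).$$ In particular, when $\omega=\pm\frac14$, $\tilde u_{\varepsilon,\omega}\equiv 0$ is the equilibrium (zero) solution.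
   Context: The Brusselator model with fixed parameters is $\partial_t u_1=4\partial_x^2u_1+2-(\beta+1)u_1+u_1^2u_2$, $\partial_t u_2=16\partial_x^2u_2+\beta u_1-u_1^2u_2$, with equilibrium $(2,\beta/2)$. After the shift $u\to u-(2,\beta/2)$, $\beta=b+4$, and the change of variable $\xi=kx$, stationary solutions that are $2\pi/k$-periodic in $x$ correspond to $2\pi$-periodic solutions $\tilde u=(\tilde u_1,\tilde u_2)(\xi)$ of $$0=N(b,k,\tilde u):=k^2D\partial_\xi^2\tilde u+f(\tilde u),\qquad D=\begin{pmatrix}4&0\\0&16\end{pmatrix},$$ $$f(\tilde u)=\begin{pmatrix}(b+3)\tilde u_1+4\tilde u_2+(\frac b2+2)\tilde u_1^2+4\tilde u_1\tilde u_2+\tilde u_1^2\tilde u_2\\-(b+4)\tilde u_1-4\tilde u_2-(\frac b2+2)\tilde u_1^2-4\tilde u_1\tilde u_2-\tilde u_1^2\tilde u_2\end{pmatrix}.$$ $H^s_{per}([0,2\pi],\mathbb{R}^2)$ denotes the $H^s$ functions that are periodic on $[0,2\pi]$. The remainder $\mathcal{O}(\varepsilon^3)$ is measured in $H^2_{per}$. *)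

(* Defs.v *)
From mathcomp Require Import all_boot all_order all_algebra.
From mathcomp Require Import all_classical all_reals all_analysis.

Set Implicit Arguments.
Unset Strict Implicit.
Unset Printing Implicit Defensive.

Import Order.TTheory GRing.Theory Num.Theory.
Import numFieldNormedType.Exports.

Local Open Scope classical_set_scope.
Local Open Scope ring_scope.

Section PeriodicSobolev.
Variable R : realType.
Implicit Types (f g phi : R -> R) (u v : R -> R * R).

(* Functions on the circle are 2 pi-periodic functions on the whole line;
   integrals are taken over one period. *)
Definition period : set R := `[0, 2 * pi]%classic.

Definition periodic2pi (T : Type) (h : R -> T) : Prop :=
  forall x, h (x + 2 * pi) = h x.

Definition L2per f : Prop := f \_ period \in Lfun (@lebesgue_measure R) 2%:E.

Definition L2norm f : R :=
  fine ('N[@lebesgue_measure R]_2%:E[EFin \o (f \_ period)])%E.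

Definition smooth phi : Prop := forall n x, derivable ((derive1n n phi)) x 1.

(* Testing against periodic smooth functions, rather than functions with
   compact support in the open interval, is what makes the weak derivative
   see the periodic boundary conditions. *)
Definition is_wderiv (j : nat) f g : Prop :=
  L2per g /\
  forall phi, smooth phi -> periodic2pi phi ->
    \int[@lebesgue_measure R]_(x in period) (f x * derive1n j phi x) =
    (-1) ^+ j * \int[@lebesgue_measure R]_(x in period) (g x * phi x).

(* A chosen weak derivative: it is determined up to equality almost everywhere
   on one period, and is 0 when there is none. *)
Definition wderiv (j : nat) f : R -> R := xget (cst 0) [set g | is_wderiv j f g].

Definition Hper (s : nat) f : Prop :=
  [/\ L2per f, periodic2pi f &
      forall j, (j <= s)%N -> exists g, is_wderiv j f g].

Definition Hnorm (s : nat) f : R :=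
  Num.sqrt (\sum_(j < s.+1) (L2norm (wderiv j f)) ^+ 2).

(* The elements of H^2_per([0, 2 pi], R^2), each represented by its continuous
   representative; this makes values at a point meaningful and makes equality
   of elements coincide with equality of functions. *)
Definition H2per2 u : Prop :=
  [/\ continuous u, Hper 2 (fst \o u) & Hper 2 (snd \o u)].

Definition H2norm2 u : R :=
  Num.sqrt (Hnorm 2 (fst \o u) ^+ 2 + Hnorm 2 (snd \o u) ^+ 2).

Definition nbhs0_H2per2 (U : set (R -> R * R)) : Prop :=
  U `<=` [set u | H2per2 u] /\
  exists2 r : R, 0 < r & forall u, H2per2 u -> H2norm2 u < r -> U u.

End PeriodicSobolev.

Section Brusselator.
Variable R : realType.
Implicit Types (b k eps omega : R) (u : R -> R * R).

Definition reaction b (p : R * R) : R * R :=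
  let: (u1, u2) := p in
  ( (b + 3) * u1 + 4 * u2 + (b / 2 + 2) * u1 ^+ 2 + 4 * u1 * u2 + u1 ^+ 2 * u2,
    - (b + 4) * u1 - 4 * u2 - (b / 2 + 2) * u1 ^+ 2 - 4 * u1 * u2
    - u1 ^+ 2 * u2 ).

(* k^2 D u'' + f(u) with D = diag(4, 16). *)
Definition Nbr b k u (xi : R) : R * R :=
  k ^+ 2 *: (4 * wderiv 2 (fst \o u) xi, 16 * wderiv 2 (snd \o u) xi)
  + reaction b (u xi).

(* N takes values in L^2, so the equation is an equality in L^2. *)
Definition stationary b k u : Prop :=
  {ae @lebesgue_measure R, forall xi, period xi -> Nbr b k u xi = 0}.

Definition even_fun u : Prop := forall xi, u (- xi) = u xi.

Definition wavenumber eps omega : R :=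
  (2 * eps * omega + Num.sqrt (4 * eps ^+ 2 * omega ^+ 2 + 1)) / 2.

Definition degenerate eps omega : bool :=
  [|| eps == 0, omega == 1 / 4 | omega == - (1 / 4)].

Definition normalized eps omega u : Prop :=
  if degenerate eps omega then u = cst 0 else 0 < (u 0).1.

Definition roll_solution eps omega u : Prop :=
  [/\ stationary (eps ^+ 2) (wavenumber eps omega) u,
      even_fun u & normalized eps omega u].

Definition roll_expansion eps omega (xi : R) : R * R :=
  let A : R := Num.sqrt (2 / 3 * (1 - 16 * omega ^+ 2)) in
  (A * cos xi * eps) *: (2, -1)
  + eps ^+ 2 *: (- (4 / 3 * omega * A * cos xi) *: (1, -2)
                 - (5 / 9 * omega * A * cos xi) *: (2, -1)).

End Brusselator.

(* Main.v *)
(* With mu = (2k)^2 and W = - (u1 + 4 u2), the stationary system is equivalent to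
   u1 = - mu W'' and mu^2 W'''' + (b + 2) mu W'' + W = q(u1, W), where q collects the
   quadratic and cubic terms.  The wavenumber is such that (mu - 1)^2 - b mu =
   - mu s^2 with s = eps sqrt(1 - 16 omega^2), so on the critical mode cos the linear
   part acts as - mu s^2.  The Lyapunov-Schmidt ansatz W = a (cos + a y), a = s t,
   z = y'' + y, h = z'' + z with y, z, h even and orthogonal to cos, turns the problem
   into a fixed point equation for (h, t) in sup norm, which is a contraction near
   (0, 33/20) as d^2/dx^2 + 1 has a bounded inverse on even functions orthogonal to
   cos.  Conversely every even solution that is small in H^2 is classical, hence small
   in sup norm, and the equation off the critical mode bounds h; so it is the fixed
   point.  Solving the bifurcation equation mu = t^2 Phi, where
   Phi = 3/8 + 65/48 (mu - 1) + O(eps^2), gives the expansion. *)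
Require Import Defs.
From mathcomp Require Import all_boot all_order all_algebra.
From mathcomp Require Import all_classical all_reals all_analysis.
From mathcomp Require Import measurable_realfun ring lra.
Import Order.TTheory GRing.Theory Num.Theory.
Import numFieldNormedType.Exports.
Local Open Scope classical_set_scope.
Local Open Scope ring_scope.

Set Implicit Arguments.
Unset Strict Implicit.
Unset Printing Implicit Defensive.

(** * Calculus on the circle *)

Section Calculus.
Variable R : realType.
Implicit Types (f g F G : R -> R) (x y : R).
Notation mu := (@lebesgue_measure R).

(** All estimates have to be uniform up to [omega = 1/4] and [omega = -1/4], where the branch of
    rolls shrinks to 0. Writing the amplitude as [a = s t] and dividing the critical component by
    [a s^2] removes this degeneracy: [mu = t^2 Phi] stays regular as [s] tends to 0, and an error of
    order eps^2 in [t] is multiplied by [s <= eps] in the solution. The critical mode forces the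
    other modes only weakly: its quadratic self-interaction has the coefficient [mu eta], of order
    eps. Hence [h], [y], [z] are of order eps, and the part of the solution orthogonal to [cos], of
    size [a^2 y], is of order eps^3. The fourth-order operator is a small perturbation of
    [(d^2/dx^2 + 1)^2]. With [h], its leading part applied to [y], as the unknown, only bounded
    inverses occur and no derivative is lost; variation of constants gives these inverses in sup
    norm without Fourier series. Numerical constants such as 48, 400 or 4000 are crude: they only
    have to be fixed before the parameters are taken small. *)

Definition der F f := forall x, is_derive x (1 : R) F (f x).

Lemma der_ext F f g : der F f -> f =1 g -> der F g.
Proof. by move=> Ff fg x; rewrite -fg; exact: Ff. Qed.

Lemma derext_fun F G f : der F f -> F =1 G -> der G f.
Proof. by move=> Ff /funext <-. Qed.

Lemma der_cst (c : R) : der (fun=> c) (fun=> 0).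
Proof. by move=> x; exact: is_derive_cst. Qed.

Lemma der_id : der (fun x => x) (fun=> 1).
Proof. by move=> x; exact: is_derive_id. Qed.

Lemma der_add F G f g : der F f -> der G g ->
  der (fun x => F x + G x) (fun x => f x + g x).
Proof. by move=> Ff Gg x; exact: is_deriveD. Qed.

Lemma der_opp F f : der F f -> der (fun x => - F x) (fun x => - f x).
Proof. by move=> Ff x; exact: is_deriveN. Qed.

Lemma der_sub F G f g : der F f -> der G g ->
  der (fun x => F x - G x) (fun x => f x - g x).
Proof. by move=> Ff Gg; apply: der_add => //; exact: der_opp. Qed.

Lemma der_mul F G f g : der F f -> der G g ->
  der (fun x => F x * G x) (fun x => f x * G x + F x * g x).
Proof.
move=> Ff Gg x; have := @is_deriveM _ _ F G x 1 _ _ (Ff x) (Gg x).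
have e : F x *: g x + G x *: f x = f x * G x + F x * g x by rewrite /GRing.scale /=; ring.
by rewrite -e.
Qed.

Lemma der_scale (c : R) F f : der F f -> der (fun x => c * F x) (fun x => c * f x).
Proof.
move=> Ff; apply: (der_ext (der_mul (der_cst c) Ff)) => x.
by rewrite mul0r add0r.
Qed.

Lemma der_comp F G f g : der F f -> der G g ->
  der (fun x => F (G x)) (fun x => f (G x) * g x).
Proof. by move=> Ff Gg x; exact: is_derive1_comp. Qed.

Lemma der_sin : der sin cos.
Proof. by move=> x; exact: is_derive_sin. Qed.

Lemma der_cos : der cos (fun x => - sin x).
Proof. by move=> x; exact: is_derive_cos. Qed.

Lemma der_continuous F f : der F f -> continuous F.
Proof.
move=> Ff x; apply/differentiable_continuous/derivable1_diffP.
by have [] := Ff x.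
Qed.

Lemma der_mvt F f x y : der F f -> x <= y ->
  exists2 c, x <= c <= y & F y - F x = f c * (y - x).
Proof.
move=> Ff xy.
have [|c cI ->] := @MVT_segment R F f x y xy (fun z _ => Ff z).
  by apply: continuous_subspaceT; exact: der_continuous Ff.
by exists c => //; move: cI; rewrite in_itv.
Qed.

Lemma der_lipschitz F f (M : R) x y : der F f -> (forall z, `|f z| <= M) ->
  `|F y - F x| <= M * `|y - x|.
Proof.
move=> Ff fM; wlog xy : x y / x <= y.
  move=> H; have [/H//|/ltW/H] := leP x y.
  by rewrite distrC (distrC x).
have [c _ ->] := der_mvt Ff xy.
by rewrite normrM ler_wpM2r.
Qed.

Lemma der0_cst F x y : der F (fun=> 0) -> F x = F y.
Proof. exact: is_derive_0_is_cst. Qed.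

Lemma der_eq F G f : der F f -> der G f -> F 0 = G 0 -> F =1 G.
Proof.
move=> Ff Gf FG0 x; apply/eqP; rewrite -subr_eq0; apply/eqP.
have H : der (fun x => F x - G x) (fun=> 0).
  by apply: (der_ext (der_sub Ff Gf)) => y; rewrite subrr.
by rewrite (der0_cst x 0 H) FG0 subrr.
Qed.

(** The fundamental theorem of calculus applied here needs a base point to the left of [x], and no
    single base point serves the whole line. Subtracting the integral up to 0 makes the value
    independent of the base point ([FE]), which may therefore move with [x]. *)
Lemma prim_exists f : continuous f -> exists2 F, der F f & F 0 = 0.
Proof.
move=> cf.
have integrable_f (a b : R) : mu.-integrable `[a, b] (EFin \o f).
  apply: continuous_compact_integrable; first exact: segment_compact.
  exact: continuous_subspaceT.
pose F x := \int[mu]_(t in `[- (`|x| + 1), x]) f t - \int[mu]_(t in `[- (`|x| + 1), 0]) f t.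
have FE (M x : R) : `|x| < M ->
    F x = \int[mu]_(t in `[- M, x]) f t - \int[mu]_(t in `[- M, 0]) f t.
  move=> xM.
  have key (A B : R) : `|x| < A -> A <= B ->
      \int[mu]_(t in `[- A, x]) f t - \int[mu]_(t in `[- A, 0]) f t =
      \int[mu]_(t in `[- B, x]) f t - \int[mu]_(t in `[- B, 0]) f t.
    move=> xA AB.
    have split (y : R) : - A <= y -> \int[mu]_(t in `[- B, y]) f t =
        \int[mu]_(t in `[- B, - A]) f t + \int[mu]_(t in `[- A, y]) f t.
      move=> Ay.
      have := @Rintegral_itvB R f (BLeft (- B)) (BRight y) (- A) (integrable_f _ _).
      rewrite !bnd_simp lerN2 AB => /(_ isT Ay).
      by rewrite Rintegral_itv_obnd_cbnd; [move=> <-; ring|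
        apply: integrableS (integrable_f (- A) y) => //; apply: subset_itv;
        rewrite bnd_simp].
    have Ax : - A <= x by move: xA; rewrite ltr_norml => /andP[/ltW].
    have A0 : - A <= 0 by rewrite oppr_le0 (le_trans _ (ltW xA)).
    by rewrite (split x Ax) (split 0 A0); ring.
  rewrite /F; have [le1|/ltW le2] := leP (`|x| + 1) M.
    by apply: key => //; rewrite ltrDl.
  by rewrite [RHS](key _ _ xM le2).
exists F; last by rewrite /F subrr.
move=> x.
pose M : R := `|x| + 2.
pose K := \int[mu]_(t in `[- M, 0]) f t.
pose I y := \int[mu]_(t in `[- M, y]) f t.
have Mx : - M < x.
  by rewrite /M ltrNl (le_lt_trans (ler_norm _))// normrN ltrDl.

have [|dI I'] := @continuous_FTC1_closed R f (- M) x (x + 1) _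
  (integrable_f _ _) Mx (cf x); first by rewrite ltrDl.
have near_eq : \forall y \near x, I y - K = F y.
  have : \forall y \near x, ball x 1 y by exact: nbhsx_ballx.
  apply: filterS => y; rewrite /ball /= => xy1; rewrite -FE // /M.
  have -> : y = x - (x - y) by ring.
  by rewrite (le_lt_trans (ler_normB _ _))// ltrD2l (lt_trans xy1)// ltr1n.
have IK : is_derive x (1 : R) (fun y => I y - K) (f x).
  rewrite -[f x]subr0; apply: is_deriveB.
  by apply: DeriveDef; [exact: dI|rewrite -derive1E].
apply: DeriveDef.
  apply: near_eq_derivable near_eq _.
  by case: IK.
by rewrite -(near_eq_derive _ near_eq); case: IK.
Qed.

(** * Integrals over one period *)

Lemma twopi_gt0 : 0 < 2 * pi :> R.
Proof. by rewrite mulr_gt0// pi_gt0. Qed.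

Lemma pi_lt4 : pi < 4 :> R.
Proof. by have := @pihalf_lt2 R; rewrite ltr_pdivrMr// -natrM. Qed.

Definition circ f := \int[mu]_(x in @period R) f x.

Lemma continuous_integrable f : continuous f ->
  mu.-integrable (@period R) (EFin \o f).
Proof.
move=> cf; apply: continuous_compact_integrable; first exact: segment_compact.
exact: continuous_subspaceT.
Qed.

Lemma measurable_period : measurable (@period R : set (measurableTypeR R)).
Proof. exact: measurable_itv. Qed.

Lemma circ_der F f : continuous f -> der F f -> circ f = F (2 * pi) - F 0.
Proof.
move=> cf Ff; rewrite /circ /Rintegral /period.
rewrite (@continuous_FTC2 R f F) ?twopi_gt0//.
- exact: continuous_subspaceT.
- split.
  + by move=> x _; have [] := Ff x.
  + by apply: cvg_at_right_filter; exact: der_continuous Ff 0.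
  + by apply: cvg_at_left_filter; exact: der_continuous Ff _.
- by move=> x _; rewrite derive1E; have [] := Ff x.
Qed.

Lemma circ_add f g : continuous f -> continuous g ->
  circ (fun x => f x + g x) = circ f + circ g.
Proof.
by move=> cf cg; apply: RintegralD; [exact: measurable_period|
  exact: continuous_integrable|exact: continuous_integrable].
Qed.

Lemma circ_sub f g : continuous f -> continuous g ->
  circ (fun x => f x - g x) = circ f - circ g.
Proof.
by move=> cf cg; apply: RintegralB; [exact: measurable_period|
  exact: continuous_integrable|exact: continuous_integrable].
Qed.

Lemma circ_scale (c : R) f : continuous f -> circ (fun x => c * f x) = c * circ f.
Proof.
by move=> cf; apply: RintegralZl; [exact: measurable_period|
  exact: continuous_integrable].
Qed.

Lemma circ_ext f g : f =1 g -> circ f = circ g.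
Proof. by move=> /funext ->. Qed.

Lemma circ_bound f (M : R) : continuous f -> (forall x, `|f x| <= M) ->
  `|circ f| <= 2 * pi * M.
Proof.
move=> cf fM; have [F Ff F0] := prim_exists cf.
rewrite (circ_der cf Ff); apply: (le_trans (der_lipschitz 0 _ Ff fM)).
by rewrite subr0 (ger0_norm (ltW twopi_gt0)) mulrC.
Qed.

(** * Derivatives under translation and reflection; even periodic functions *)

Lemma der_uniq F f g : der F f -> der F g -> f =1 g.
Proof. by move=> Ff Fg x; have [_ <-] := Ff x; have [_ <-] := Fg x. Qed.

Lemma der_shift F f (c : R) : der F f -> der (fun x => F (x + c)) (fun x => f (x + c)).
Proof.
move=> Ff; apply: (der_ext (der_comp Ff (der_add der_id (der_cst c)))) => x.
by rewrite addr0 mulr1.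
Qed.

Lemma der_rev F f : der F f -> der (fun x => F (- x)) (fun x => - f (- x)).
Proof.
move=> Ff; apply: (der_ext (der_comp Ff (der_opp der_id))) => x.
by rewrite mulrN1.
Qed.

Lemma der_periodic F f : der F f -> periodic2pi F -> periodic2pi f.
Proof.
move=> Ff pF; apply: (der_uniq _ Ff).
exact: derext_fun (der_shift (2 * pi) Ff) pF.
Qed.

Lemma der_even F f : der F f -> (forall x, F (- x) = F x) -> forall x, f (- x) = - f x.
Proof.
move=> Ff eF x.
have := der_uniq (derext_fun (der_rev Ff) eF) Ff x.
by move=> /(congr1 -%R); rewrite opprK.
Qed.

Lemma periodic_reduce f x : periodic2pi f ->
  exists2 y, 0 <= y <= 2 * pi & f x = f y.
Proof.
move=> pf.
have pN y : f (y - 2 * pi) = f y by rewrite -(pf (y - 2 * pi)) subrK.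
have pn (n : nat) y : f (y + (2 * pi) *+ n) = f y.
  by elim: n => [|n IH]; rewrite ?mulr0n ?addr0// mulrSr addrA pf IH.
have pnN (n : nat) y : f (y - (2 * pi) *+ n) = f y.
  by rewrite -[in LHS](pn n) subrK.
pose k := Num.floor (x / (2 * pi)).
exists (x - (2 * pi) * k%:~R).
  have := floor_itv (x / (2 * pi)).
  rewrite -/k ler_pdivlMr ?twopi_gt0// ltr_pdivrMr ?twopi_gt0//.
  rewrite intrD => /andP[h1 /ltW h2]; apply/andP; split; lra.
case: k => n.
  by rewrite -pmulrn mulr_natr pnN.
by rewrite NegzE mulrNz mulrN opprK -pmulrn mulr_natr pn.
Qed.

(** The space in which the reduction takes place. Evenness excludes [sin], so that the kernel of
    [d^2/dx^2 + 1] is spanned by [cos] alone. *)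
Definition good f := [/\ continuous f, forall x, f (- x) = f x & periodic2pi f].

Lemma cos2pi_periodic : periodic2pi (@cos R).
Proof. by move=> x; rewrite mulr_natl cosD2pi. Qed.

Lemma sin2pi_periodic : periodic2pi (@sin R).
Proof. by move=> x; rewrite mulr_natl sinD2pi. Qed.

Lemma good_cos : good cos.
Proof. by split; [exact: continuous_cos|exact: cosN|exact: cos2pi_periodic]. Qed.

Lemma good_cst (c : R) : good (fun=> c).
Proof. by split=> // x; exact: cst_continuous. Qed.

Lemma good_add f g : good f -> good g -> good (fun x => f x + g x).
Proof.
move=> [cf ef pf] [cg eg pg]; split.
- by move=> x; apply: continuousD; [exact: cf|exact: cg].
- by move=> x; rewrite ef eg.
- by move=> x; rewrite pf pg.
Qed.

Lemma good_mul f g : good f -> good g -> good (fun x => f x * g x).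
Proof.
move=> [cf ef pf] [cg eg pg]; split.
- by move=> x; apply: continuousM; [exact: cf|exact: cg].
- by move=> x; rewrite ef eg.
- by move=> x; rewrite pf pg.
Qed.

Lemma good_opp f : good f -> good (fun x => - f x).
Proof.
move=> [cf ef pf]; split.
- by move=> x; apply: continuousN; exact: cf.
- by move=> x; rewrite ef.
- by move=> x; rewrite pf.
Qed.

Lemma good_exp f n : good f -> good (fun x => f x ^+ n).
Proof.
move=> gf; elim: n => [|n IH]; first exact: good_cst.
by under eq_fun do rewrite exprS; exact: good_mul.
Qed.

Lemma continuous_mul f g : continuous f -> continuous g -> continuous (fun x => f x * g x).
Proof. by move=> cf cg x; apply: continuousM; [exact: cf|exact: cg]. Qed.

Lemma continuous_add f g : continuous f -> continuous g -> continuous (fun x => f x + g x).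
Proof. by move=> cf cg x; apply: continuousD; [exact: cf|exact: cg]. Qed.

Lemma continuous_opp f : continuous f -> continuous (fun x => - f x).
Proof. by move=> cf x; apply: continuousN; exact: cf. Qed.

Lemma good_continuous f : good f -> continuous f.
Proof. by case. Qed.

(** * The Fourier coefficient of the critical mode [cos] *)

Definition coef f : R := pi^-1 * circ (fun x => f x * cos x).

Let pi_neq0 : pi != 0 :> R. Proof. by rewrite gt_eqF// pi_gt0. Qed.
Let continuous_mulcos f : continuous f -> continuous (fun x => f x * cos x).
Proof. by move=> cf; apply: continuous_mul => //; exact: continuous_cos. Qed.

Lemma coef_ext f g : f =1 g -> coef f = coef g.
Proof. by move=> /funext ->. Qed.

Lemma coef_add f g : continuous f -> continuous g ->
  coef (fun x => f x + g x) = coef f + coef g.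
Proof.
move=> cf cg; rewrite /coef -mulrDr -circ_add; [|exact: continuous_mulcos..].
by congr (_ * _); apply: circ_ext => x; rewrite mulrDl.
Qed.

Lemma coef_scale (c : R) f : continuous f -> coef (fun x => c * f x) = c * coef f.
Proof.
move=> cf; rewrite /coef mulrCA -[in RHS]circ_scale; last exact: continuous_mulcos.
by congr (_ * _); apply: circ_ext => x; rewrite mulrA.
Qed.

Lemma coef_sub f g : continuous f -> continuous g ->
  coef (fun x => f x - g x) = coef f - coef g.
Proof.
move=> cf cg; rewrite coef_add//; last exact: continuous_opp.
congr (_ + _); rewrite -mulN1r -coef_scale//.
by apply: coef_ext => x; rewrite mulN1r.
Qed.

Lemma coef_bound f (M : R) : continuous f -> (forall x, `|f x| <= M) ->
  `|coef f| <= 2 * M.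
Proof.
move=> cf fM; rewrite /coef normrM ger0_norm ?invr_ge0 ?pi_ge0//.
rewrite ler_pdivrMl ?pi_gt0//.
have -> : pi * (2 * M) = 2 * pi * M by ring.
apply: circ_bound; first exact: continuous_mulcos.
move=> x; rewrite normrM -[leRHS]mulr1; apply: ler_pM => //; exact: cos_max.
Qed.

Let sin_sq x : sin x ^+ 2 = 1 - cos x ^+ 2 := sin2cos2 x.
Let sin_2pi : sin (2 * pi) = 0 :> R. Proof. by rewrite mulr_natl sin2pi. Qed.

Lemma circ_cos1 : circ cos = 0.
Proof.
by rewrite (circ_der (@continuous_cos R) der_sin) sin_2pi sin0 subrr.
Qed.

Lemma circ_cos2 : circ (fun x => cos x ^+ 2) = pi.
Proof.
have H : der (fun x => 2^-1 * (x + sin x * cos x)) (fun x => cos x ^+ 2).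
  apply: (der_ext (der_scale _ (der_add der_id (der_mul der_sin der_cos)))) => x.
  have := sin_sq x; nra.
rewrite (circ_der _ H); last exact: good_continuous (good_exp _ good_cos).
by rewrite sin_2pi sin0; field.
Qed.

Lemma circ_cos3 : circ (fun x => cos x ^+ 3) = 0.
Proof.
have H : der (fun x => sin x * (1 - 3^-1 * (sin x * sin x))) (fun x => cos x ^+ 3).
  apply: (der_ext (der_mul der_sin (der_sub (der_cst 1)
    (der_scale _ (der_mul der_sin der_sin))))) => x.
  have -> : cos x ^+ 3 = cos x * (1 - sin x ^+ 2) by rewrite sin_sq; ring.
  by field.
rewrite (circ_der _ H); last exact: good_continuous (good_exp _ good_cos).
by rewrite sin_2pi sin0; ring.
Qed.

Lemma circ_cos4 : circ (fun x => cos x ^+ 4) = 3 / 4 * pi.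
Proof.
have H : der (fun x => 3 / 8 * x + sin x * cos x * (3 / 8 + 4^-1 * (cos x * cos x)))
             (fun x => cos x ^+ 4).
  apply: (der_ext (der_add (der_scale _ der_id) (der_mul (der_mul der_sin der_cos)
    (der_add (der_cst _) (der_scale _ (der_mul der_cos der_cos)))))) => x.
  rewrite [X in _ = X](_ : _ = cos x ^+ 4 + (1 - cos x ^+ 2 - sin x ^+ 2) *
    (3 / 8 + 3 / 4 * cos x ^+ 2)); first by field.
  by rewrite sin_sq subrr mul0r addr0.
rewrite (circ_der _ H); last exact: good_continuous (good_exp _ good_cos).
by rewrite sin_2pi sin0; field.
Qed.

Lemma circ_cos5 : circ (fun x => cos x ^+ 5) = 0.
Proof.
have H : der (fun x => sin x * (1 - 2 / 3 * (sin x * sin x) + 5^-1 * (sin x * sin x * (sin x * sin x))))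
             (fun x => cos x ^+ 5).
  apply: (der_ext (der_mul der_sin (der_add (der_sub (der_cst 1)
    (der_scale _ (der_mul der_sin der_sin))) (der_scale _ (der_mul (der_mul der_sin der_sin) (der_mul der_sin der_sin)))))) => x.
  have -> : cos x ^+ 5 = cos x * (1 - sin x ^+ 2) ^+ 2 by rewrite sin_sq; ring.
  by field.
rewrite (circ_der _ H); last exact: good_continuous (good_exp _ good_cos).
by rewrite sin_2pi sin0; ring.
Qed.

Lemma coef_cst (c : R) : coef (fun=> c) = 0.
Proof.
by rewrite /coef circ_scale ?circ_cos1 ?mulr0//; exact: continuous_cos.
Qed.

Lemma coef_cos : coef cos = 1.
Proof. by rewrite /coef -[X in circ X]/(fun x => cos x ^+ 2) circ_cos2 mulVf. Qed.

Lemma coef_cos2 : coef (fun x => cos x ^+ 2) = 0.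
Proof.
rewrite /coef (@circ_ext _ (fun x => cos x ^+ 3)) ?circ_cos3 ?mulr0// => x.
by rewrite -exprSr.
Qed.

Lemma coef_cos3 : coef (fun x => cos x ^+ 3) = 3 / 4.
Proof.
rewrite /coef (@circ_ext _ (fun x => cos x ^+ 4)).
  by rewrite circ_cos4 mulrCA mulVf ?mulr1.
by move=> x; rewrite -exprSr.
Qed.

(** The resonant oscillator [y'' + y = g], with [y] normalised to have no component along [cos]: [y]
    is the image of [g] under the inverse of [d^2/dx^2 + 1] on even functions orthogonal to
    [cos]. *)
Definition osc (g y : R -> R) := [/\ good y, coef y = 0 &
  exists2 y', der y y' & der y' (fun x => g x - y x)].

Lemma osc_sub g1 g2 (y1 y2 : R -> R) : osc g1 y1 -> osc g2 y2 ->
  osc (fun x => g1 x - g2 x) (fun x => y1 x - y2 x).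
Proof.
move=> [gy1 c1 [d1 D1 D1']] [gy2 c2 [d2 D2 D2']]; split.
- by apply: good_add => //; exact: good_opp.
- by rewrite coef_sub ?c1 ?c2 ?subrr//; exact: good_continuous.
- exists (fun x => d1 x - d2 x); first exact: der_sub.
  by apply: (der_ext (der_sub D1' D2')) => x; ring.
Qed.

Lemma osc_scale (c : R) g (y : R -> R) : osc g y -> osc (fun x => c * g x) (fun x => c * y x).
Proof.
move=> [gy c0 [d D D']]; split.
- by apply: good_mul => //; exact: good_cst.
- by rewrite coef_scale ?c0 ?mulr0//; exact: good_continuous.
- exists (fun x => c * d x); first exact: der_scale.
  by apply: (der_ext (der_scale c D')) => x; ring.
Qed.

(** Variation of constants: [C] and [S] have derivatives [g cos] and [g sin], so over a period,
    shorter than 8, each moves by at most [8 M]. This bounds [r = y - y(0) cos] by [16 M]. Since [y]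
    has no critical component, [y(0) = - coef r] is at most [32 M], and 16 + 32 = 48. *)
Lemma osc_bound (g y : R -> R) (M : R) : osc g y -> (forall x, `|g x| <= M) ->
  forall x, `|y x| <= 48 * M.
Proof.
move=> [gy c0 [d D D']] gM.
have [cy ey py] := gy.
have d0 : d 0 = 0.
  have := der_even D ey 0; rewrite oppr0 => /eqP.
  by rewrite -addr_eq0 -mulr2n mulrn_eq0 /= => /eqP.
have M0 : 0 <= M by exact: le_trans (gM 0).
pose C x := y x * sin x + d x * cos x.
pose S x := d x * sin x - y x * cos x.
have DC : der C (fun x => g x * cos x).
  apply: (der_ext (der_add (der_mul D der_sin) (der_mul D' der_cos))) => x; ring.
have DS : der S (fun x => g x * sin x).
  apply: (der_ext (der_sub (der_mul D' der_sin) (der_mul D der_cos))) => x; ring.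
have bm (t u : R) : `|t| <= M -> `|u| <= 1 -> `|t * u| <= M.
  by move=> tM u1; rewrite normrM -[leRHS]mulr1; apply: ler_pM.
pose r x := y x - y 0 * cos x.
have rE x : r x = sin x * (C x - C 0) - cos x * (S x - S 0).
  rewrite /r /C /S sin0 cos0 d0.
  have := cos2Dsin2 x => e.
  transitivity (y x * (cos x ^+ 2 + sin x ^+ 2) - y 0 * cos x); first by rewrite e mulr1.
  by ring.
have r_bound x : `|r x| <= 16 * M.
  have pr : periodic2pi r by move=> z; rewrite /r py cos2pi_periodic.
  have [z /andP[z0 zpi] ->] := periodic_reduce x pr.
  have z8 : `|z - 0| <= 8.
    by rewrite subr0 ger0_norm// (le_trans zpi)//; have := pi_lt4; lra.
  have bC : `|C z - C 0| <= 8 * M.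
    apply: (le_trans (der_lipschitz 0 z DC (fun u => bm _ _ (gM u) (cos_max u)))).
    by rewrite mulrC ler_wpM2r.
  have bS : `|S z - S 0| <= 8 * M.
    apply: (le_trans (der_lipschitz 0 z DS (fun u => bm _ _ (gM u) (sin_max u)))).
    by rewrite mulrC ler_wpM2r.
  rewrite rE; apply: (le_trans (ler_normB _ _)).
  have -> : 16 * M = 1 * (8 * M) + 1 * (8 * M) by ring.
  by apply: lerD; rewrite normrM; apply: ler_pM => //; [exact: sin_max|exact: cos_max].
have gr : good r.
  apply: good_add => //; apply: good_opp; apply: good_mul; first exact: good_cst.
  exact: good_cos.
have y0E : y 0 = - coef r.
  rewrite coef_sub ?coef_scale ?coef_cos ?c0; [by ring|exact: continuous_cos|exact: cy|].
  by apply: continuous_mul; [exact: cst_continuous|exact: continuous_cos].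
have y0b : `|y 0| <= 32 * M.
  rewrite y0E normrN; apply: (le_trans (coef_bound (good_continuous gr) r_bound)).
  by lra.
move=> x; have -> : y x = r x + y 0 * cos x by rewrite /r; ring.
have -> : 48 * M = 16 * M + 32 * M * 1 by ring.
apply: (le_trans (ler_normD _ _)); apply: lerD => //.
by rewrite normrM; apply: ler_pM => //; exact: cos_max.
Qed.

Lemma osc_uniq g (y1 y2 : R -> R) : osc g y1 -> osc g y2 -> y1 =1 y2.
Proof.
move=> o1 o2 x.
have b z : `|g z - g z| <= 0 by rewrite subrr normr0.
have := osc_bound (osc_sub o1 o2) b x.
by rewrite mulr0 normr_le0 subr_eq0 => /eqP.
Qed.

(** By evenness the derivative vanishes at 0, and its own derivative [g - y] is at most [50 M]; over
    a period shorter than 8 this gives [400 M]. *)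
Lemma osc_der_bound g (y d : R -> R) (M : R) : osc g y -> der y d -> (forall x, `|g x| <= M) ->
  forall x, `|d x| <= 400 * M.
Proof.
move=> o D gM.
have yb := osc_bound o gM.
have [[cy ey py] c0 [d2 D2 D2']] := o.
have {}D2' : der d (fun x => g x - y x).
  exact: derext_fun D2' (der_uniq D2 D).
have d0 : d 0 = 0.
  have := der_even D ey 0; rewrite oppr0 => /eqP.
  by rewrite -addr_eq0 -mulr2n mulrn_eq0 /= => /eqP.
have M0 : 0 <= M by exact: le_trans (gM 0).
move=> x; have [z /andP[z0 zpi] ->] := periodic_reduce x (der_periodic D py).
have b u : `|g u - y u| <= 50 * M.
  apply: (le_trans (ler_normB _ _)); have := gM u; have := yb u; lra.
have := der_lipschitz 0 z D2' b; rewrite d0 !subr0 (ger0_norm z0) => /le_trans; apply.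
have := pi_lt4; nra.
Qed.

(** Variation of constants, [y0 = sin C - cos S]. It is periodic if [C] and [S] are: for [C] this is
    the hypothesis that [g] has no critical component, for [S] it follows from the parity of [g].
    Subtracting a multiple of [cos] then gives the normalisation. *)
Lemma osc_exists g : good g -> coef g = 0 -> exists y : R -> R, osc g y.
Proof.
move=> [cg eg pg] c0.
have cgc : continuous (fun x => g x * cos x).
  by apply: continuous_mul => //; exact: continuous_cos.
have cgs : continuous (fun x => g x * sin x).
  by apply: continuous_mul => //; exact: continuous_sin.
have [C DC C0] := prim_exists cgc.
have [S DS S0] := prim_exists cgs.
have Codd x : C (- x) = - C x.
  apply/eqP; rewrite -[_ == _]opprK -eqr_oppLR; apply/eqP.
  apply: (@der_eq (fun x => - C (- x)) C _ _ DC); last by rewrite oppr0 C0 oppr0.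
  apply: (der_ext (der_opp (der_rev DC))) => z.
  by rewrite eg cosN opprK.
have Seven x : S (- x) = S x.
  apply: (@der_eq (fun x => S (- x)) S _ _ DS); last by rewrite oppr0.
  apply: (der_ext (der_rev DS)) => z.
  by rewrite eg sinN; ring.
have Cshift x : C (x + 2 * pi) = C x + C (2 * pi).
  apply: (@der_eq (fun x => C (x + 2 * pi)) (fun x => C x + C (2 * pi)) (fun x => g x * cos x)).
  - apply: (der_ext (der_shift (2 * pi) DC)) => z.
    by rewrite pg cos2pi_periodic.
  - by apply: (der_ext (der_add DC (der_cst _))) => z; rewrite addr0.
  - by rewrite add0r C0 add0r.
have Sshift x : S (x + 2 * pi) = S x + S (2 * pi).
  apply: (@der_eq (fun x => S (x + 2 * pi)) (fun x => S x + S (2 * pi)) (fun x => g x * sin x)).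
  - apply: (der_ext (der_shift (2 * pi) DS)) => z.
    by rewrite pg sin2pi_periodic.
  - by apply: (der_ext (der_add DS (der_cst _))) => z; rewrite addr0.
  - by rewrite add0r S0 add0r.
have C2pi : C (2 * pi) = 0.
  have := c0; rewrite /coef (circ_der cgc DC) C0 subr0 => /eqP.
  by rewrite mulf_eq0 invr_eq0 (negbTE pi_neq0) => /eqP.
have S2pi : S (2 * pi) = 0.
  have := Sshift (- (2 * pi)); rewrite addNr S0 Seven => /eqP.
  by rewrite eq_sym -mulr2n mulrn_eq0 /= => /eqP.
pose y0 x := sin x * C x - cos x * S x.
have Dy0 : der y0 (fun x => cos x * C x + sin x * S x).
  by apply: (der_ext (der_sub (der_mul der_sin DC) (der_mul der_cos DS))) => x; ring.
have Dy0' : der (fun x => cos x * C x + sin x * S x) (fun x => g x - y0 x).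
  apply: (der_ext (der_add (der_mul der_cos DC) (der_mul der_sin DS))) => x.
  have e : g x = g x * (cos x ^+ 2 + sin x ^+ 2) by rewrite cos2Dsin2 mulr1.
  by rewrite [in RHS]e /y0; ring.
have gy0 : good y0.
  split; first exact: der_continuous Dy0.
  - by move=> x; rewrite /y0 sinN cosN Codd Seven mulrNN.
  - by move=> x; rewrite /y0 sin2pi_periodic cos2pi_periodic Cshift Sshift C2pi S2pi !addr0.
have gc (c : R) : good (fun x => c * cos x).
  by apply: good_mul; [exact: good_cst|exact: good_cos].
exists (fun x => y0 x - coef y0 * cos x); split.
- by apply: good_add => //; exact: good_opp.
- rewrite coef_sub ?coef_scale ?coef_cos ?mulr1 ?subrr//; try exact: good_continuous.
  exact: continuous_cos.
- exists (fun x => cos x * C x + sin x * S x + coef y0 * sin x).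
  + by apply: (der_ext (der_sub Dy0 (der_scale (coef y0) der_cos))) => x; ring.
  + by apply: (der_ext (der_add Dy0' (der_scale (coef y0) der_sin))) => x; ring.
Qed.

(* The weight 2/3 - cos^2/3 is the preimage of cos^2 under d^2/dx^2 + 1, which is
   symmetric. *)
Lemma circ_cos2_osc g (y : R -> R) : continuous g -> osc g y ->
  circ (fun x => cos x ^+ 2 * y x) = circ (fun x => (2 / 3 - 3^-1 * cos x ^+ 2) * g x).
Proof.
move=> cg [[cy _ py] _ [d D D']].
have cphi : continuous (fun x : R => 2 / 3 - 3^-1 * cos x ^+ 2).
  apply: continuous_add; first exact: cst_continuous.
  apply/continuous_opp/continuous_mul; first exact: cst_continuous.
  exact: good_continuous (good_exp _ good_cos).
have c1 : continuous (fun x => (2 / 3 - 3^-1 * cos x ^+ 2) * g x) by exact: continuous_mul.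
have c2 : continuous (fun x => cos x ^+ 2 * y x).
  by apply: continuous_mul => //; exact: good_continuous (good_exp _ good_cos).
apply/eqP; rewrite eq_sym -subr_eq0 -circ_sub//; apply/eqP.
have H : der (fun x => (2 / 3 - 3^-1 * (cos x * cos x)) * d x - 2 / 3 * (cos x * sin x) * y x)
  (fun x => (2 / 3 - 3^-1 * cos x ^+ 2) * g x - cos x ^+ 2 * y x).
  apply: (der_ext (der_sub (der_mul (der_sub (der_cst _) (der_scale _ (der_mul der_cos der_cos))) D')
    (der_mul (der_scale _ (der_mul der_cos der_sin)) D))) => x.
  have e : sin x * sin x = 1 - cos x ^+ 2 by rewrite -expr2 sin2cos2.
  transitivity ((2 / 3 - 3^-1 * cos x ^+ 2) * (g x - y x)
    + 2 / 3 * (sin x * sin x - cos x ^+ 2) * y x); first by field.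
  by rewrite e; field.
rewrite (circ_der _ H); last by apply: continuous_add => //; exact: continuous_opp.
have e0 (f : R -> R) : periodic2pi f -> f (2 * pi) = f 0 by move=> /(_ 0); rewrite add0r.
by rewrite !(e0 _ py) !(e0 _ (der_periodic D py)) (e0 _ cos2pi_periodic) (e0 _ sin2pi_periodic) subrr.
Qed.

End Calculus.

(** * The reduced system *)

Lemma half_le (R : realType) (x : R) : 0 <= x -> x / 2 <= x.
Proof. by lra. Qed.

(** * Contractions in sup norm *)

Section Contraction.
Variables (R : realType) (T : Type).
Implicit Types (S : set (T -> R)) (F : (T -> R) -> T -> R) (H : T -> R).

Lemma geometric_small (M e : R) : 0 < e -> exists n : nat, M / 2 ^+ n < e.
Proof.
move=> e0.
have [M0|M0] := leP M 0.
  by exists 0%N; rewrite expr0 divr1 (le_lt_trans M0).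
exists (Num.truncn (M / e)).+1.
rewrite ltr_pdivrMr ?exprn_gt0// mulrC -ltr_pdivrMr//.
apply: lt_le_trans (truncnS_gt (M / e)) _.
by rewrite -natrX ler_nat ltnW// ltn_expl.
Qed.

(** The sup distance enters only through its upper bounds [d], so neither boundedness of the
    functions nor a metric on [T -> R] is involved. *)
Definition contracting S F := forall H H' (d : R), S H -> S H' ->
  (forall t, `|H t - H' t| <= d) -> forall t, `|F H t - F H' t| <= d / 2.

Lemma contraction_uniq S F H H' (d : R) : contracting S F -> S H -> S H' ->
  F H =1 H -> F H' =1 H' -> (forall t, `|H t - H' t| <= d) -> H =1 H'.
Proof.
move=> ctr SH SH' FH FH' Hd.
have step (n : nat) : forall t, `|H t - H' t| <= d / 2 ^+ n.
  elim: n => [|n IH] t; first by rewrite expr0 divr1.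
  have := ctr _ _ _ SH SH' IH t; rewrite FH FH'.
  by rewrite exprSr invfM mulrA.
move=> t; apply/eqP; rewrite -subr_eq0 -normr_le0.
rewrite leNgt; apply/negP => /(geometric_small d)[n].
by rewrite ltNge step.
Qed.

Lemma contraction_exists S F H0 (M : R) : contracting S F -> S H0 ->
  (forall H, S H -> S (F H)) ->
  (forall H, (forall e : R, 0 < e -> exists2 H', S H' & forall t, `|H t - H' t| <= e) -> S H) ->
  (forall t, `|F H0 t - H0 t| <= M) ->
  exists2 H, S H & F H =1 H.
Proof.
move=> ctr SH0 SF cS FM.
pose u n := iter n F H0.
have Su n : S (u n) by elim: n => //= n IH; exact: SF.
have du n : forall t, `|u n.+1 t - u n t| <= M / 2 ^+ n.
  elim: n => [|n IH] t; first by rewrite expr0 divr1; exact: FM.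
  have := ctr _ _ _ (Su _) (Su _) IH t.
  by rewrite exprSr invfM mulrA.
(* The subtracted term is the tail of the geometric series; keeping it lets the induction on [k]
   close. *)
have duk n k : forall t, `|u (n + k)%N t - u n t| <= 2 * (M / 2 ^+ n) - 2 * (M / 2 ^+ (n + k)).
  elim: k => [|k IH] t; first by rewrite addn0 !subrr normr0.
  have -> : u (n + k.+1)%N t - u n t = (u (n + k).+1 t - u (n + k)%N t) + (u (n + k)%N t - u n t).
    by rewrite addnS; ring.
  apply: (le_trans (ler_normD _ _)).
  have := lerD (du (n + k)%N t) (IH t) => /le_trans; apply.
  by rewrite addnS exprSr invfM [X in _ <= _ - 2 * X]mulrA; set q := M / 2 ^+ (n + k); lra.
pose L t := limn (fun n => u n t).
have M0 (t : T) : 0 <= M by exact: le_trans (normr_ge0 _) (FM t).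
have tail n k t : `|u (n + k)%N t - u n t| <= 2 * M / 2 ^+ n.
  apply: (le_trans (duk n k t)); rewrite mulrA lerBlDr lerDl.
  by rewrite mulr_ge0// divr_ge0 ?(M0 t)// exprn_ge0.
have cL t : cvgn (fun n => u n t).
  apply: cauchy_cvg; apply: cauchy_exP => e e0.
  have [n ne] := geometric_small (2 * M) e0.
  exists (u n t); exists n => // k /= nk; rewrite /ball /= distrC.
  by rewrite -(subnKC nk); apply: le_lt_trans ne; exact: tail.
have uL n t : `|L t - u n t| <= 2 * M / 2 ^+ n.
  have c1 : (fun k => u k t - u n t) @ \oo --> L t - u n t.
    by apply: cvgB; [exact: cL|exact: cvg_cst].
  have c2 : (fun k => `|u k t - u n t|) @ \oo --> `|L t - u n t| by exact: cvg_norm c1.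
    rewrite -(cvg_lim _ c2)//.
  apply: limr_le; first by apply/cvg_ex; eexists; exact: c2.
  by exists n => // k /= nk; rewrite -(subnKC nk); exact: tail.
have SL : S L.
  apply: cS => e e0; have [n ne] := geometric_small (2 * M) e0.
  by exists (u n) => // t; apply: le_trans (ltW ne); exact: uL.
exists L => // t; apply/eqP; rewrite -subr_eq0 -normr_le0.
rewrite leNgt; apply/negP => /(geometric_small (2 * M + 2 * M))[n].
rewrite ltNge => /negP; apply.
have -> : F L t - L t = (F L t - F (u n) t) + (u n.+1 t - L t) by rewrite /=; ring.
apply: (le_trans (ler_normD _ _)).
rewrite mulrDl; apply: lerD.
  apply: (le_trans (ctr _ _ _ SL (Su n) (uL n) t)).
  by apply: half_le; rewrite divr_ge0 ?exprn_ge0// mulr_ge0// (M0 t).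
rewrite distrC; apply: le_trans (uL _ _) _.
rewrite exprSr invfM mulrA.
by apply: half_le; rewrite divr_ge0 ?exprn_ge0// mulr_ge0// (M0 t).
Qed.

End Contraction.

Lemma uniform_limit_continuous_ex (R : realType) (f : R -> R) :
  (forall e : R, 0 < e -> exists2 g, continuous g & forall x, `|f x - g x| <= e) ->
  continuous f.
Proof.
move=> H x; apply/cvgrPdist_lt => e e0.
have [|g cg fg] := H (e / 4); first by rewrite divr_gt0.
have /cvgrPdist_lt/(_ (e / 4)) := cg x.
rewrite divr_gt0// => /(_ isT); apply: filterS => y xy.
have -> : f x - f y = (f x - g x) + (g x - g y) - (f y - g y) by ring.
apply: (le_lt_trans (ler_normB _ _)).
have := ler_normD (f x - g x) (g x - g y); have := fg x; have := fg y; lra.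
Qed.

(** * Propagation of bounds and Lipschitz constants *)

Section Lipschitz.
Variables (R : realType) (D : R).
Implicit Types (B L x y c : R).

(** Here [x] and [x'] are the values of one expression at two states at distance [D]. Carrying the
    bound [B] together with the Lipschitz constant [L] is what makes the product rule available;
    [D = 0] yields plain bounds. *)
Definition lip B L x x' := [/\ `|x| <= B, `|x'| <= B & `|x - x'| <= L * D].

Lemma lip_cst c B : `|c| <= B -> lip B 0 c c.
Proof. by move=> cB; split=> //; rewrite subrr normr0 mul0r. Qed.

Lemma lip_add B1 L1 B2 L2 x x' y y' : lip B1 L1 x x' -> lip B2 L2 y y' ->
  lip (B1 + B2) (L1 + L2) (x + y) (x' + y').
Proof.
move=> [h1 h2 h3] [k1 k2 k3]; split.
- by apply: (le_trans (ler_normD _ _)); exact: lerD.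
- by apply: (le_trans (ler_normD _ _)); exact: lerD.
- rewrite opprD addrACA mulrDl.
  by apply: (le_trans (ler_normD _ _)); exact: lerD.
Qed.

Lemma lip_opp B L x x' : lip B L x x' -> lip B L (- x) (- x').
Proof. by move=> [h1 h2 h3]; split; rewrite -?opprD normrN. Qed.

Lemma lip_sub B1 L1 B2 L2 x x' y y' : lip B1 L1 x x' -> lip B2 L2 y y' ->
  lip (B1 + B2) (L1 + L2) (x - y) (x' - y').
Proof. by move=> lx ly; apply: lip_add => //; exact: lip_opp. Qed.

Lemma lip_mul B1 L1 B2 L2 x x' y y' : lip B1 L1 x x' -> lip B2 L2 y y' ->
  lip (B1 * B2) (B1 * L2 + L1 * B2) (x * y) (x' * y').
Proof.
move=> [h1 h2 h3] [k1 k2 k3]; split.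
- by rewrite normrM; exact: ler_pM.
- by rewrite normrM; exact: ler_pM.
- have -> : x * y - x' * y' = x * (y - y') + (x - x') * y' by ring.
  apply: (le_trans (ler_normD _ _)); rewrite !normrM mulrDl; apply: lerD.
    by rewrite -mulrA; exact: ler_pM.
  by rewrite mulrAC; exact: ler_pM.
Qed.

Lemma lip_le B L B' L' x x' : 0 <= D -> lip B L x x' -> B <= B' -> L <= L' ->
  lip B' L' x x'.
Proof.
move=> D0 [h1 h2 h3] BB LL; split; [exact: le_trans BB|exact: le_trans BB|].
by apply: (le_trans h3); exact: ler_wpM2r.
Qed.

Lemma lip_eq B L x x' y y' : lip B L x x' -> x = y -> x' = y' -> lip B L y y'.
Proof. by move=> ? <- <-. Qed.

Lemma lip_coef B L (f f' : R -> R) : continuous f -> continuous f' ->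
  (forall x, lip B L (f x) (f' x)) -> lip (2 * B) (2 * L) (coef f) (coef f').
Proof.
move=> cf cf' ff; split.
- by apply: coef_bound => // x; case: (ff x).
- by apply: coef_bound => // x; case: (ff x).
- rewrite -coef_sub// -mulrA; apply: coef_bound; last by move=> x; case: (ff x).
  by apply: continuous_add => //; exact: continuous_opp.
Qed.

End Lipschitz.

(** [refine] leaves [B] and [L] open, so that unification computes the constants of a composite
    expression along its syntax tree; only two numerical inequalities remain. *)
Ltac lip_step := match goal with
  | H : lip _ _ _ ?x ?x' |- lip _ _ _ ?x ?x' => exact H
  | |- lip _ _ _ (_ - _) _ => refine (lip_sub _ _)
  | |- lip _ _ _ (_ + _) _ => refine (lip_add _ _)
  | |- lip _ _ _ (_ * _) _ => refine (lip_mul _ _)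
  | |- lip _ _ _ (- _) _ => refine (lip_opp _)
  end.

Ltac lip_num d0 :=
  apply: (lip_le d0); [repeat lip_step | clear; lra | clear; lra].

(** * The fixed point equation for the profile and the amplitude factor *)

Section ReducedDefs.
Variable R : realType.
Variables mu b s : R.
Implicit Types (a c t : R) (h : R -> R).

(** Up to the factor [mu], the coefficient of the quadratic self-interaction of the critical mode.
    It is small because [b] and [mu - 1] are. *)
Definition eta := (1 + b / 2) * mu - 1.

(* With c = cos, W = a (c + a y) and u1 = mu a (c + a (y - z)), the nonlinearity is
   a^2 (mu eta c^2 + a cubic_part). *)
Definition cubic_part a c (y z : R) :=
  mu * (y - z) * (eta * c + a * (eta * y - (1 + b / 2) * mu * z))
  + mu * c * (eta * y - (1 + b / 2) * mu * z)
  - (mu * (c + a * (y - z))) ^+ 2 * (c + a * y + mu * (c + a * (y - z))) / 4.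

(** The critical component of the equation is [mu s^2 a = - coef q]; as [cos^2] has no critical
    component, dividing by [a s^2] turns it into [mu = t^2 Phi]. To leading order [cubic_part] is
    [- cos^3 / 2], whence [Phi] is close to 3/8. *)
Definition Phi t (y z : R -> R) :=
  - coef (fun x => cubic_part (s * t) (cos x) (y x) (z x)).

(** In terms of [h], [z], [y] the linear part is [mu^2 h + mu (b - 2 (mu - 1)) z - mu s^2 y] off the
    critical mode. Only [h] is kept on the left, the rest [(mu^2 - 1) h] of the leading term being
    moved to the right, so every term on the right carries a small factor. [Phi cos] removes the
    critical component of [cubic_part]. *)
Definition range_map h t (y z : R -> R) (x : R) :=
  mu * eta * cos x ^+ 2
  + s * t * (cubic_part (s * t) (cos x) (y x) (z x) + Phi t y z * cos x)
  - mu * (b - 2 * (mu - 1)) * z x + mu * s ^+ 2 * y x - (mu ^+ 2 - 1) * h x.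

(* A simplified Newton step at t = 33/20, which is close to sqrt (8/3): there the
   derivative of t^2 Phi is about 2 * 33/20 * 3/8, close to 5/4. *)
Definition bif_map t (y z : R -> R) := t + 4 / 5 * (mu - t ^+ 2 * Phi t y z).

Definition reduced (h : R -> R) t (y z : R -> R) := [/\ good h, coef h = 0, osc h z & osc z y] /\
  (h =1 range_map h t y z /\ mu = t ^+ 2 * Phi t y z).

End ReducedDefs.

(** * Unique solvability of the reduced system *)

Section Reduced.
Variable R : realType.

Definition small_params (mu b s del : R) :=
  [/\ `|mu - 1| <= del, 0 <= b <= del & 0 <= s <= del].

(** [rho] is the radius of the ball for [h]. As 48 is the norm bound of [osc_bound], the second
    condition keeps [z] and [y] below 1/100; the third makes terms with a factor of size [del]
    negligible against [rho]. *)
Definition small_consts (del rho : R) :=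
  [/\ 0 < rho, 48 * (48 * rho) <= 1 / 100 & 100 * del <= rho].

Lemma small_consts_le (del rho : R) : small_consts del rho -> del <= 1 / 4000.
Proof. by move=> [h1 h2 h3]; lra. Qed.

Lemma eta_small (mu b s del rho : R) : small_params mu b s del -> small_consts del rho ->
  `|(eta mu b)| <= 2 * del.
Proof.
move=> sp sc; have dl := small_consts_le sc.
have [/ler_normlP[h1 h2] /andP[b0 b1] _] := sp.
by rewrite /eta; apply/ler_normlP; split; nra.
Qed.

(** Adding [c^3 / 2] cancels the leading term. What is left is small mainly because [y] and [z] are
    at most 1/100; the term [c^2 z] dominates. *)
Lemma cubic_part_lip (mu b s del rho d t t' c y y' z z' : R) : small_params mu b s del -> small_consts del rho ->
  0 <= d -> `|c| <= 1 ->
  lip d 2 1 t t' -> lip d (1/100) (1/100) y y' -> lip d (1/100) (1/100) z z' ->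
  lip d (11/1000) (11/1000) (cubic_part mu b (s * t) c y z + c ^+ 3 / 2)
    (cubic_part mu b (s * t') c y' z' + c ^+ 3 / 2).
Proof.
move=> sp sc d0 c1 lt ly lz.
have dl := small_consts_le sc; have [r0 rs dr] := sc.
have [m1 /andP[b0 b1] /andP[s0 s1]] := sp.
have ls : lip d (1/4000) 0 s s by apply: lip_cst; rewrite ger0_norm//; clear -dl s1; lra.
have lc := lip_cst d c1.
have le : lip d (2/4000) 0 (eta mu b) (eta mu b).
  by apply: lip_cst; apply: le_trans (eta_small sp sc) _; clear -dl; lra.
have lmu : lip d (1001/1000) 0 mu mu.
  by apply: lip_cst; move/ler_normlP : m1 => [m2 m3]; apply/ler_normlP; split; clear -dl b0 b1 m2 m3; lra.
have lm : lip d (1/4000) 0 (mu - 1) (mu - 1).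
  by apply: lip_cst; apply: le_trans m1 _; clear -dl; lra.
have lk : lip d (1001/1000) 0 (1 + b / 2) (1 + b / 2).
  by apply: lip_cst; apply/ler_normlP; split; clear -dl b0 b1; lra.
have l4 : lip d (1/4) 0 (4^-1) 4^-1 by apply: lip_cst; rewrite ger0_norm; clear; lra.
have l2 : lip d 2 0 2 2 by apply: lip_cst; rewrite ger0_norm.
have la : lip d (2 / 4000) (1 / 4000) (s * t) (s * t').
  lip_num d0.
have lyz : lip d (2/100) (2/100) (y - z) (y' - z').
  lip_num d0.
have lw : lip d (51/5000) (51/5000) ((eta mu b) * y - (1 + b / 2) * mu * z) ((eta mu b) * y' - (1 + b / 2) * mu * z').
  lip_num d0.
(* With [mu (c + a (y - z)) = c + p] and [c + a y + (c + p) = 2 c + r], the cubic product minus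
   [c^3 / 2] becomes an expression in which each term contains [p] or [r]: the cancellation is made
   before anything is estimated. *)
set p := (mu - 1) * c + mu * (s * t * (y - z)).
set p' := (mu - 1) * c + mu * (s * t' * (y' - z')).
have lp : lip d (1/3000) (1/3000) p p'.
  rewrite /p /p'; lip_num d0.
set r := s * t * y + p; set r' := s * t' * y' + p'.
have lr : lip d (1/2500) (1/2500) r r'.
  rewrite /r /r'; lip_num d0.
have lA : lip d (1/5000) (1/5000)
  (mu * (y - z) * ((eta mu b) * c + s * t * ((eta mu b) * y - (1 + b / 2) * mu * z)))
  (mu * (y' - z') * ((eta mu b) * c + s * t' * ((eta mu b) * y' - (1 + b / 2) * mu * z'))).
  lip_num d0.
have lC : lip d (1/2000) (1/2000)
  (((2 * c * p + p * p) * (2 * c + r) + c * c * r) * 4^-1)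
  (((2 * c * p' + p' * p') * (2 * c + r') + c * c * r') * 4^-1).
  lip_num d0.
have lB : lip d (41/4000) (41/4000)
  (mu * c * ((eta mu b) * y - (1 + b / 2) * mu * z))
  (mu * c * ((eta mu b) * y' - (1 + b / 2) * mu * z')).
  lip_num d0.
have H := lip_sub (lip_add lA lB) lC.
apply: (lip_le d0 (lip_eq H _ _)); [|
  |by clear; lra|by clear; lra].
  by rewrite /cubic_part /r /p; field.
by rewrite /cubic_part /r' /p'; field.
Qed.

Lemma good_cubic_part (mu b s t : R) (y z : R -> R) : good y -> good z ->
  good (fun x => cubic_part mu b (s * t) (cos x) (y x) (z x)).
Proof.
move=> gy gz; rewrite /cubic_part.
repeat first [assumption | exact: good_cos | exact: good_cst | apply: good_add |
  apply: good_opp | apply: good_mul | apply: good_exp].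
Qed.

(** [cos^3 / 2] has critical coefficient 3/8, so the estimate of [cubic_part] carries over through
    [coef], at the cost of a factor 2. *)
Lemma Phi_lip (mu b s del rho d t t' : R) (y y' z z' : R -> R) : small_params mu b s del -> small_consts del rho ->
  0 <= d ->
  good y -> good z -> good y' -> good z' -> lip d 2 1 t t' ->
  (forall x, lip d (1/100) (1/100) (y x) (y' x)) ->
  (forall x, lip d (1/100) (1/100) (z x) (z' x)) ->
  lip d (22/1000) (22/1000) (Phi mu b s t y z - 3 / 8) (Phi mu b s t' y' z' - 3 / 8).
Proof.
move=> sp sc d0 gy gz gy' gz' lt ly lz.
have gc3 : good (fun x : R => cos x ^+ 3 / 2).
  by apply: good_mul; [exact: good_exp (good_cos R)|exact: good_cst].
have PhiE u v w : good v -> good w -> - coef (fun x => cubic_part mu b (s * u) (cos x) (v x) (w x)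
    + cos x ^+ 3 / 2) = Phi mu b s u v w - 3 / 8.
  move=> gv gw; rewrite coef_add; [|by apply: good_continuous; exact: good_cubic_part|exact: good_continuous].
  rewrite opprD; congr (_ - _).
  rewrite (@coef_ext _ _ (fun x => 2^-1 * cos x ^+ 3)); last by move=> x; rewrite mulrC.
  rewrite coef_scale ?coef_cos3; first by field.
  exact: good_continuous (good_exp _ (good_cos R)).
have gcc u v w : good v -> good w -> continuous (fun x => cubic_part mu b (s * u) (cos x) (v x) (w x)
    + cos x ^+ 3 / 2).
  by move=> gv gw; apply: good_continuous; apply: good_add => //; exact: good_cubic_part.
rewrite -!PhiE//; apply: lip_opp.
have /(lip_le d0) := lip_coef (gcc t y z gy gz) (gcc t' y' z' gy' gz')
  (fun x => cubic_part_lip sp sc d0 (cos_max x) lt (ly x) (lz x)).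
by apply; clear; lra.
Qed.

(** Each term has one of the factors [eta], [s], [b - 2 (mu - 1)], [s^2], [mu^2 - 1], all of size at
    most [3 del], and [100 del <= rho]. *)
Lemma range_map_lip (mu b s del rho d t t' x : R) (h h' y y' z z' : R -> R) : small_params mu b s del -> small_consts del rho ->
  0 <= d ->
  good y -> good z -> good y' -> good z' -> lip d 2 1 t t' ->
  (forall x, lip d (1/100) (1/100) (h x) (h' x)) ->
  (forall x, lip d (1/100) (1/100) (y x) (y' x)) ->
  (forall x, lip d (1/100) (1/100) (z x) (z' x)) ->
  lip d rho (rho / 2) (range_map mu b s h t y z x) (range_map mu b s h' t' y' z' x).
Proof.
move=> sp sc d0 gy gz gy' gz' lt lh ly lz.
have dl := small_consts_le sc; have [r0 rs dr] := sc.
have [m1 /andP[b0 b1] /andP[s0 s1]] := sp.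
have ls : lip d del 0 s s by apply: lip_cst; rewrite ger0_norm.
have lc := lip_cst d (cos_max x).
have le : lip d (2 * del) 0 (eta mu b) (eta mu b) by apply: lip_cst; exact: eta_small sp sc.
have lmu : lip d (1001/1000) 0 mu mu.
  by apply: lip_cst; move/ler_normlP : m1 => [m2 m3]; apply/ler_normlP; split; clear -dl b0 b1 m2 m3; lra.
have lb : lip d (3 * del) 0 (b - 2 * (mu - 1)) (b - 2 * (mu - 1)).
  by apply: lip_cst; move/ler_normlP : m1 => [m2 m3]; apply/ler_normlP; split; clear -dl b0 b1 m2 m3; lra.
have lm2 : lip d (3 * del) 0 (mu ^+ 2 - 1) (mu ^+ 2 - 1).
  by apply: lip_cst; move/ler_normlP : m1 => [m2 m3]; apply/ler_normlP; split; clear -dl m2 m3; nra.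
have ls2 : lip d del 0 (s ^+ 2) (s ^+ 2).
  by apply: lip_cst; rewrite ger0_norm ?sqr_ge0//; clear -dl s0 s1; nra.
have lP : lip d 1 (22/1000) (Phi mu b s t y z) (Phi mu b s t' y' z').
  have lP := Phi_lip sp sc d0 gy gz gy' gz' lt ly lz.
  have l3 : lip d (3/8) 0 (3/8) (3/8 : R) by apply: lip_cst; rewrite ger0_norm; clear; lra.
  by apply: lip_le d0 (lip_eq (lip_add lP l3) _ _) _ _; [ring|ring|clear; lra|clear; lra].
have lR : lip d 1 (11/1000) (cubic_part mu b (s * t) (cos x) (y x) (z x))
    (cubic_part mu b (s * t') (cos x) (y' x) (z' x)).
  have lR := cubic_part_lip sp sc d0 (cos_max x) lt (ly x) (lz x).
  have l3 : lip d (1/2) 0 (cos x * (cos x * (cos x * 2^-1))) (cos x * (cos x * (cos x * 2^-1))).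
    have l2 : lip d (1/2) 0 (2^-1 : R) 2^-1 by apply: lip_cst; rewrite ger0_norm; clear; lra.
    lip_num d0.
  by apply: lip_le d0 (lip_eq (lip_sub lR l3) _ _) _ _; [ring|ring|clear; lra|clear; lra].
have := ly x; have := lz x; have := lh x => lhx lzx lyx.
apply: (@lip_eq _ _ _ _ (mu * (eta mu b) * (cos x * cos x)
  + s * t * (cubic_part mu b (s * t) (cos x) (y x) (z x) + Phi mu b s t y z * cos x)
  - mu * (b - 2 * (mu - 1)) * z x + mu * s ^+ 2 * y x - (mu ^+ 2 - 1) * h x)
  (mu * (eta mu b) * (cos x * cos x)
  + s * t' * (cubic_part mu b (s * t') (cos x) (y' x) (z' x) + Phi mu b s t' y' z' * cos x)
  - mu * (b - 2 * (mu - 1)) * z' x + mu * s ^+ 2 * y' x - (mu ^+ 2 - 1) * h' x)) => //.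
apply: (lip_le d0); [repeat lip_step|clear -dr dl rs r0; lra|clear -dr dl rs r0; lra].
Qed.

(** Differences factor through [(t - t') (1 - 4/5 (t + t') P)], where the Newton factor 4/5 brings
    the second factor below 22/100. The remaining margin up to 1/2 absorbs the variation of
    [Phi]. *)
Lemma bif_map_lip (mu b s del rho d t t' : R) (y y' z z' : R -> R) : small_params mu b s del -> small_consts del rho ->
  0 <= d ->
  good y -> good z -> good y' -> good z' ->
  lip d 2 1 t t' -> `|t - 33/20| <= 1/4 -> `|t' - 33/20| <= 1/4 ->
  (forall x, lip d (1/100) (1/100) (y x) (y' x)) ->
  (forall x, lip d (1/100) (1/100) (z x) (z' x)) ->
  `|bif_map mu b s t y z - 33/20| <= 1/4 /\ `|bif_map mu b s t y z - bif_map mu b s t' y' z'| <= d / 2.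
Proof.
move=> sp sc d0 gy gz gy' gz' lt tb tb' ly lz.
have dl := small_consts_le sc.
have [m1 _ _] := sp.
have [P1 P2 P3] := Phi_lip sp sc d0 gy gz gy' gz' lt ly lz.
have {}P3 : `|Phi mu b s t y z - Phi mu b s t' y' z'| <= 22/1000 * d.
  by rewrite (_ : _ - _ = Phi mu b s t y z - 3 / 8 - (Phi mu b s t' y' z' - 3 / 8)) //; ring.
have [_ _ dt] := lt; rewrite mul1r in dt.
move: P1 P2 P3 m1 tb tb' dt; rewrite /bif_map.
set P := Phi mu b s t y z; set P' := Phi mu b s t' y' z'.
move=> P1 P2 P3 m1 tb tb' dt.
have [a1 a2] := ler_normlP _ _ P1; have [b1 b2] := ler_normlP _ _ P2.
have [c1 c2] := ler_normlP _ _ m1; have [e1 e2] := ler_normlP _ _ tb.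
have [f1 f2] := ler_normlP _ _ tb'.
(* [u] stands for a sum of two points of the interval [[7/5, 19/10]] around 33/20. *)
have small (u : R) : 279/100 <= u <= 381/100 -> `|1 - 4/5 * (u * P)| <= 22/100.
  by move=> /andP[u1 u2]; apply/ler_normlP; split; clear -a1 a2 u1 u2; nra.
split.
  have -> : t + 4 / 5 * (mu - t ^+ 2 * P) - 33 / 20 =
    (t - 33/20) * (1 - 4/5 * ((t + 33/20) * P)) + 4/5 * (mu - (33/20) ^+ 2 * P) by field.
  apply: (le_trans (ler_normD _ _)); rewrite normrM.
  have k1 : `|t - 33/20| * `|1 - 4/5 * ((t + 33/20) * P)| <= 1/4 * (22/100).
    by apply: ler_pM => //; apply: small; clear -e1 e2 f1 f2; lra.
  have k2 : `|4/5 * (mu - (33/20) ^+ 2 * P)| <= 8/100.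
    by apply/ler_normlP; split; clear -c1 c2 a1 a2 dl; lra.
  by clear -k1 k2; lra.
have -> : t + 4 / 5 * (mu - t ^+ 2 * P) - (t' + 4 / 5 * (mu - t' ^+ 2 * P')) =
  (t - t') * (1 - 4/5 * ((t + t') * P)) - 4/5 * (t' ^+ 2 * (P - P')) by ring.
apply: (le_trans (ler_normB _ _)); rewrite normrM [X in _ + X]normrM [X in _ + _ * X]normrM.
have k1 : `|t - t'| * `|1 - 4/5 * ((t + t') * P)| <= d * (22/100).
  by apply: ler_pM => //; apply: small; clear -e1 e2 f1 f2; lra.
have k2 : `|t' ^+ 2| * `|P - P'| <= 4 * (22/1000 * d).
  by apply: ler_pM => //; rewrite ger0_norm ?sqr_ge0//; clear -f1 f2; nra.
rewrite (@ger0_norm _ (4/5)); last by clear; lra.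
clear -k1 k2 d0; lra.
Qed.

(* The state is a single function on [option R], so that one sup-norm contraction
   determines the profile [h] (on [Some x], rescaled by [rho]) and the amplitude
   factor (on [None]) at once. *)
Definition profile (rho : R) (H : option R -> R) (x : R) := rho * H (Some x).

Definition state_space (rho : R) : set (option R -> R) := [set H |
  [/\ good (profile rho H), coef (profile rho H) = 0,
      forall x, `|H (Some x)| <= 1 & `|H None - 33 / 20| <= 1 / 4]].

Definition osc_inv (g : R -> R) : R -> R := xget (fun=> 0) [set y | osc g y].

Lemma osc_invP g : good g -> coef g = 0 -> osc g (osc_inv g).
Proof. by move=> gg c0; have [y yg] := osc_exists gg c0; exact: (xgetI _ yg). Qed.

Definition state_map (mu b s rho : R) (H : option R -> R) (i : option R) : R :=
  let z := osc_inv (profile rho H) in let y := osc_inv z in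
  if i is Some x then rho^-1 * range_map mu b s (profile rho H) (H None) y z x
  else bif_map mu b s (H None) y z.

Lemma state_lip (del rho d : R) H H' : small_consts del rho -> 0 <= d ->
  state_space rho H -> state_space rho H' -> (forall i, `|H i - H' i| <= d) ->
  let z := osc_inv (profile rho H) in let y := osc_inv z in
  let z' := osc_inv (profile rho H') in let y' := osc_inv z' in
  [/\ osc (profile rho H) z, osc z y, osc (profile rho H') z' & osc z' y'] /\
  [/\ lip d 2 1 (H None) (H' None),
      forall x, lip d (1/100) (1/100) (profile rho H x) (profile rho H' x),
      forall x, lip d (1/100) (1/100) (y x) (y' x) &
      forall x, lip d (1/100) (1/100) (z x) (z' x)].
Proof.
move=> [r0 rs _] d0 [gh ch hb hN] [gh' ch' hb' hN'] HH.
move=> z y z' y'.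
have oz : osc (profile rho H) z by exact: osc_invP.
have oz' : osc (profile rho H') z' by exact: osc_invP.
have oy : osc z y by apply: osc_invP; case: oz.
have oy' : osc z' y' by apply: osc_invP; case: oz'.
split; first by split.
have key (C : R) : 0 <= C -> C * rho <= 1/100 ->
    forall u v, (forall x, `|u x| <= C * rho) -> (forall x, `|v x| <= C * rho) ->
    (forall x, `|u x - v x| <= C * (rho * d)) ->
    forall x : R, lip d (1/100) (1/100) (u x) (v x).
  move=> C0 Cr u v ub vb uv x; split.
  - exact: le_trans (ub x) Cr.
  - exact: le_trans (vb x) Cr.
  - by apply: le_trans (uv x) _; rewrite mulrA ler_wpM2r.
have pb x : `|profile rho H x| <= rho.
  by rewrite /profile normrM gtr0_norm// ger_pMr.
have pb' x : `|profile rho H' x| <= rho.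
  by rewrite /profile normrM gtr0_norm// ger_pMr.
have pd x : `|profile rho H x - profile rho H' x| <= rho * d.
  by rewrite /profile -mulrBr normrM gtr0_norm// ler_wpM2l// ltW.
have zb := osc_bound oz pb; have zb' := osc_bound oz' pb'.
have zd := osc_bound (osc_sub oz oz') pd.
have yb := osc_bound oy zb; have yb' := osc_bound oy' zb'.
have yd := osc_bound (osc_sub oy oy') zd.
split.
- have [e1 e2] := ler_normlP _ _ hN; have [f1 f2] := ler_normlP _ _ hN'.
  split; last by rewrite mul1r.
  + by apply/ler_normlP; split; clear -e1 e2; lra.
  + by apply/ler_normlP; split; clear -f1 f2; lra.
- apply: (key 1) => //; first (by clear -r0 rs; lra); by move=> x; rewrite mul1r.
- apply: (key (48 * 48)) => //; first by rewrite -mulrA.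
  + by move=> x; rewrite -mulrA.
  + by move=> x; rewrite -mulrA.
  + by move=> x; rewrite -mulrA.
- apply: (key 48) => //; by clear -r0 rs; lra.
Qed.

Lemma range_map_good (mu b s t : R) (h y z : R -> R) : good h -> good y -> good z ->
  good (range_map mu b s h t y z).
Proof.
move=> gh gy gz; have gc := good_cubic_part mu b s t gy gz.
rewrite /range_map.
by repeat first [assumption | exact: gc | exact: good_cos | exact: good_cst |
  apply: good_add | apply: good_opp | apply: good_mul | apply: good_exp].
Qed.

(** This is where the choice of [Phi] matters: [Phi cos] cancels the critical component of
    [cubic_part], while [cos^2] has none. It makes the space of states invariant. *)
Lemma range_map_coef (mu b s t : R) (h y z : R -> R) : good h -> good y -> good z ->
  coef h = 0 -> coef y = 0 -> coef z = 0 -> coef (range_map mu b s h t y z) = 0.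
Proof.
move=> gh gy gz ch cy cz; have gc := good_cubic_part mu b s t gy gz.
have g2 : good (fun x : R => cos x ^+ 2) by apply: good_exp; exact: good_cos.
have gs (k : R) (f : R -> R) : good f -> good (fun x => k * f x).
  by move=> gf; apply: good_mul => //; exact: good_cst.
have gP : good (fun x => Phi mu b s t y z * cos x) by apply: gs; exact: good_cos.
have gN (k : R) (f : R -> R) : good f -> continuous (fun x => k * f x).
  by move=> gf; exact: good_continuous (gs _ _ gf).
have cN (k : R) (f : R -> R) : good f -> coef (fun x => k * f x) = k * coef f.
  by move=> gf; rewrite coef_scale//; exact: good_continuous.
rewrite /range_map coef_sub.
- rewrite coef_add.
  + rewrite coef_sub.
    * rewrite coef_add.
      - rewrite !cN// ?ch ?cy ?cz ?coef_cos2 ?mulr0; last exact: good_add.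
        rewrite coef_add; [|exact: good_continuous|exact: good_continuous].
        rewrite cN ?coef_cos; last exact: good_cos.
        by rewrite mulr1 /Phi subrr; ring.
      - exact: gN.
      - by apply: gN; exact: good_add.
    * by apply: continuous_add; apply: gN => //; exact: good_add.
    * exact: gN.
  + apply: continuous_add; last by apply: continuous_opp; exact: gN.
    by apply: continuous_add; apply: gN => //; exact: good_add.
  + exact: gN.
- apply: continuous_add; last exact: gN.
  apply: continuous_add; last by apply: continuous_opp; exact: gN.
  by apply: continuous_add; apply: gN => //; exact: good_add.
- exact: gN.
Qed.

Lemma state_map_contracting (mu b s del rho : R) : small_params mu b s del ->
  small_consts del rho -> contracting (state_space rho) (state_map mu b s rho).
Proof.
move=> sp sc H H' d SH SH' HH.
have d0 : 0 <= d by exact: le_trans (normr_ge0 _) (HH None).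
have [r0 _ _] := sc.
have [[oz oy oz' oy'] [lt lh ly lz]] := state_lip sc d0 SH SH' HH.
have [gz _ _] := oz; have [gy _ _] := oy; have [gz' _ _] := oz'; have [gy' _ _] := oy'.
case=> [x|]; rewrite /state_map.
  have [_ _] := range_map_lip x sp sc d0 gy gz gy' gz' lt lh ly lz.
  rewrite -mulrBr normrM gtr0_norm ?invr_gt0// ler_pdivrMl// => /le_trans; apply.
  by rewrite mulrAC mulrA.
have [_ _ _ hN] := SH; have [_ _ _ hN'] := SH'.
by have [_] := bif_map_lip sp sc d0 gy gz gy' gz' lt hN hN' ly lz.
Qed.

Lemma state_map_stable (mu b s del rho : R) H : small_params mu b s del ->
  small_consts del rho -> state_space rho H -> state_space rho (state_map mu b s rho H).
Proof.
move=> sp sc SH.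
have [r0 _ _] := sc.
have HH i : `|H i - H i| <= 0 by rewrite subrr normr0.
have [[oz oy _ _] [lt lh ly lz]] := state_lip sc (lexx _) SH SH HH.
have [gz cz _] := oz; have [gy cy _] := oy.
have [gh ch hb hN] := SH.
have pE : profile rho (state_map mu b s rho H) =
    range_map mu b s (profile rho H) (H None) (osc_inv (osc_inv (profile rho H))) (osc_inv (profile rho H)).
  by apply/funext => x; rewrite /profile /= mulVKf// gt_eqF.
split.
- by rewrite pE; exact: range_map_good.
- by rewrite pE; exact: range_map_coef.
- move=> x; rewrite /state_map.
  have [+ _ _] := range_map_lip x sp sc (lexx _) gy gz gy gz lt lh ly lz.
  by rewrite normrM gtr0_norm ?invr_gt0// ler_pdivrMl// mulr1.
- by have [] := bif_map_lip sp sc (lexx _) gy gz gy gz lt hN hN ly lz.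
Qed.

Lemma state_space_closed (rho : R) H : 0 < rho ->
  (forall e : R, 0 < e -> exists2 H', state_space rho H' & forall t, `|H t - H' t| <= e) ->
  state_space rho H.
Proof.
move=> r0 app.
have le_eps (x c : R) : (forall e, 0 < e -> x <= c + e) -> x <= c by move/ler_addgt0Pr.
have eq_eps (x y : R) : (forall e, 0 < e -> `|x - y| <= e) -> x = y.
  move=> xy; apply/eqP; rewrite -subr_eq0 -normr_le0; apply: le_eps => e e0.
  by rewrite add0r; exact: xy.
have papp (e : R) : 0 < e -> exists2 H', state_space rho H' &
    forall x, `|profile rho H x - profile rho H' x| <= e.
  move=> e0; have [|H' SH' HH'] := app (e / rho); first exact: divr_gt0.
  exists H' => // x; rewrite /profile -mulrBr normrM gtr0_norm// -ler_pdivlMl//.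
  by rewrite mulrC; exact: HH'.
have cH : continuous (profile rho H).
  apply: uniform_limit_continuous_ex => e e0; have [H' [gH' _ _ _] HH'] := papp _ e0.
  by exists (profile rho H') => //; exact: good_continuous.
have gH : good (profile rho H).
  split=> //.
  - move=> x; apply: eq_eps => e e0.
    have [|H' [[_ eH' _] _ _ _] HH'] := papp (e / 2); first by rewrite divr_gt0.
    have := HH' (- x); rewrite eH'; have := HH' x.
    move=> /ler_normlP[a1 a2] /ler_normlP[b1 b2]; apply/ler_normlP.
    by split; clear -a1 a2 b1 b2; lra.
  - move=> x; apply: eq_eps => e e0.
    have [|H' [[_ _ pH'] _ _ _] HH'] := papp (e / 2); first by rewrite divr_gt0.
    have := HH' (x + 2 * pi); rewrite pH'; have := HH' x.
    move=> /ler_normlP[a1 a2] /ler_normlP[b1 b2]; apply/ler_normlP.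
    by split; clear -a1 a2 b1 b2; lra.
split=> //.
- apply: eq_eps => e e0; have [|H' [gH' cH' _ _] HH'] := papp (e / 2); first by rewrite divr_gt0.
  rewrite -cH' -coef_sub//; last exact: good_continuous.
  have -> : e = 2 * (e / 2) by field.
  apply: coef_bound => //.
  by apply: continuous_add => //; apply: continuous_opp; exact: good_continuous.
- move=> x; apply: le_eps => e e0; have [H' [_ _ bH' _] HH'] := app e e0.
  rewrite -(subrK (H' (Some x)) (H (Some x))) addrC.
  by apply: (le_trans (ler_normD _ _)); exact: lerD.
- apply: le_eps => e e0; have [H' [_ _ _ nH'] HH'] := app e e0.
  have -> : H None - 33 / 20 = (H' None - 33 / 20) + (H None - H' None) by ring.
  by apply: (le_trans (ler_normD _ _)); exact: lerD.
Qed.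

Lemma reduced_exists (mu b s del rho : R) : small_params mu b s del ->
  small_consts del rho -> exists h t y z,
  [/\ reduced mu b s h t y z, forall x, `|h x| <= rho & `|t - 33 / 20| <= 1 / 4].
Proof.
move=> sp sc; have [r0 _ _] := sc.
pose H0 (i : option R) : R := if i is Some _ then 0 else 33 / 20.
have S0 : state_space rho H0.
  have -> : state_space rho H0 = [/\ good (profile rho H0), coef (profile rho H0) = 0,
    forall x, `|H0 (Some x)| <= 1 & `|H0 None - 33 / 20| <= 1 / 4] by [].
  have -> : profile rho H0 = fun=> 0 by apply/funext => x; rewrite /profile mulr0.
  split; [exact: good_cst|exact: coef_cst|by move=> x; rewrite normr0|].
  by rewrite subrr normr0.
have SF H : state_space rho H -> state_space rho (state_map mu b s rho H).
  exact: state_map_stable sp sc.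
have M0 i : `|state_map mu b s rho H0 i - H0 i| <= 1.
  have [_ _ b1 bN] := SF _ S0.
  case: i => [x|]; first by rewrite subr0.
  by apply: (le_trans bN); clear; lra.
have [H SH FH] := contraction_exists (state_map_contracting sp sc) S0 SF
  (fun H => state_space_closed r0) M0.
have [gh ch hb hN] := SH.
have oz := osc_invP gh ch.
have oy : osc (osc_inv (profile rho H)) (osc_inv (osc_inv (profile rho H))).
  by apply: osc_invP; case: oz.
exists (profile rho H), (H None), (osc_inv (osc_inv (profile rho H))), (osc_inv (profile rho H)).
split=> //; last by move=> x; rewrite /profile normrM gtr0_norm// ger_pMr.
split; first by split.
split=> [x|].
  by rewrite /profile -FH /= mulVKf// gt_eqF.
have := FH None; rewrite /state_map /bif_map => /eqP.
rewrite -[X in _ == X]addr0 (inj_eq (addrI _)) mulf_eq0 => /orP[|].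
  by rewrite mulf_eq0 invr_eq0 !pnatr_eq0.
by rewrite subr_eq0 => /eqP.
Qed.

Lemma reduced_uniq (mu b s del rho : R) h t y z h' t' y' z' :
  small_params mu b s del -> small_consts del rho ->
  reduced mu b s h t y z -> (forall x, `|h x| <= rho) -> `|t - 33 / 20| <= 1 / 4 ->
  reduced mu b s h' t' y' z' -> (forall x, `|h' x| <= rho) -> `|t' - 33 / 20| <= 1 / 4 ->
  [/\ h = h', t = t', y = y' & z = z'].
Proof.
move=> sp sc; have [r0 _ _] := sc.
pose st (h : R -> R) t (i : option R) := if i is Some x then rho^-1 * h x else t.
have pst (f : R -> R) u : profile rho (st f u) = f.
  by apply/funext => x; rewrite /profile /= mulVKf// gt_eqF.
have key f u v w : reduced mu b s f u v w -> (forall x, `|f x| <= rho) -> `|u - 33 / 20| <= 1 / 4 ->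
    [/\ state_space rho (st f u), state_map mu b s rho (st f u) =1 st f u,
        w = osc_inv f & v = osc_inv (osc_inv f)].
  move=> [[gf cf ow ov] [fE uE]] fb ub.
  have wE : w = osc_inv f.
    by apply/funext; apply: osc_uniq ow (osc_invP gf cf).
  have vE : v = osc_inv (osc_inv f).
    have ov' : osc (osc_inv f) v by rewrite -wE.
    by apply/funext; apply: (osc_uniq ov'); rewrite -wE; apply: osc_invP; case: ow.
  split=> //.
    rewrite /state_space /= pst; split=> // x.
    by rewrite normrM gtr0_norm ?invr_gt0// ler_pdivrMl// mulr1.
  move=> [x|]; rewrite /state_map pst -wE -?vE /=.
    by rewrite -wE in vE; rewrite -vE -fE.
  by rewrite -wE in vE; rewrite -vE /bif_map -uE subrr mulr0 addr0.
move=> red hb tb red' hb' tb'.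
have [S1 F1 zE yE] := key _ _ _ _ red hb tb.
have [S2 F2 zE' yE'] := key _ _ _ _ red' hb' tb'.
have dist i : `|st h t i - st h' t' i| <= 2.
  case: i => [x|] /=.
    have [_ _ b1 _] := S1; have [_ _ b2 _] := S2.
    apply: (le_trans (ler_normB _ _)).
    by have -> : 2 = 1 + 1 :> R by []; apply: lerD; [exact: (b1 x)|exact: (b2 x)].
  move: tb tb' => /ler_normlP[a1 a2] /ler_normlP[b1 b2].
  by apply/ler_normlP; split; clear -a1 a2 b1 b2; lra.
have E := contraction_uniq (state_map_contracting sp sc) S1 S2 F1 F2 dist.
have hh : h = h' by rewrite -(pst h t) -(pst h' t'); apply/funext => x; rewrite /profile E.
by split=> //; [exact: (E None)|rewrite yE yE' hh|rewrite zE zE' hh].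
Qed.

End Reduced.

(** * Weak derivatives *)

Section SquareIntegrable.
Variable R : realType.
Implicit Types (f g : R -> R).
Notation mu := (@lebesgue_measure R).
Notation period := (@period R).

Lemma periodP x : period x <-> 0 <= x <= 2 * pi.
Proof. by rewrite /Defs.period /= in_itv. Qed.

Lemma ae_period (P Q : R -> Prop) : (forall x, period x -> P x -> Q x) ->
  {ae mu, forall x, period x -> P x} -> {ae mu, forall x, period x -> Q x}.
Proof.
move=> PQ; apply: filterS; first exact: (ae_filter_ringOfSetsType mu).
by move=> x Px px; apply: PQ => //; exact: Px.
Qed.

Lemma L2per_measurable f : L2per f -> measurable_fun period f.
Proof.
rewrite /L2per inE => /andP[/[!inE]/= mf _].
by apply/measurable_restrictT => //; exact: measurable_period.
Qed.

Lemma L2per_sqr_integrable f : L2per f ->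
  mu.-integrable period (EFin \o (fun x => f x ^+ 2)).
Proof.
move=> /Lfun2_integrable_sqr.
have -> : EFin \o (fun x => (f \_ period) x ^+ 2) = (EFin \o (fun x => f x ^+ 2)) \_ period.
  by apply/funext => x; rewrite /= /patch; case: ifPn => //= _; rewrite expr0n.
move=> H; rewrite -[X in _.-integrable X _]setTI.
by apply/integrable_restrict => //; exact: measurable_period.
Qed.

Lemma L2per_integrable f : L2per f -> mu.-integrable period (EFin \o f).
Proof.
move=> lf; have i2 := L2per_sqr_integrable lf.
have i1 : mu.-integrable period (EFin \o (fun=> 1 : R)).
  by apply: continuous_integrable => x; exact: cst_continuous.
have := integrableD (@measurable_period R) i1 i2.
apply: le_integrable; first exact: measurable_period.
  by apply/measurable_EFinP; exact: L2per_measurable.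
move=> x _ /=; rewrite lee_fin [leRHS]ger0_norm ?addr_ge0 ?sqr_ge0//.
have -> : f x ^+ 2 = `|f x| ^+ 2 by rewrite real_normK// num_real.
have := sqr_ge0 (`|f x| - 1 / 2); set u := `|f x|; clear; nra.
Qed.

Lemma Lnorm2E f : ('N[mu]_2%:E[EFin \o (f \_ period)] =
  (\int[mu]_(x in period) (f x ^+ 2)%:E) `^ (2^-1))%E.
Proof.
rewrite unlock; congr (_ `^ _)%E; rewrite [RHS]integral_mkcond.
apply: eq_integral => x _; rewrite /= /patch; case: ifPn => _.
  by rewrite powR_mulrn// real_normK// num_real.
by rewrite normr0 powR0.
Qed.

Lemma L2norm_sqr f : L2per f -> L2norm f ^+ 2 = circ (fun x => f x ^+ 2).
Proof.
move=> lf; rewrite /L2norm Lnorm2E /circ /Rintegral.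
have := integrable_fin_num (@measurable_period R) (L2per_sqr_integrable lf).
have : (0 <= \int[mu]_(x in period) (f x ^+ 2)%:E)%E.
  by apply: integral_ge0 => x _; rewrite lee_fin sqr_ge0.
case: (integral _ _ _) => // r; rewrite lee_fin => r0 _.
by rewrite poweR_EFin /= powR12_sqrt// sqr_sqrtr.
Qed.

Lemma L2norm_ge0 f : 0 <= L2norm f.
Proof. by rewrite /L2norm fine_ge0// Lnorm_ge0. Qed.

Lemma continuous_L2per f : continuous f -> L2per f.
Proof.
move=> cf; rewrite /L2per inE; apply/andP; split; rewrite inE/=.
  apply/(measurable_restrictT _ (@measurable_period R)).
  exact: measurable_funTS (continuous_measurable_fun cf).
rewrite /finite_norm Lnorm2E poweR_lty//.
have /(integrable_fin_num (@measurable_period R)) : mu.-integrable period (EFin \o (fun x => f x * f x)).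
  by apply: continuous_integrable; exact: continuous_mul.
rewrite fin_numE /= => /andP[_]; rewrite ltey.
by under eq_integral do rewrite /= -expr2.
Qed.

Lemma circ_ae f g : measurable_fun period f -> measurable_fun period g ->
  {ae mu, forall x, period x -> f x = g x} -> circ f = circ g.
Proof.
move=> mf mg fg; rewrite /circ /Rintegral; congr fine.
apply: ae_eq_integral; [exact: measurable_period|exact/measurable_EFinP|exact/measurable_EFinP|].
by apply: ae_period fg => x _ /= ->.
Qed.

Lemma L2norm_ae f g : L2per f -> L2per g ->
  {ae mu, forall x, period x -> f x = g x} -> L2norm f = L2norm g.
Proof.
move=> lf lg fg.
have : L2norm f ^+ 2 = L2norm g ^+ 2.
  rewrite !L2norm_sqr//; apply: circ_ae.
  - by apply: measurable_funX; exact: L2per_measurable.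
  - by apply: measurable_funX; exact: L2per_measurable.
  - by apply: ae_period fg => x _ ->.
by move/eqP; rewrite eqrXn2 ?L2norm_ge0// => /eqP.
Qed.

Lemma L2per_sub f g : L2per f -> L2per g -> L2per (fun x => f x - g x).
Proof.
rewrite /L2per => lf lg.
have -> : (fun x => f x - g x) \_ period = f \_ period - g \_ period.
  apply/funext => x; rewrite /= /patch [RHS]/GRing.add /= /GRing.opp /=.
  by case: ifPn => //= _; rewrite subr0.
have p2 : (1 <= 2%:E :> \bar R)%E by rewrite lee_fin ler1n.
have [_ addc] := Lfun_addr_closed mu p2.
by apply: addc => //; exact: Lfun_oppr_closed.
Qed.

(** The factor 3 comes from [2 pi < 8 < 3^2]. *)
Lemma L2norm_bound f (M : R) : continuous f -> (forall x, `|f x| <= M) -> L2norm f <= 3 * M.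
Proof.
move=> cf fM.
have M0 : 0 <= M by exact: le_trans (normr_ge0 _) (fM 0).
rewrite -(@ler_pXn2r _ 2) ?nnegrE ?L2norm_ge0//; last by rewrite mulr_ge0.
rewrite L2norm_sqr; last exact: continuous_L2per.
apply: (le_trans (ler_norm _)).
have c2 : continuous (fun x => f x ^+ 2).
  by under eq_fun do rewrite expr2; exact: continuous_mul.
have b2 x : `|f x ^+ 2| <= M ^+ 2.
  by rewrite normrX ler_pXn2r ?nnegrE.
apply: (le_trans (circ_bound c2 b2)).
have p4 := pi_lt4 R; have := sqr_ge0 M; clear -p4; nra.
Qed.

(* Pointwise bound of a C^1 function by its H^1 norm: a point where f^2 is at most its
   mean exists by the mean value theorem, and f^2 moves by at most the integral of
   f^2 + f'^2. *)
Lemma sobolev_bound f f' x : der f f' -> continuous f' -> periodic2pi f ->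
  f x ^+ 2 <= 2 * (L2norm f ^+ 2 + L2norm f' ^+ 2).
Proof.
move=> Df cf' pf; have cf := der_continuous Df.
have sq (g : R -> R) : continuous g -> continuous (fun x => g x ^+ 2).
  by move=> cg; under eq_fun do rewrite expr2; exact: continuous_mul.
rewrite !L2norm_sqr; [|exact: continuous_L2per..].
have [P DP P0] := prim_exists (sq _ cf).
have [Q DQ Q0] := prim_exists (sq _ cf').
rewrite (circ_der (sq _ cf) DP) (circ_der (sq _ cf') DQ) P0 Q0 !subr0.
have pi2 := twopi_gt0 R.
have mono (A a : R -> R) u v : der A a -> (forall x, 0 <= a x) -> u <= v -> A u <= A v.
  move=> DA a0 uv; have [c _ e] := der_mvt DA uv.
  by rewrite -subr_ge0 e mulr_ge0// subr_ge0.
have sq0 (g : R -> R) z : 0 <= g z ^+ 2 by exact: sqr_ge0.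
have [c /andP[c0 c2] Pc] := der_mvt DP (ltW pi2).
rewrite P0 !subr0 in Pc.
have [z /andP[z0 z2] ->] := periodic_reduce x pf.
have DE : der (fun x => P x + Q x - f x ^+ 2) (fun x => (f x - f' x) ^+ 2).
  apply: (@der_ext _ _ (fun x => f x ^+ 2 + f' x ^+ 2 - (f' x * f x + f x * f' x))).
    by apply: der_sub; [exact: der_add|exact: der_mul].
  by move=> u; ring.
have DE' : der (fun x => P x + Q x + f x ^+ 2) (fun x => (f x + f' x) ^+ 2).
  apply: (@der_ext _ _ (fun x => f x ^+ 2 + f' x ^+ 2 + (f' x * f x + f x * f' x))).
    by apply: der_add; [exact: der_add|exact: der_mul].
  by move=> u; ring.
have Pz := mono _ _ _ _ DP (sq0 f) z0; have Pz' := mono _ _ _ _ DP (sq0 f) z2.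
have Qz := mono _ _ _ _ DQ (sq0 f') z0; have Qz' := mono _ _ _ _ DQ (sq0 f') z2.
have Pc1 := mono _ _ _ _ DP (sq0 f) c0; have Pc2 := mono _ _ _ _ DP (sq0 f) c2.
have Qc1 := mono _ _ _ _ DQ (sq0 f') c0; have Qc2 := mono _ _ _ _ DQ (sq0 f') c2.
rewrite P0 in Pz Pc1; rewrite Q0 in Qz Qc1.
have fc : f c ^+ 2 <= P (2 * pi).
  rewrite Pc -[leLHS]mulr1; apply: ler_wpM2l; first exact: sqr_ge0.
  by have := pi_ge2 R; clear; lra.
have [cz|/ltW zc] := leP c z.
  have := mono _ _ _ _ DE (fun u => sqr_ge0 _) cz.
  clear -fc Pz Pz' Qz Qz' Pc1 Pc2 Qc1 Qc2; lra.
have := mono _ _ _ _ DE' (fun u => sqr_ge0 _) zc.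
clear -fc Pz Pz' Qz Qz' Pc1 Pc2 Qc1 Qc2; lra.
Qed.

(** A primitive [P] of [f^2] is nondecreasing and takes the same value at both ends of the period.
    If [f] were nonzero at a point, [P] would increase strictly on an interval next to it. *)
Lemma ae_continuous_eq0 f : continuous f ->
  {ae mu, forall x, period x -> f x = 0} -> forall x, period x -> f x = 0.
Proof.
move=> cf f0.
have c2 : continuous (fun x => f x ^+ 2).
  by under eq_fun do rewrite expr2; exact: continuous_mul.
have : circ (fun x => f x ^+ 2) = circ (fun=> 0).
  apply: circ_ae.
  - exact: measurable_funTS (continuous_measurable_fun c2).
  - exact: measurable_cst.
  - by apply: ae_period f0 => x _ ->; rewrite expr0n.
have [P DP P0] := prim_exists c2.
rewrite (circ_der c2 DP) (@circ_der _ (fun=> 0) (fun=> 0)); last first.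
- exact: der_cst.
- by move=> ?; exact: cst_continuous.
rewrite P0 !subr0 => P2.
have mono u v : u <= v -> P u <= P v.
  move=> uv; have [c _ e] := der_mvt DP uv.
  by rewrite -subr_ge0 e mulr_ge0 ?sqr_ge0// subr_ge0.
move=> x /periodP /andP[x0 x2].
apply/eqP; apply/negPn/negP => fx.
have fx2 : 0 < f x ^+ 2 by rewrite exprn_even_gt0.
have /cvgrPdist_lt/(_ _ fx2) := c2 x.
move=> /nbhs_ballP[e /= e0 He].
have pi2 := twopi_gt0 R.
(* An interval on one side of [x] that stays inside the period: to the right in general, to the left
   when [x] is the right end point. *)
have [u [v [uv u0 v2 uvx]]] : exists u v, [/\ u < v, 0 <= u, v <= 2 * pi &
    forall w, u <= w <= v -> `|x - w| < e].
  have [xl|xg] := ltP x (2 * pi).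
    exists x, (Num.min (2 * pi) (x + e / 2)); split=> //.
    - by rewrite lt_min xl ltrDl divr_gt0.
    - by rewrite ge_min lexx.
    - move=> w /andP[xw]; rewrite le_min => /andP[_ we].
      by rewrite distrC ger0_norm ?subr_ge0//; clear -we e0; lra.
  exists (Num.max 0 (x - e / 2)), x; split=> //.
  - by rewrite gt_max (lt_le_trans pi2 xg) ltrBlDr ltrDl divr_gt0.
  - by rewrite le_max lexx.
  - move=> w /andP[]; rewrite ge_max => /andP[_ we] xw.
    by rewrite ger0_norm ?subr_ge0//; clear -we e0; lra.
have [c cuv Pe] := der_mvt DP (ltW uv).
have fc : 0 < f c ^+ 2.
  have := He c (uvx _ cuv); rewrite ltr_norml => /andP[_]; clear; lra.
have : 0 < P v - P u by rewrite Pe mulr_gt0// subr_gt0.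
have := mono _ _ u0; have := mono _ _ v2; rewrite P2 P0; clear; lra.
Qed.

End SquareIntegrable.

(** * Smooth periodic approximations of indicator functions *)

Section Smooth.
Variable R : realType.
Implicit Types (f g phi : R -> R).

Inductive generated (G : set (R -> R)) : (R -> R) -> Prop :=
| gen_cst (c : R) : generated G (fun=> c)
| gen_in f : G f -> generated G f
| gen_add f g : generated G f -> generated G g -> generated G (fun x => f x + g x)
| gen_mul f g : generated G f -> generated G g -> generated G (fun x => f x * g x).

Lemma smooth_der phi n : smooth phi -> der (derive1n n phi) (derive1n n.+1 phi).
Proof.
move=> sphi x; apply: DeriveDef; first exact: sphi.
by rewrite derive1nS derive1E.
Qed.

Lemma derive1_der f g : der f g -> derive1 f = g.
Proof. by move=> fg; apply/funext => x; rewrite derive1E; have [] := fg x. Qed.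

(** Smoothness by invariance: it is enough to place [f] in a set stable under differentiation,
    without a formula for higher derivatives. *)
Lemma smooth_closed (A : set (R -> R)) :
  (forall f, A f -> exists2 g, A g & der f g) -> forall f, A f -> smooth f.
Proof.
move=> H f Af n x.
have [|g _ Dg] := H (derive1n n f); last by have [] := Dg x.
elim: n => // n IH; have [g Ag Dg] := H _ IH.
by rewrite derive1nS (derive1_der Dg).
Qed.

(** The product rule keeps derivatives inside the algebra generated by [G] as soon as those of the
    generators lie in it. *)
Lemma generated_smooth (G : set (R -> R)) :
  (forall f, G f -> exists2 g, generated G g & der f g) ->
  forall f, generated G f -> smooth f.
Proof.
move=> H; apply: smooth_closed => f; elim=> [c|{}f|f1 f2 g1 [d1 e1 D1] g2 [d2 e2 D2]|f1 f2 g1 [d1 e1 D1] g2 [d2 e2 D2]].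
- by exists (fun=> 0); [exact: gen_cst|exact: der_cst].
- exact: H.
- by exists (fun x => d1 x + d2 x); [exact: gen_add|exact: der_add].
- exists (fun x => d1 x * f2 x + f1 x * d2 x); last exact: der_mul.
  by apply: gen_add; exact: gen_mul.
Qed.

Lemma smooth_prim f g : der f g -> smooth g -> smooth f.
Proof.
move=> fg sg [|n] x; first by have [] := fg x.
by rewrite derive1Sn (derive1_der fg); exact: sg.
Qed.

Lemma smooth_continuous phi n : smooth phi -> continuous (derive1n n phi).
Proof. by move=> sp; exact: der_continuous (smooth_der n sp). Qed.

Lemma smooth_periodic phi n : smooth phi -> periodic2pi phi -> periodic2pi (derive1n n phi).
Proof.
move=> sp pp; elim: n => // n IH.
exact: der_periodic (smooth_der n sp) IH.
Qed.

Lemma smooth_subc phi (c : R) : smooth phi -> smooth (fun x => phi x - c).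
Proof.
move=> sp [|n] x.
  by have [] := der_sub (smooth_der 0 sp) (der_cst c) x.
have D : der (fun x => phi x - c) (derive1n 1 phi).
  by apply: (der_ext (der_sub (smooth_der 0 sp) (der_cst c))) => y; rewrite subr0.
by rewrite derive1Sn (derive1_der D) derive1n1 -derive1Sn; exact: sp n.+1 x.
Qed.

(** A decreasing sigmoid whose derivative is a polynomial in itself, so that smoothness of the
    cut-offs built from it is a matter of algebra. *)
Definition logistic (t : R) : R := (1 + expR t)^-1.

Lemma logistic_bounds t : 0 < logistic t < 1.
Proof.
rewrite /logistic invr_gt0 addr_gt0 ?expR_gt0//=.
by rewrite invf_lt1 ?addr_gt0 ?expR_gt0// ltrDl expR_gt0.
Qed.

Lemma der_logistic : der logistic (fun t => - (logistic t * (1 - logistic t))).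
Proof.
move=> t.
have n0 : 1 + expR t != 0 by rewrite gt_eqF// addr_gt0// expR_gt0.
have D : is_derive t 1 (fun t : R => 1 + expR t) (0 + expR t).
  by apply: is_deriveD.
have -> : - (logistic t * (1 - logistic t)) = - (1 + expR t) ^- 2 *: (0 + expR t).
  by rewrite /logistic /GRing.scale /=; field.
exact: is_deriveV.
Qed.

(* The summand n makes the limit 0 also at the two end points 0 and 2 c, where the
   difference of cosines vanishes. *)
Definition bump (c : R) (n : nat) (x : R) : R :=
  logistic (n%:R - n%:R ^+ 2 * (cos (x - c) - cos c)).

Lemma bump_smooth c n : smooth (bump c n).
Proof.
pose G : set (R -> R) := [set f | f = (fun x => sin (x - c)) \/ f = (fun x => cos (x - c)) \/ f = bump c n].
have Ds : der (fun x => sin (x - c)) (fun x => cos (x - c))  by exact: (der_shift (- c) (@der_sin R)).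
have Dc : der (fun x => cos (x - c)) (fun x => - 1 * sin (x - c)).
  by apply: (der_ext (der_shift (- c) (@der_cos R))) => x; rewrite mulN1r.
apply: (@generated_smooth G); last by apply: gen_in; right; right.
move=> f [->|[->|->]].
- by exists (fun x => cos (x - c)) => //; apply: gen_in; right; left.
- exists (fun x => - 1 * sin (x - c)) => //; apply: gen_mul; first exact: gen_cst.
  by apply: gen_in; left.
- exists (fun x => bump c n x * (1 + - 1 * bump c n x) * (- n%:R ^+ 2 * sin (x - c))).
    have gb : generated G (bump c n) by apply: gen_in; right; right.
    apply: gen_mul.
      apply: gen_mul => //; apply: gen_add; first exact: gen_cst.
      by apply: gen_mul => //; exact: gen_cst.
    apply: gen_mul; first exact: gen_cst.
    by apply: gen_in; left.
  apply: (der_ext (der_comp der_logistic (der_sub (der_cst n%:R) (der_scale (n%:R ^+ 2) (der_sub Dc (der_cst (cos c))))))) => x.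
  by rewrite -/(bump c n x); ring.
Qed.

Lemma bump_periodic c n : periodic2pi (bump c n).
Proof. by move=> x; rewrite /bump addrAC cos2pi_periodic. Qed.

(** The difference of cosines equals [2 sin(x/2) sin(c - x/2)], positive exactly for [0 < x < 2 c]
    within the period. The argument of [logistic] is then eventually at most [- n], and otherwise at
    least [n]; from [1 + t <= expR t] the error is at most [1 / (n + 1)]. *)
Lemma bump_cvg (c x : R) : 0 < c <= pi -> 0 <= x <= 2 * pi ->
  bump c n x @[n --> \oo] --> ((0 < x < 2 * c)%R%:R : R).
Proof.
move=> /andP[c0 cpi] /andP[x0 x2].
have aux (u v : R) : cos (u - v) - cos (u + v) = 2 * sin u * sin v.
  by rewrite cosB cosD; ring.
have TE : cos (x - c) - cos c = 2 * sin (x / 2) * sin (c - x / 2).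
  have -> : x - c = x / 2 - (c - x / 2) by field.
  have -> : cos c = cos (x / 2 + (c - x / 2)) by congr cos; field.
  exact: aux.
have small (t : R) n : n%:R <= t -> logistic t <= n.+1%:R^-1.
  move=> nt; rewrite /logistic lef_pV2 ?posrE ?ltr0n ?addr_gt0 ?expR_gt0//.
  rewrite -natr1; have := expR_ge1Dx t; move: nt; clear; lra.
have logisticN (t : R) : 1 - logistic t = logistic (- t).
  rewrite /logistic expRN; field; rewrite ?gt_eqF ?addr_gt0 ?expR_gt0//=.
have lim (l : R) : (\forall n \near \oo, `|l - bump c n x| <= n.+1%:R^-1) ->
    bump c n x @[n --> \oo] --> l.
  move=> H; apply/cvgrPdist_le => e e0; near=> n.
  apply: (le_trans (_ : _ <= n.+1%:R^-1)); first by near: n.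
  by apply: ltW; near: n; exact: (near_infty_natSinv_lt (PosNum e0)).
have bpos n : 0 < bump c n x < 1 by exact: logistic_bounds.
have lim0 : cos (x - c) - cos c <= 0 -> bump c n x @[n --> \oo] --> (0 : R).
  move=> T0; apply: lim; apply: nearW => n; rewrite sub0r normrN ger0_norm.
    apply: small; rewrite lerDl oppr_ge0.
    by apply: mulr_ge0_le0 => //; rewrite exprn_ge0.
  by case/andP: (bpos n) => /ltW.
have lim1 : 0 < cos (x - c) - cos c -> bump c n x @[n --> \oo] --> (1 : R).
  move=> T0; apply: lim.
  near=> n; rewrite ger0_norm.
    rewrite /bump logisticN; apply: small.
    have : 2 / (cos (x - c) - cos c) <= n%:R by near: n; exact: nbhs_infty_ger.
    rewrite ler_pdivrMr// => h.
    have n0 : 0 <= n%:R :> R by [].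
    move: n0 h; set N : R := n%:R; set T := cos _ - cos _ => n0 h.
    by clear -n0 h; nra.
  by rewrite subr_ge0; case/andP: (bpos n) => _ /ltW.
have [xz|xpos] := leP x 0.
  have e : x = 0 by apply/eqP; rewrite eq_le xz x0.
  by apply: lim0; rewrite TE e mul0r sin0 mulr0 mul0r.
have s1 : 0 <= sin (x / 2).
  by apply: sin_ge0_pi; rewrite divr_ge0//= ler_pdivrMr// mulrC.
have [xc|xc] := ltP x (2 * c) => /=.
  apply: lim1; rewrite TE !mulr_gt0//.
    by apply: sin_gt0_pi; rewrite divr_gt0//=; clear -xc cpi; lra.
  by apply: sin_gt0_pi; apply/andP; split; clear -xc cpi xpos; lra.
apply: lim0; rewrite TE; apply: mulr_ge0_le0; first by rewrite mulr_ge0.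
have -> : c - x / 2 = - (x / 2 - c) by ring.
rewrite sinN oppr_le0; apply: sin_ge0_pi; apply/andP; split; clear -xc x2 c0; lra.
Unshelve. all: by end_near.
Qed.

Lemma bump_continuous (c : R) n : continuous (bump c n).
Proof. exact: (@smooth_continuous _ 0 (@bump_smooth c n)). Qed.

End Smooth.

(** * Weak derivatives on the circle *)

Section WeakDerivative.
Variable R : realType.
Implicit Types (f g phi : R -> R).
Notation mu := (@lebesgue_measure R).
Notation period := (@period R).

Lemma measurable_continuous f : continuous f -> measurable_fun period f.
Proof. by move=> cf; exact: measurable_funTS (continuous_measurable_fun cf). Qed.

Lemma integrable_mul_continuous f phi (M : R) : mu.-integrable period (EFin \o f) ->
  continuous phi -> (forall x, `|phi x| <= M) ->
  mu.-integrable period (EFin \o (fun x => f x * phi x)).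
Proof.
move=> fi cphi phiM.
have M0 : 0 <= M by exact: le_trans (normr_ge0 _) (phiM 0).
have := integrableZl (@measurable_period R) M fi.
apply: le_integrable; first exact: measurable_period.
  apply/measurable_EFinP; apply: measurable_funM; last exact: measurable_continuous.
  by apply/measurable_EFinP; case/integrableP : fi.
move=> x _ /=; rewrite lee_fin !normrM (ger0_norm M0) mulrC.
exact: ler_wpM2r.
Qed.

Lemma smooth_bound phi n : smooth phi -> periodic2pi phi ->
  exists M, forall x, `|derive1n n phi x| <= M.
Proof.
move=> sp pp; have cp := @smooth_continuous R phi n sp.
have := @segment_compact R 0 (2 * pi).
move=> /(continuous_compact (continuous_subspaceT cp)) /compact_bounded.
move=> [M [_ HM]]; exists (M + 1) => x.
have [y yI ->] := periodic_reduce x (@smooth_periodic R phi n sp pp).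
apply: HM; first by rewrite ltrDl.
by exists y => //=; rewrite in_itv.
Qed.

(** Testing against [bump c n] and letting [n] grow, with [|f|] as dominating function, gives
    integral 0 over [[0, 2 c]] for every [c] in []0, pi]]. So the indefinite integral of [f],
    extended by 0, vanishes identically, and Lebesgue differentiation yields [f = 0] almost
    everywhere. *)
Lemma weakly_zero f : L2per f ->
  (forall phi, smooth phi -> periodic2pi phi -> circ (fun x => f x * phi x) = 0) ->
  {ae mu, forall x, period x -> f x = 0}.
Proof.
move=> lf H.
have fi := L2per_integrable lf.
pose F := f \_ period.
have FE : EFin \o F = (EFin \o f) \_ period by rewrite /F restrict_EFin.
have Fi : mu.-integrable setT (EFin \o F).
  rewrite FE; apply/integrable_restrict => //; first exact: measurable_period.
  by rewrite setTI.
have piece (c : R) : 0 < c <= pi -> \int[mu]_(x in `[0, 2 * c]) f x = 0.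
  move=> cpi; have /andP[c0 cpi'] := cpi.
  pose u n x := (f x * bump c n x)%:E.
  pose l x := (f x * ((0 < x < 2 * c)%R%:R : R))%:E.
  have mi : measurable_fun period (fun x : R => ((0 < x < 2 * c)%R%:R : R)).
    have -> : (fun x : R => ((0 < x < 2 * c)%R%:R : R)) = \1_(`]0, 2 * c[%classic).
      apply/funext => x; rewrite indicE; congr (_%:R).
      by rewrite mem_setE /= in_itv.
    exact: measurable_indic.
  have mf := L2per_measurable lf.
  have [|||||_ _ cvg] := @dominated_convergence _ _ _ mu period (@measurable_period R)
     u l (EFin \o (fun x => `|f x|)).
  - move=> n; apply/measurable_EFinP; apply: measurable_funM => //.
    by apply: measurable_continuous; exact: bump_continuous.
  - by apply/measurable_EFinP; exact: measurable_funM.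
  - apply: aeW => x /periodP xI.
    by apply: cvg_EFin; [exact: nearW|]; apply: cvgMl_tmp; exact: bump_cvg.
  - by have := integrable_norm fi.
  - apply: aeW => x n _; rewrite /u /= lee_fin normrM -[leRHS]mulr1.
    apply: ler_wpM2l => //; have /andP[/ltW b0 /ltW b1] := logistic_bounds (n%:R - n%:R ^+ 2 * (cos (x - c) - cos c)).
    by rewrite ger0_norm.
  have z n : (\int[mu]_(x in period) u n x = 0)%E.
    have := H _ (@bump_smooth R c n) (@bump_periodic R c n).
    rewrite /circ /Rintegral => h.
    have ui : mu.-integrable period (EFin \o (fun x => f x * bump c n x)).
      apply: (@integrable_mul_continuous f (bump c n) 1) => //; first exact: bump_continuous.
      move=> x; have /andP[/ltW b0 /ltW b1] := logistic_bounds (n%:R - n%:R ^+ 2 * (cos (x - c) - cos c)).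
      by rewrite ger0_norm.
    have fu := integrable_fin_num (@measurable_period R) ui; rewrite /= in fu.
    by rewrite /u -[LHS](fineK fu) h.
  have : (\int[mu]_(x in period) l x = 0)%E.
    have c1 : ([sequence \int[mu]_(x in period) u n x]_n @ \oo --> (0 : \bar R))%E.
      by rewrite (_ : [sequence _]_n = fun=> 0%E); [exact: cvg_cst|apply/funext => n; exact: z].
    exact: (cvg_unique _ cvg c1).
  have sub : `]0, 2 * c[%classic `<=` period.
    move=> x /=; rewrite in_itv /= => /andP[x0 xc]; apply/periodP.
    by rewrite (ltW x0) /=; clear -xc cpi'; lra.
  have -> : (\int[mu]_(x in period) l x = \int[mu]_(x in `]0%R, (2 * c)%R[) (f x)%:E)%E.
    rewrite -(setIidr sub) integral_mkcondr; apply: eq_integral => x _.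
    rewrite /l /patch mem_setE /= in_itv /=; case: ifP => _; first by rewrite mulr1.
    by rewrite mulr0.
  move=> z0.
  have ci : mu.-integrable `[0, 2 * c] (EFin \o f).
    apply: integrableS fi => //; first exact: measurable_period.
    move=> x /=; rewrite in_itv /= => /andP[x0 xc]; apply/periodP; rewrite x0 /=.
    by clear -xc cpi'; lra.
  rewrite -Rintegral_itv_obnd_cbnd; last first.
    by apply: integrableS ci => //; apply: subset_itv; rewrite bnd_simp.
  rewrite -Rintegral_itv_bndo_bndc; last first.
    by apply: integrableS ci => //; apply: subset_itv; rewrite bnd_simp.
  by rewrite /Rintegral z0.
have pi2 := twopi_gt0 R.
have G0 x : \int[mu]_(t in `]-oo, x]) F t = 0.
  rewrite /F -Rintegral_mkcondr /Defs.period.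
  have [xn|xp] := leP x 0.
    have [x0|/eqP x0] := eqVneq x 0; last first.
      rewrite (_ : _ `&` _ = set0) ?Rintegral_set0//; apply/seteqP; split => // t /=.
      rewrite !in_itv /= => -[tx /andP[t0 _]]; apply: x0; apply/eqP.
      by rewrite eq_le xn (le_trans t0 tx).
    rewrite (_ : _ `&` _ = [set 0]) ?Rintegral_set1//; apply/seteqP; split => t /=.
      by rewrite x0 !in_itv /= => -[tx /andP[t0 _]]; apply/eqP; rewrite eq_le tx t0.
    by move=> ->; rewrite x0 !in_itv /= lexx ltW.
  pose c := Num.min x (2 * pi) / 2.
  rewrite (_ : _ `&` _ = `[0, 2 * c]%classic).
    apply: piece; rewrite /c divr_gt0 ?lt_min ?xp ?pi2//= ler_pdivrMr// mulrC.
    by rewrite ge_min lexx orbT.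
  have -> : 2 * c = Num.min x (2 * pi) by rewrite /c; field.
  apply/seteqP; split => t /=; rewrite !in_itv /= le_min.
    by move=> [-> /andP[-> ->]].
  by move=> /and3P[-> -> ->].
have Fi' y : mu.-integrable `]-oo, y] (EFin \o F) by exact: integrableS Fi.
have := @FTC1Ny R F Fi' (open_integrable_locally openT Fi).
apply: filterS; first exact: (ae_filter_ringOfSetsType mu).
move=> x [_ dF] px.
have : (fun x0 : R => \int[mu]_(t in `]-oo, x0]) F t) = cst 0 by apply/funext => y; exact: G0.
move=> E; move: dF; by rewrite E derive1_cst /F /patch mem_set.
Qed.

Lemma circ_mul_sub f g phi : L2per f -> L2per g -> smooth phi -> periodic2pi phi ->
  circ (fun x => (f x - g x) * phi x) = circ (fun x => f x * phi x) - circ (fun x => g x * phi x).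
Proof.
move=> lf lg sp pp; have [M HM] := @smooth_bound phi 0 sp pp.
have cp : continuous phi := @smooth_continuous R phi 0 sp.
have i1 := integrable_mul_continuous (L2per_integrable lf) cp HM.
have i2 := integrable_mul_continuous (L2per_integrable lg) cp HM.
rewrite /circ -RintegralB//; last exact: measurable_period.
by congr Rintegral; apply/funext => x; rewrite mulrBl.
Qed.

Lemma is_wderiv_ae j f g1 g2 : is_wderiv j f g1 -> is_wderiv j f g2 ->
  {ae mu, forall x, period x -> g1 x = g2 x}.
Proof.
move=> [l1 H1] [l2 H2].
have : {ae mu, forall x, period x -> g1 x - g2 x = 0}.
  apply: weakly_zero; first exact: L2per_sub.
  move=> phi sp pp; rewrite circ_mul_sub//.
  have e : (-1) ^+ j * circ (fun x => g1 x * phi x) = (-1) ^+ j * circ (fun x => g2 x * phi x).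
    by rewrite /circ -H1// -H2.
  by move: e => /(mulfI _) ->; rewrite ?subrr// signr_eq0.
by apply: ae_period => x _ /eqP; rewrite subr_eq0 => /eqP.
Qed.

Lemma wderivP j f : (exists g, is_wderiv j f g) -> is_wderiv j f (wderiv j f).
Proof. by move=> [g fg]; exact: (xgetI _ fg). Qed.

Lemma wderiv_ae j f g : is_wderiv j f g -> {ae mu, forall x, period x -> wderiv j f x = g x}.
Proof. by move=> fg; exact: (is_wderiv_ae (wderivP (ex_intro _ _ fg)) fg). Qed.

Lemma L2norm_wderiv j f g : is_wderiv j f g -> L2norm (wderiv j f) = L2norm g.
Proof.
move=> fg; apply: L2norm_ae; last exact: wderiv_ae.
- by have [|] := @wderivP j f; first by exists g.
- by case: fg.
Qed.

Lemma circ_by_parts f f' phi phi' : der f f' -> der phi phi' -> continuous f' ->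
  continuous phi' -> periodic2pi f -> periodic2pi phi ->
  circ (fun x => f x * phi' x) = - circ (fun x => f' x * phi x).
Proof.
move=> Df Dp cf' cp' pf pp.
have cf := der_continuous Df; have cp := der_continuous Dp.
apply/eqP; rewrite -addr_eq0 addrC -circ_add; [|exact: continuous_mul..].
rewrite (circ_der _ (der_mul Df Dp)).
  by have := pf 0; have := pp 0; rewrite !add0r => -> ->; rewrite subrr.
by apply: continuous_add; exact: continuous_mul.
Qed.

Lemma is_wderiv0 f : continuous f -> is_wderiv 0 f f.
Proof.
move=> cf; split; first exact: continuous_L2per.
by move=> phi _ _; rewrite expr0 mul1r.
Qed.

Lemma is_wderiv1 f f' : der f f' -> continuous f' -> periodic2pi f -> is_wderiv 1 f f'.
Proof.
move=> Df cf' pf; split; first exact: continuous_L2per.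
move=> phi sp pp; rewrite expr1 mulN1r.
apply: (circ_by_parts Df (@smooth_der R phi 0 sp)) => //.
exact: (@smooth_continuous R phi 1 sp).
Qed.

Lemma is_wderiv2 f f' f'' : der f f' -> der f' f'' -> continuous f'' -> periodic2pi f ->
  is_wderiv 2 f f''.
Proof.
move=> Df Df' cf'' pf; split; first exact: continuous_L2per.
move=> phi sp pp; rewrite sqrrN expr1n mul1r.
have cf' := der_continuous Df'; have pf' := der_periodic Df pf.
have c0 := @smooth_continuous R phi 0 sp.
have c1 := @smooth_continuous R phi 1 sp; have c2 := @smooth_continuous R phi 2 sp.
have e1 := circ_by_parts Df (@smooth_der R phi 1 sp) cf' c2 pf (@smooth_periodic R phi 1 sp pp).
have e2 := circ_by_parts Df' (@smooth_der R phi 0 sp) cf'' c1 pf' pp.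
by rewrite [LHS]e1 [X in - X]e2 opprK.
Qed.

Lemma Hper2_classical f f' f'' : der f f' -> der f' f'' -> continuous f'' ->
  periodic2pi f -> Hper 2 f.
Proof.
move=> Df Df' cf'' pf.
have cf' := der_continuous Df'; have cf := der_continuous Df.
split=> //; first exact: continuous_L2per.
case=> [|[|[|//]]] _.
- by exists f; exact: is_wderiv0.
- by exists f'; exact: is_wderiv1.
- by exists f''; exact: (is_wderiv2 Df Df').
Qed.

Lemma Hnorm2_sqr f f' f'' : der f f' -> der f' f'' -> continuous f'' -> periodic2pi f ->
  Hnorm 2 f ^+ 2 = L2norm f ^+ 2 + L2norm f' ^+ 2 + L2norm f'' ^+ 2.
Proof.
move=> Df Df' cf'' pf.
have cf' := der_continuous Df'; have cf := der_continuous Df.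
rewrite /Hnorm sqr_sqrtr; last by apply: sumr_ge0 => i _; exact: sqr_ge0.
rewrite !big_ord_recl big_ord0 /= addr0 addrA.
rewrite (L2norm_wderiv (is_wderiv0 cf)) (L2norm_wderiv (is_wderiv1 Df cf' pf)).
by rewrite (L2norm_wderiv (is_wderiv2 Df Df' cf'' pf)).
Qed.

Lemma Hnorm2_bound f f' f'' (M : R) : der f f' -> der f' f'' -> continuous f'' ->
  periodic2pi f -> (forall x, `|f x| <= M) -> (forall x, `|f' x| <= M) ->
  (forall x, `|f'' x| <= M) -> Hnorm 2 f ^+ 2 <= 27 * M ^+ 2.
Proof.
move=> Df Df' cf'' pf b0 b1 b2; rewrite (Hnorm2_sqr Df Df' cf'' pf).
have cf' := der_continuous Df'; have cf := der_continuous Df.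
have M0 : 0 <= M by exact: le_trans (normr_ge0 _) (b0 0).
have key g : continuous g -> (forall x, `|g x| <= M) -> L2norm g ^+ 2 <= 9 * M ^+ 2.
  move=> cg gb; have := L2norm_bound cg gb => h.
  have -> : 9 * M ^+ 2 = (3 * M) ^+ 2 by ring.
  by rewrite ler_pXn2r ?nnegrE ?L2norm_ge0// mulr_ge0.
have := key _ cf b0; have := key _ cf' b1; have := key _ cf'' b2; clear; lra.
Qed.

(* A continuous weak solution of f'' = g with g continuous is classical: it differs
   by a constant from a periodic second primitive of g. *)
Lemma wderiv2_classical f g : continuous f -> periodic2pi f -> continuous g ->
  periodic2pi g -> is_wderiv 2 f g -> exists2 f', der f f' & der f' g.
Proof.
move=> cf pf cg pg [lg Hg].
have twopi0 : 2 * pi != 0 :> R by rewrite gt_eqF// twopi_gt0.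
(* Mean zero is what makes a primitive periodic; subtracting the mean of the primitive allows the
   step to be iterated. *)
have pprim (h : R -> R) : continuous h -> periodic2pi h -> circ h = 0 ->
    exists H, [/\ der H h, periodic2pi H & circ H = 0].
  move=> ch ph h0; have [P DP P0] := prim_exists ch.
  have P2 : P (2 * pi) = 0 by have := circ_der ch DP; rewrite h0 P0 subr0.
  have pP : periodic2pi P.
    apply: (@der_eq _ (fun x => P (x + 2 * pi)) P h) => //; last by rewrite add0r P2 P0.
    by apply: (der_ext (der_shift (2 * pi) DP)) => x; rewrite ph.
  have cP := der_continuous DP.
  pose m := circ P / (2 * pi).
  exists (fun x => P x - m); split.
  - by apply: (der_ext (der_sub DP (der_cst m))) => x; rewrite subr0.
  - by move=> x; rewrite pP.
  - rewrite circ_sub//; last by move=> ?; exact: cst_continuous.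
    rewrite (@circ_der _ (fun x => m * x) (fun=> m)).
    + by rewrite mulr0 subr0 /m divfK// subrr.
    + by move=> ?; exact: cst_continuous.
    + by apply: (der_ext (der_scale m (@der_id R))) => x; rewrite mulr1.
have s1 : smooth (fun=> 1 : R).
  apply: (@smooth_closed R [set f | exists c, f = fun=> c]); last by exists 1.
  by move=> _ [c ->]; exists (fun=> 0); [exists 0|exact: der_cst].
(* The constant test function 1, whose second derivative vanishes, detects the mean of [g]. *)
have g0 : circ g = 0.
  have := Hg _ s1 (fun _ => erefl); rewrite sqrrN expr1n mul1r.
  have -> : derive1n 2 (fun=> 1 : R) = fun=> 0.
    by rewrite derive1Sn (derive1_der (der_cst 1)) derive1n1 (derive1_der (der_cst 0)).
  move=> e; rewrite -[LHS](_ : circ (fun x => g x * 1) = _); last first.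
    by apply: circ_ext => x; rewrite mulr1.
  rewrite /circ -e -/(circ _) (@circ_ext _ _ (fun=> 0)); last by move=> x; rewrite mulr0.
  rewrite (@circ_der _ (fun=> 0) (fun=> 0)) ?subrr//; first by move=> ?; exact: cst_continuous.
  exact: der_cst.
have [G1 [DG1 pG1 G10]] := pprim _ cg pg g0.
have cG1 := der_continuous DG1.
have [G2 [DG2 pG2 G20]] := pprim _ cG1 pG1 G10.
have cG2 := der_continuous DG2.
have [_ HG] := is_wderiv2 DG2 DG1 cg pG2.
pose d x := f x - G2 x.
have cd : continuous d by apply: continuous_add => //; exact: continuous_opp.
pose m := circ d / (2 * pi).
have m0 : circ (fun x => d x - m) = 0.
  rewrite circ_sub//; last by move=> ?; exact: cst_continuous.
  rewrite (@circ_der _ (fun x => m * x) (fun=> m)).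
  + by rewrite mulr0 subr0 /m divfK// subrr.
  + by move=> ?; exact: cst_continuous.
  + by apply: (der_ext (der_scale m (@der_id R))) => x; rewrite mulr1.
have cdm : continuous (fun x => d x - m).
  by apply: continuous_add => // ?; exact: cst_continuous.
have dphi phi : smooth phi -> periodic2pi phi -> circ (fun x => d x * derive1n 2 phi x) = 0.
  move=> sp pp; have c2 := @smooth_continuous R phi 2 sp.
  have -> : circ (fun x => d x * derive1n 2 phi x) =
      circ (fun x => f x * derive1n 2 phi x) - circ (fun x => G2 x * derive1n 2 phi x).
    rewrite -circ_sub; [|exact: continuous_mul..].
    by apply: circ_ext => x; rewrite /d mulrBl.
  by have := Hg _ sp pp; have := HG _ sp pp; rewrite /circ => -> ->; rewrite subrr.
have wz : {ae mu, forall x, period x -> d x - m = 0}.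
  apply: weakly_zero; first exact: continuous_L2per.
  move=> psi sp pp; have cp : continuous psi := @smooth_continuous R psi 0 sp.
  (* A test function is its mean plus the second derivative of a smooth periodic function [Q2], and
     [d - m] is orthogonal to both summands. *)
  pose k := circ psi / (2 * pi).
  pose psi0 x := psi x - k.
  have sp0 : smooth psi0 by exact: smooth_subc.
  have cp0 : continuous psi0 := @smooth_continuous R psi0 0 sp0.
  have pp0 : periodic2pi psi0 by move=> x; rewrite /psi0 pp.
  have psi00 : circ psi0 = 0.
    rewrite circ_sub//; last by move=> ?; exact: cst_continuous.
    rewrite (@circ_der _ (fun x => k * x) (fun=> k)).
    + by rewrite mulr0 subr0 /k divfK// subrr.
    + by move=> ?; exact: cst_continuous.
    + by apply: (der_ext (der_scale k (@der_id R))) => x; rewrite mulr1.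
  have [Q1 [DQ1 pQ1 Q10]] := pprim _ cp0 pp0 psi00.
  have [Q2 [DQ2 pQ2 Q20]] := pprim _ (der_continuous DQ1) pQ1 Q10.
  have sQ2 : smooth Q2 by exact: smooth_prim DQ2 (smooth_prim DQ1 sp0).
  have := dphi _ sQ2 pQ2.
  rewrite derive1Sn (derive1_der DQ2) derive1n1 (derive1_der DQ1) => e.
  have -> : circ (fun x => (d x - m) * psi x) =
     circ (fun x => d x * psi0 x - m * psi0 x) + k * circ (fun x => d x - m).
    rewrite -circ_scale// -circ_add.
    - by apply: circ_ext => x; rewrite /psi0; ring.
    - apply: continuous_add; first exact: continuous_mul.
      by apply/continuous_opp/continuous_mul => // ?; exact: cst_continuous.
    - by apply: continuous_mul => // ?; exact: cst_continuous.
  rewrite m0 mulr0 addr0 circ_sub; [|exact: continuous_mul|]; last first.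
    by apply: continuous_mul => // ?; exact: cst_continuous.
  by rewrite e circ_scale// psi00 mulr0 subrr.
have dm x : d x - m = 0.
  have pd : periodic2pi (fun x => d x - m) by move=> y; rewrite /d pf pG2.
  have [y yI e] := periodic_reduce x pd; rewrite e.
  by apply: (ae_continuous_eq0 cdm wz); apply/periodP.
exists G1 => //.
have DGm : der (fun x => G2 x + m) G1.
  by apply: (der_ext (der_add DG2 (der_cst m))) => x; rewrite addr0.
apply: (derext_fun DGm) => x.
by have := dm x; rewrite /d => /eqP; rewrite subr_eq0 => /eqP <-; rewrite addrC subrK.
Qed.

End WeakDerivative.

(** * Classical solutions and the reduced system *)

Section Bounds.
Variable R : realType.
Implicit Types x y B : R.

Definition bnd B x : Prop := `|x| <= B.

Lemma bnd_add B1 B2 x y : bnd B1 x -> bnd B2 y -> bnd (B1 + B2) (x + y).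
Proof. by move=> h1 h2; apply: (le_trans (ler_normD _ _)); exact: lerD. Qed.

Lemma bnd_opp B x : bnd B x -> bnd B (- x).
Proof. by rewrite /bnd normrN. Qed.

Lemma bnd_sub B1 B2 x y : bnd B1 x -> bnd B2 y -> bnd (B1 + B2) (x - y).
Proof. by move=> h1 h2; apply: bnd_add => //; exact: bnd_opp. Qed.

Lemma bnd_mul B1 B2 x y : bnd B1 x -> bnd B2 y -> bnd (B1 * B2) (x * y).
Proof. by move=> h1 h2; rewrite /bnd normrM; exact: ler_pM. Qed.

Lemma bnd_le B B' x : bnd B x -> B <= B' -> bnd B' x.
Proof. exact: le_trans. Qed.

Lemma bnd_ge0 B x : bnd B x -> 0 <= B.
Proof. exact: le_trans. Qed.

Lemma bnd_itv B x : - B <= x <= B -> bnd B x.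
Proof. by rewrite /bnd ler_norml. Qed.

Lemma bndP B x : bnd B x -> - B <= x /\ x <= B.
Proof. by rewrite /bnd ler_norml => /andP. Qed.

End Bounds.

Ltac bnd_step := match goal with
  | H : bnd _ ?x |- bnd _ ?x => exact H
  | |- bnd _ (_ - _) => refine (bnd_sub _ _)
  | |- bnd _ (_ + _) => refine (bnd_add _ _)
  | |- bnd _ (_ * _) => refine (bnd_mul _ _)
  | |- bnd _ (- _) => refine (bnd_opp _)
  end.

(** * Wavenumber and dispersion relation *)

Section WaveParams.
Variable R : realType.
Implicit Types eps omega : R.

Definition mu_of eps omega : R := (2 * wavenumber eps omega) ^+ 2.
Definition s_of eps omega : R := eps * Num.sqrt (1 - 16 * omega ^+ 2).

(** [2 k] is the positive root of [x^2 - 4 eps omega x - 1 = 0]. *)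
Lemma kappa_bounds eps omega : 0 <= eps <= 1 / 10 -> - (1 / 4) <= omega <= 1 / 4 ->
  [/\ `|2 * wavenumber eps omega - 1| <= eps,
      (2 * wavenumber eps omega) ^+ 2 = 1 + 4 * eps * omega * (2 * wavenumber eps omega) &
      0 < wavenumber eps omega].
Proof.
move=> /andP[e0 e1] /andP[w0 w1]; rewrite /wavenumber.
set q := Num.sqrt _.
have -> : 2 * ((2 * eps * omega + q) / 2) = 2 * eps * omega + q by field.
have a0 : 0 <= 4 * eps ^+ 2 * omega ^+ 2 + 1.
  by rewrite addr_ge0// mulr_ge0 ?sqr_ge0// mulr_ge0 ?sqr_ge0.
have q2 : q ^+ 2 = 4 * eps ^+ 2 * omega ^+ 2 + 1 by rewrite sqr_sqrtr.
have q0 : 0 <= q by exact: sqrtr_ge0.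
have eo : `|eps * omega| <= eps / 4.
  rewrite normrM (ger0_norm e0) ler_wpM2l//; apply/ler_normlP; split; clear -w0 w1; lra.
have [eo1 eo2] := ler_normlP _ _ eo.
have eo3 : (eps * omega) ^+ 2 <= (eps / 4) ^+ 2.
  by rewrite -(real_normK (num_real (eps * omega))) ler_pXn2r ?nnegrE//; clear -e0; lra.
have q2' : q ^+ 2 = 4 * (eps * omega) ^+ 2 + 1 by rewrite q2; ring.
have q1 : 1 <= q.
  by rewrite -(@ler_pXn2r _ 2) ?nnegrE// q2' expr1n lerDr mulr_ge0// sqr_ge0.
have q3 : q <= 1 + eps / 2.
  rewrite -(@ler_pXn2r _ 2) ?nnegrE//; last by clear -e0; lra.
  rewrite q2'; have -> : (1 + eps / 2) ^+ 2 = 1 + eps + 4 * (eps / 4) ^+ 2 by field.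
  by clear -eo3 e0; lra.
have E : 2 * eps * omega = 2 * (eps * omega) by ring.
split.
- by apply/ler_normlP; rewrite E; split; clear -eo1 eo2 q1 q3 e0; lra.
- rewrite sqrrD q2; ring.
- by rewrite divr_gt0// E; clear -eo1 q1 e1; lra.
Qed.

(** By the quadratic equation for [2 k], [mu - 1] is [4 eps omega (2 k)]. Its square is
    [16 eps^2 omega^2 mu], which is the dispersion identity; replacing [2 k] by 1 costs [eps^2] and
    gives the second estimate. *)
Lemma params_facts eps omega : 0 <= eps <= 1 / 10 -> - (1 / 4) <= omega <= 1 / 4 ->
  [/\ `|mu_of eps omega - 1| <= 2 * eps,
      `|mu_of eps omega - 1 - 4 * eps * omega| <= eps ^+ 2,
      (mu_of eps omega - 1) ^+ 2 - eps ^+ 2 * mu_of eps omega =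
        - (mu_of eps omega * s_of eps omega ^+ 2) &
      0 <= s_of eps omega <= eps].
Proof.
move=> e01 o01; have [] := kappa_bounds e01 o01; move: e01 o01.
rewrite /mu_of; set k := 2 * wavenumber eps omega.
move=> /andP[e0 e1] /andP[w0 w1] kb kE _.
have w2 : 0 <= 1 - 16 * omega ^+ 2 by nra.
have sE : s_of eps omega ^+ 2 = eps ^+ 2 * (1 - 16 * omega ^+ 2).
  by rewrite /s_of exprMn sqr_sqrtr.
have [k1 k2] := ler_normlP _ _ kb.
have eo : `|eps * omega| <= eps / 4.
  rewrite normrM (ger0_norm e0) ler_wpM2l//; apply/ler_normlP; split; clear -w0 w1; lra.
split.
- rewrite kE; have -> : 1 + 4 * eps * omega * k - 1 = 4 * ((eps * omega) * k) by ring.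
  rewrite normrM normrM (@ger0_norm _ 4)//.
  have : `|eps * omega| * `|k| <= eps / 4 * 2.
    apply: ler_pM => //; apply/ler_normlP; split; clear -k1 k2 e1 e0; lra.
  by clear; lra.
- rewrite kE; have -> : 1 + 4 * eps * omega * k - 1 - 4 * eps * omega = 4 * ((eps * omega) * (k - 1)) by ring.
  rewrite normrM normrM (@ger0_norm _ 4)//.
  have : `|eps * omega| * `|k - 1| <= eps / 4 * eps by apply: ler_pM.
  by rewrite expr2; clear; lra.
- rewrite sE; have -> : k ^+ 2 - 1 = 4 * eps * omega * k by rewrite kE; ring.
  ring.
- rewrite /s_of mulr_ge0 ?sqrtr_ge0//= -[leRHS]mulr1 ler_wpM2l//.
  by rewrite -[leRHS]sqrtr1 ler_wsqrtr// gerBl mulr_ge0// sqr_ge0.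
Qed.

Lemma s_of_gt0 eps omega : 0 <= eps -> - (1 / 4) <= omega <= 1 / 4 ->
  ~~ degenerate eps omega -> 0 < s_of eps omega.
Proof.
move=> e0 /andP[w0 w1]; rewrite /degenerate !negb_or => /and3P[e1 w2 w3].
rewrite /s_of; apply: mulr_gt0; first by rewrite lt_neqAle eq_sym e1 e0.
rewrite sqrtr_gt0.
have l1 : omega < 1 / 4 by rewrite lt_neqAle w2.
have l2 : - (1 / 4) < omega by rewrite lt_neqAle eq_sym w3.
have : 0 < (1 - 4 * omega) * (1 + 4 * omega) by rewrite mulr_gt0//; [clear -l1|clear -l2]; lra.
by congr (_ < _); ring.
Qed.

End WaveParams.

(** * Passage between classical solutions and reduced data *)

Section Profile.
Variable R : realType.
Implicit Types (u v y z h W : R -> R) (mu b s a t : R).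

(** From [W = a (cos + a y)] and [y'' = z - y], these are [u1 = - mu W''] and
    [u2 = - (W + u1) / 4]. *)
Definition sol1 mu a y z (x : R) := mu * a * (cos x + a * (y x - z x)).
Definition sol2 mu a y z (x : R) := - ((a * (cos x + a * y x) + sol1 mu a y z x) / 4).

(** The system solved for the second derivatives: with [mu = (2 k)^2] the diffusion coefficients
    [4 k^2] and [16 k^2] are [mu] and [4 mu]. *)
Definition classical mu b u1 u2 := exists d1 d2,
  [/\ der u1 d1, der d1 (fun x => - (reaction b (u1 x, u2 x)).1 / mu),
      der u2 d2 & der d2 (fun x => - (reaction b (u1 x, u2 x)).2 / (4 * mu))].

Lemma good_sol1 mu a y z : good y -> good z -> good (sol1 mu a y z).
Proof.
move=> gy gz; apply: good_mul; first exact: good_cst.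
apply: good_add; first exact: good_cos.
by apply: good_mul; [exact: good_cst|apply: good_add => //; exact: good_opp].
Qed.

Lemma good_sol2 mu a y z : good y -> good z -> good (sol2 mu a y z).
Proof.
move=> gy gz; apply: good_opp; apply: good_mul; last exact: good_cst.
apply: good_add; last exact: good_sol1.
apply: good_mul; first exact: good_cst.
by apply: good_add; [exact: good_cos|apply: good_mul => //; exact: good_cst].
Qed.

(** The residual of the first equation is a linear combination of the residuals of the fixed point
    equation, of the bifurcation equation and of the dispersion relation ([eq1]). The second
    equation follows because the two reaction terms add up to [- u1]. *)
Lemma reduced_classical mu b s h t y z : 0 < mu ->
  (mu - 1) ^+ 2 - b * mu = - (mu * s ^+ 2) -> reduced mu b s h t y z ->
  classical mu b (sol1 mu (s * t) y z) (sol2 mu (s * t) y z).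
Proof.
move=> mu0 disp [[gh ch [gz cz [z' Dz Dz']] [gy cy [y' Dy Dy']]] [hE tE]].
set a := s * t.
have mun : mu != 0 by rewrite gt_eqF.
exists (fun x => mu * a * (- sin x + a * (y' x - z' x))).
exists (fun x => - ((a * (- sin x + a * y' x) + mu * a * (- sin x + a * (y' x - z' x))) / 4)).
have D1 : der (sol1 mu a y z) (fun x => mu * a * (- sin x + a * (y' x - z' x))).
  apply: der_scale; apply: der_add; first exact: (@der_cos R).
  by apply: der_scale; exact: der_sub.
have Dsin : der (fun x : R => - sin x) (fun x => - cos x) by apply: der_opp; exact: (@der_sin R).
have D1' : der (fun x => mu * a * (- sin x + a * (y' x - z' x)))
  (fun x => mu * a * (- cos x + a * ((z x - y x) - (h x - z x)))).
  by apply: der_scale; apply: der_add => //; apply: der_scale; exact: der_sub.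
have DW : der (fun x => a * (cos x + a * y x)) (fun x => a * (- sin x + a * y' x)).
  apply: der_scale; apply: der_add; first exact: (@der_cos R).
  exact: der_scale.
have DW' : der (fun x => a * (- sin x + a * y' x)) (fun x => a * (- cos x + a * (z x - y x))).
  by apply: der_scale; apply: der_add => //; exact: der_scale.
have D4 (f g : R -> R) : der f g -> der (fun x => - (f x / 4)) (fun x => - (g x / 4)).
  move=> fg; apply: (derext_fun (f := fun x => - (g x / 4)) (F := fun x => (- 4^-1) * f x)).
    by apply: (der_ext (der_scale _ fg)) => x; ring.
  by move=> x; ring.
have eq1 x : mu * (mu * a * (- cos x + a * ((z x - y x) - (h x - z x)))) +
    (reaction b (sol1 mu a y z x, sol2 mu a y z x)).1 = 0.
  have E1 := hE x; have E2 := tE.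
  transitivity (a ^+ 2 * (range_map mu b s h t y z x - h x)
    + a * s ^+ 2 * cos x * (mu - t ^+ 2 * Phi mu b s t y z)
    + a * (a * y x + cos x) * (- (mu * s ^+ 2) - ((mu - 1) ^+ 2 - b * mu))).
    rewrite /range_map /sol2 /sol1 /reaction /cubic_part /eta /a /=.
    by field.
  by rewrite -E1 -E2 disp !subrr !mulr0 !addr0.
have eq12 x : (reaction b (sol1 mu a y z x, sol2 mu a y z x)).2 =
   - (reaction b (sol1 mu a y z x, sol2 mu a y z x)).1 - sol1 mu a y z x.
  by rewrite /reaction /=; ring.
split.
- exact: D1.
- apply: (der_ext D1') => x.
  have := eq1 x; set A := mu * a * _; set B := _.1 => e.
  have -> : - B = mu * A by apply/eqP; rewrite eq_sym -addr_eq0 e.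
  by rewrite [mu * A]mulrC mulfK.
- by apply: D4; exact: der_add.
- apply: (der_ext (D4 _ _ (der_add DW' D1'))) => x.
  rewrite eq12; have := eq1 x; set A := mu * a * _; set B := _.1 => e.
  have -> : B = - (mu * A) by apply/eqP; rewrite -addr_eq0 addrC e.
  by rewrite /A /sol1; field.
Qed.

(** Solvability condition of the resonant oscillator: [g cos] is the derivative of the periodic
    function [y' cos + y sin]. *)
Lemma osc_source_coef g y y' : continuous g -> good y -> der y y' ->
  der y' (fun x => g x - y x) -> coef g = 0.
Proof.
move=> cg [cy ey py] Dy Dy'; rewrite /coef.
have D : der (fun x => y' x * cos x + y x * sin x) (fun x => g x * cos x).
  by apply: (der_ext (der_add (der_mul Dy' (@der_cos R)) (der_mul Dy (@der_sin R)))) => x; ring.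
rewrite (circ_der _ D); last by apply: continuous_mul => //; exact: continuous_cos.
have py' := der_periodic Dy py.
have := py' 0; have := py 0; have := cos2pi_periodic (0 : R); have := sin2pi_periodic (0 : R).
by rewrite !add0r => -> -> -> ->; rewrite subrr mulr0.
Qed.

Lemma periodic_max (f : R -> R) : continuous f -> periodic2pi f -> exists x0, forall x, `|f x| <= `|f x0|.
Proof.
move=> cf pf.
have cn : {within `[0, 2 * pi], continuous (fun x => `|f x|)}.
  by apply: continuous_subspaceT => x; apply: cvg_norm; exact: cf.
have [c _ H] := EVT_max (ltW (twopi_gt0 R)) cn.
exists c => x; have [y yI ->] := periodic_reduce x pf.
by apply: H; rewrite in_itv.
Qed.

(* The right-hand side of mu^2 W'''' + (b + 2) mu W'' + W = nonlin b u1 W. *)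
Definition nonlin (b p W : R) : R := p * ((1 + b / 2) * p - W) - p ^+ 2 * (W + p) / 4.

Lemma nonlin_bound (b p W P : R) : bnd (101/100) (1 + b / 2) -> 0 <= P <= 1 / 10 ->
  bnd (101/100 * P) p -> bnd P W -> bnd (3 * P ^+ 2) (nonlin b p W).
Proof.
move=> lb /andP[P0 P1] lp lW.
have l4 : bnd (1/4 : R) 4^-1 by rewrite /bnd ger0_norm; clear; lra.
have -> : nonlin b p W = p * ((1 + b / 2) * p - W) - p * p * (W + p) * 4^-1.
  by rewrite /nonlin; ring.
apply: bnd_le; [repeat bnd_step|clear -P0 P1].
rewrite expr2; nra.
Qed.

(* The classical solutions in terms of the critical Fourier coefficient a of W and of
   the remainders Y = W - a cos, Z = Y'' + Y, H = Z'' + Z. *)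
Lemma classical_remainders mu b s u1 u2 : 0 < mu ->
  (mu - 1) ^+ 2 - b * mu = - (mu * s ^+ 2) -> good u1 -> good u2 ->
  classical mu b u1 u2 ->
  let W x := - (u1 x + 4 * u2 x) in let a := coef W in
  let Y x := W x - a * cos x in let Z x := W x - u1 x / mu in
  let H x := W x - 2 * u1 x / mu + (reaction b (u1 x, u2 x)).1 / mu ^+ 2 in
  let q x := nonlin b (u1 x) (W x) in
  [/\ good W, osc Z Y, osc H Z, good H & coef H = 0] /\
  [/\ good q, mu * s ^+ 2 * a = - coef q &
      forall x, H x = q x - coef q * cos x - mu * (b - 2 * (mu - 1)) * Z x
        + mu * s ^+ 2 * Y x - (mu ^+ 2 - 1) * H x].
Proof.
move=> mu0 disp g1 g2 [d1 [d2 [D1 D1' D2 D2']]] W a Y Z H q.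
have mun : mu != 0 by rewrite gt_eqF.
have gk (c : R) f : good f -> good (fun x => c * f x).
  by move=> gf; apply: good_mul => //; exact: good_cst.
have gkr (c : R) f : good f -> good (fun x => f x * c).
  by move=> gf; apply: good_mul => //; exact: good_cst.
have gsub f g : good f -> good g -> good (fun x => f x - g x).
  by move=> gf gg; apply: good_add => //; exact: good_opp.
have gW : good W by apply: good_opp; apply: good_add => //; exact: gk.
have gac : good (fun x => a * cos x) by apply: gk; exact: good_cos.
have gY : good Y by exact: gsub.
have gZ : good Z by apply: gsub => //; exact: gkr.
have gr : good (fun x => (reaction b (u1 x, u2 x)).1).
  rewrite /reaction /=.
  by repeat first [exact: g1 | exact: g2 | exact: good_cst | apply: good_add | apply: good_mul | apply: good_exp].
have gH : good H.
  apply: good_add; last exact: gkr.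
  by apply: gsub => //; apply: gkr; exact: gk.
have gq : good q.
  rewrite /q /nonlin.
  by repeat first [exact: g1 | exact: gW | exact: good_cst | apply: good_add | apply: good_opp | apply: good_mul | apply: good_exp].
have DW : der W (fun x => - (d1 x + 4 * d2 x)).
  by apply: der_opp; apply: der_add => //; exact: der_scale.
have DW' : der (fun x => - (d1 x + 4 * d2 x)) (fun x => - (u1 x / mu)).
  apply: (der_ext (der_opp (der_add D1' (der_scale 4 D2')))) => x.
  by rewrite /reaction /=; field.
have DY : der Y (fun x => - (d1 x + 4 * d2 x) - a * (- sin x)).
  by apply: der_sub => //; apply: der_scale; exact: (@der_cos R).
have DY' : der (fun x => - (d1 x + 4 * d2 x) - a * (- sin x)) (fun x => Z x - Y x).
  apply: (der_ext (der_sub DW' (der_scale a (der_opp (@der_sin R))))) => x.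
  by rewrite /Z /Y; ring.
have cW := good_continuous gW; have cZ := good_continuous gZ.
have coefY : coef Y = 0.
  rewrite coef_sub//; last exact: good_continuous.
  by rewrite coef_scale ?coef_cos ?mulr1 ?subrr//; exact: continuous_cos.
have coefZ : coef Z = 0 by exact: osc_source_coef DY DY'.
have DZ : der Z (fun x => - (d1 x + 4 * d2 x) - mu^-1 * d1 x).
  apply: (derext_fun (der_sub DW (der_scale mu^-1 D1))) => x.
  by rewrite /Z mulrC.
have DZ' : der (fun x => - (d1 x + 4 * d2 x) - mu^-1 * d1 x) (fun x => H x - Z x).
  apply: (der_ext (der_sub DW' (der_scale mu^-1 D1'))) => x.
  by rewrite /H /Z; field.
have cH := good_continuous gH; have cq := good_continuous gq.
have coefH : coef H = 0 by exact: osc_source_coef DZ DZ'.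
(* The fourth-order equation in the variables [H], [Z], [Y] and [a]. The two sides differ by a
   multiple of [W] whose coefficient vanishes by the dispersion relation; the critical component of
   this identity gives the amplitude equation [amp]. *)
have E x : q x = mu ^+ 2 * H x + mu * (b - 2 * (mu - 1)) * Z x - mu * s ^+ 2 * Y x - mu * s ^+ 2 * a * cos x.
  transitivity (mu ^+ 2 * H x + mu * (b - 2 * (mu - 1)) * Z x - mu * s ^+ 2 * Y x - mu * s ^+ 2 * a * cos x
    + (mu * s ^+ 2 + ((mu - 1) ^+ 2 - b * mu)) * W x).
    by rewrite /q /nonlin /H /Z /Y /W /reaction /=; field.
  by rewrite disp subrr mul0r addr0.
have amp : mu * s ^+ 2 * a = - coef q.
  rewrite (coef_ext E).
  have ck (c : R) f : good f -> continuous (fun x => c * f x).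
    by move=> gf; exact: good_continuous (gk _ _ gf).
  have ck' (c : R) f : good f -> coef (fun x => c * f x) = c * coef f.
    by move=> gf; rewrite coef_scale//; exact: good_continuous.
  have gcos := @good_cos R.
  rewrite coef_sub.
  - rewrite coef_sub.
    + rewrite coef_add.
      * rewrite !ck'// coefH coefY coefZ coef_cos; ring.
      * exact: ck.
      * exact: ck.
    + by apply: continuous_add; exact: ck.
    + exact: ck.
  - apply: continuous_add; last by apply: continuous_opp; exact: ck.
    by apply: continuous_add; exact: ck.
  - exact: ck.
have coefYs : coef Y = 0 by [].
split; first split=> //.
- split=> //; exists (fun x => - (d1 x + 4 * d2 x) - a * (- sin x)) => //.
- split=> //; exists (fun x => - (d1 x + 4 * d2 x) - mu^-1 * d1 x) => //.
split=> // x; rewrite (E x).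
have -> : coef q = - (mu * s ^+ 2 * a) by rewrite amp opprK.
by rewrite /Y; ring.
Qed.

Lemma nonlin_profile mu b a c (y z : R) :
  nonlin b (mu * (a * c + a ^+ 2 * (y - z))) (a * c + a ^+ 2 * y) =
  a ^+ 2 * (mu * eta mu b * c ^+ 2 + a * cubic_part mu b a c y z).
Proof. by rewrite /nonlin /cubic_part /eta; field. Qed.

Lemma coef_weight mu b (f : R -> R) (k : R) : continuous f ->
  coef (fun x => mu * eta mu b * cos x ^+ 2 + k * f x) = k * coef f.
Proof.
move=> cf.
have cc : continuous (fun x : R => cos x ^+ 2) by exact: good_continuous (good_exp _ (@good_cos R)).
rewrite coef_add ?coef_scale// ?coef_cos2 ?mulr0 ?add0r//.
- by apply: continuous_mul => // ?; exact: cst_continuous.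
- by apply: continuous_mul => // ?; exact: cst_continuous.
Qed.

(** Nothing relates the amplitude [a] to [s] at the outset. The remainder is therefore bounded by
    [a^2] alone, through a self-improving estimate; positivity at 0 then forces [a > 0], so the
    rescaled data [h = H / a^2], [z], [y] make sense. They solve the range equation, which brings
    [h] into the ball of radius [rho]. Only then does [mu = t^2 Phi] locate [t = a / s]. *)
Lemma classical_reduced mu b s (del rho dl : R) u1 u2 : small_params mu b s del ->
  small_consts del rho -> 0 < s -> 0 < dl ->
  100 * dl <= del -> 200 * (500 * (200 * del)) <= rho ->
  4000 * (4000 * (4000 * (100 * del))) <= 1 ->
  (mu - 1) ^+ 2 - b * mu = - (mu * s ^+ 2) -> good u1 -> good u2 ->
  (forall x, `|u1 x| <= dl) -> (forall x, `|u2 x| <= dl) -> 0 < u1 0 ->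
  classical mu b u1 u2 ->
  exists h t y z, [/\ reduced mu b s h t y z, forall x, `|h x| <= rho,
    `|t - 33 / 20| <= 1 / 4, u1 =1 sol1 mu (s * t) y z & u2 =1 sol2 mu (s * t) y z].
Proof.
move=> sp sc s_gt0 dl0 dl1 hrho hdel disp g1 g2 b1 b2 u10 cl.
have d1e := small_consts_le sc.
have [r0 rs dr] := sc; have [m1 /andP[bb0 bb1] /andP[s0 s1]] := sp.
have [m2 m3] := ler_normlP _ _ m1.
have mu0 : 0 < mu by clear -m2 d1e; lra.
have mun : mu != 0 by rewrite gt_eqF.
have [[gW oY oH gH cH] [gq amp HE]] := classical_remainders mu0 disp g1 g2 cl.
set W := fun x => - (u1 x + 4 * u2 x) in gW oY oH gH cH gq amp HE.
set a := coef W in oY amp HE.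
set Y := fun x => W x - a * cos x in oY HE.
set Z := fun x => W x - u1 x / mu in oY oH HE.
set H := fun x => W x - 2 * u1 x / mu + (reaction b (u1 x, u2 x)).1 / mu ^+ 2 in oH gH cH HE.
set q := fun x => nonlin b (u1 x) (W x) in gq amp HE.
have {}HE x : H x = q x - coef q * cos x - mu * (b - 2 * (mu - 1)) * Z x
    + mu * s ^+ 2 * Y x - (mu ^+ 2 - 1) * H x by exact: HE.
have cq := good_continuous gq.
have bW x : bnd (5 * dl) (W x).
  have [h1 h2] := bndP (b1 x); have [h3 h4] := bndP (b2 x).
  by apply: bnd_itv; rewrite /W; clear -h1 h2 h3 h4; lra.
have ba : bnd (10 * dl) a.
  have := coef_bound (good_continuous gW) bW; rewrite -/a /bnd.
  by clear; lra.
have mub : bnd (101/100) mu by apply: bnd_itv; clear -m2 m3 d1e; lra.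
have kb : bnd (101/100) (1 + b / 2) by apply: bnd_itv; clear -bb0 bb1 d1e; lra.
have muVb : bnd (101/100) mu^-1.
  rewrite /bnd gtr0_norm ?invr_gt0// -div1r ler_pdivrMr//.
  by clear -m2 d1e; lra.
have bH0 x : bnd (100 * dl) (H x).
  have l1 : bnd dl (u1 x) by exact: b1.
  have l2 : bnd dl (u2 x) by exact: b2.
  have l3 : bnd (4 : R) (b + 3) by apply: bnd_itv; clear -bb0 bb1 d1e; lra.
  have l4 : bnd (4 : R) 4 by rewrite /bnd ger0_norm.
  have l5 : bnd (3 : R) (b / 2 + 2) by apply: bnd_itv; clear -bb0 bb1 d1e; lra.
  have l6 : bnd (2 : R) 2 by rewrite /bnd ger0_norm.
  have lW := bW x.
  have dls : dl <= 1 / 4000 by clear -dl1 d1e dl0; lra.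
  have -> : H x = W x - 2 * u1 x * mu^-1 + ((b + 3) * u1 x + 4 * u2 x
     + (b / 2 + 2) * (u1 x * u1 x) + 4 * u1 x * u2 x + u1 x * u1 x * u2 x) * (mu^-1 * mu^-1).
    by rewrite /H /reaction /=; field.
  apply: bnd_le; [repeat bnd_step|].
  have dl2 : dl * dl <= dl / 4000 by clear -dls dl0; nra.
  have dl3 : dl * dl * dl <= dl / 4000 by clear -dls dl0 dl2; nra.
  by clear -dl2 dl3 dl0; nra.
pose A : R := `|a|.
have A0 : 0 <= A by exact: normr_ge0.
have AA : A ^+ 2 = a ^+ 2 by rewrite /A real_normK// num_real.
have baA : bnd A a by exact: lexx.
have bcos x : bnd 1 (cos x : R) by exact: cos_max.
have YZ (M : R) : (forall x, `|H x| <= M) -> [/\ forall x, `|Z x| <= 48 * M & forall x, `|Y x| <= 48 * (48 * M)].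
  move=> HM; have zb := osc_bound oH HM; split=> //.
  exact: osc_bound oY zb.
have u1E x : u1 x = mu * (a * cos x + (Y x - Z x)).
  by rewrite /Y /Z; field.
have qb (N : R) : (forall x, `|Z x| <= N) -> (forall x, `|Y x| <= N) -> A + 2 * N <= 1 / 10 ->
    forall x, `|q x| <= 3 * (A + 2 * N) ^+ 2.
  move=> ZN YN NP x.
  have lZ : bnd N (Z x) by exact: ZN.
  have lY : bnd N (Y x) by exact: YN.
  have lc := bcos x.
  have N0 : 0 <= N by exact: bnd_ge0 lZ.
  apply: nonlin_bound => //.
  - by apply/andP; split; [clear -A0 N0; lra|].
  - rewrite u1E; apply: bnd_le; [repeat bnd_step|].
    by clear; lra.
  - have -> : W x = a * cos x + Y x by rewrite /Y; ring.
    by apply: bnd_le; [repeat bnd_step|clear -N0; lra].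
have lb : bnd (3 * del) (b - 2 * (mu - 1)) by apply: bnd_itv; clear -bb0 bb1 m2 m3; lra.
have lm2 : bnd (3 * del) (mu ^+ 2 - 1) by apply: bnd_itv; clear -m2 m3 d1e; apply/andP; split; nra.
have ls2 : bnd del (s ^+ 2) by rewrite /bnd ger0_norm ?sqr_ge0//; clear -s0 s1 d1e; nra.
have del0 : 0 < del by clear -dl1 dl0; lra.
(* [H] is controlled by the nonlinearity, at most [3 (A + 2 N)^2] with [N] a multiple of [M], and by
   linear terms with a factor [del]. Since [M <= 100 dl] is tiny, [N^2 <= M / 500], and all
   dependence on [M] fits into [M / 2]. *)
have improve (M : R) : (forall x, `|H x| <= M) -> M <= 100 * dl -> forall x, `|H x| <= 20 * A ^+ 2 + M / 2.
  move=> HM Ms x; have [zb yb] := YZ M HM.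
  have M0 : 0 <= M by exact: le_trans (HM x).
  pose N := 48 * (48 * M).
  have zb' (v : R) : `|Z v| <= N by apply: (le_trans (zb v)); rewrite /N; clear -M0; lra.
  have AM : A + 2 * N <= 1 / 10.
    have : A <= 10 * dl by exact: ba.
    rewrite /N; clear -Ms dl1 hdel del0; lra.
  have Q := qb N zb' yb AM.
  have Qc := coef_bound cq Q.
  have lq : bnd (3 * (A + 2 * N) ^+ 2) (q x) by exact: Q.
  have lcq : bnd (2 * (3 * (A + 2 * N) ^+ 2)) (coef q) by exact: Qc.
  have lc := bcos x.
  have lH : bnd M (H x) by exact: HM.
  have lZ : bnd (48 * M) (Z x) by exact: zb.
  have lY : bnd (48 * (48 * M)) (Y x) by exact: yb.
  change (bnd (20 * A ^+ 2 + M / 2) (H x)); rewrite HE.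
  apply: bnd_le; [repeat bnd_step|].
  have small : del * M <= M / 4000 / 4000.
    by clear -M0 hdel del0; nra.
  have sq : (A + 2 * N) ^+ 2 <= 2 * A ^+ 2 + 8 * N ^+ 2.
    by have := sqr_ge0 (A - 2 * N); clear; nra.
  have Nsq : N ^+ 2 <= M / 500.
    have : N <= 4000 * M by rewrite /N; clear -M0; lra.
    have : 0 <= N by rewrite /N; clear -M0; lra.
    move=> N0 NM.
    have h : 4000 * (4000 * M) <= 1 / 500 by clear -Ms dl1 hdel; lra.
    rewrite expr2; apply: (le_trans (ler_pM N0 N0 NM NM)).
    by clear -h M0; nra.
  by clear -small sq Nsq M0 A0; nra.
(* Taking for [M] the maximum of [|H|] itself turns the improvement into [M <= 20 A^2 + M / 2]. *)
have [x0 Hx0] := periodic_max (good_continuous gH) (let: And3 _ _ p := gH in p).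
have bH x : `|H x| <= 40 * A ^+ 2.
  apply: (le_trans (Hx0 x)).
  have := improve _ Hx0 (bH0 x0) x0; clear; lra.
have [zb yb] := YZ _ bH.
(* If [a] vanished, so would [H], [Z], [Y] and with them [u1], contrary to positivity at 0. *)
have an0 : a != 0.
  apply/eqP => a0; move: zb yb; rewrite /A a0 normr0 expr0n /= !mulr0 => zb yb.
  have Z0 : Z 0 = 0 by apply/eqP; rewrite -normr_le0; exact: zb.
  have Y0 : Y 0 = 0 by apply/eqP; rewrite -normr_le0; exact: yb.
  by move: u10; rewrite u1E a0 Z0 Y0 mul0r subrr addr0 mulr0 ltxx.
have a2 : 0 < a ^+ 2 by rewrite exprn_even_gt0.
pose y x := a ^- 2 * Y x; pose z x := a ^- 2 * Z x; pose h x := a ^- 2 * H x.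
have YE x : Y x = a ^+ 2 * y x by rewrite /y mulVKf// gt_eqF.
have ZE x : Z x = a ^+ 2 * z x by rewrite /z mulVKf// gt_eqF.
have HhE x : H x = a ^+ 2 * h x by rewrite /h mulVKf// gt_eqF.
have scaled (f g : R -> R) (C : R) : (forall x, f x = a ^+ 2 * g x) ->
    (forall x, `|f x| <= C * A ^+ 2) -> forall x, bnd C (g x).
  move=> fg fC x; have := fC x; rewrite fg AA normrM (ger0_norm (ltW a2)) mulrC.
  by rewrite ler_pM2r.
have bh := scaled H h 40 HhE bH.
have bz : forall x, bnd 2000 (z x).
  apply: (scaled Z z 2000 ZE) => x; apply: (le_trans (zb x)).
  by rewrite AA; clear -a2; lra.
have by_ : forall x, bnd (50 * 2000) (y x).
  apply: (scaled Y y (50 * 2000) YE) => x; apply: (le_trans (yb x)).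
  by rewrite AA; clear -a2; lra.
have oz : osc h z by exact: osc_scale.
have oy : osc z y by exact: osc_scale.
have gz : good z by case: oz.
have gy : good y by case: oy.
have gh : good h by apply: good_mul => //; exact: good_cst.
have ch : coef h = 0 by rewrite coef_scale ?cH ?mulr0//; exact: good_continuous.
have u1E' x : u1 x = mu * (a * cos x + a ^+ 2 * (y x - z x)).
  by rewrite u1E YE ZE mulrBr.
have WE x : W x = a * cos x + a ^+ 2 * y x by rewrite -YE /Y; ring.
have As : A <= del / 10 by have : A <= 10 * dl by [exact: ba]; clear -dl1; lra.
have abig : A * (50 * 2000) <= 1 / 1000 by clear -As hdel del0; lra.
have a_gt0 : 0 < a.
  move: u10; rewrite u1E' cos0 mulr1 pmulr_rgt0//.
  have -> : a + a ^+ 2 * (y 0 - z 0) = a * (1 + a * (y 0 - z 0)) by ring.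
  have ly := by_ 0; have lz := bz 0.
  have /bndP[k1 _] : bnd (1 / 2) (a * (y 0 - z 0)).
    by apply: bnd_le; [repeat bnd_step|clear -abig A0; lra].
  by rewrite pmulr_lgt0//; clear -k1; lra.
have AE : A = a by rewrite /A gtr0_norm.
pose cp x := cubic_part mu b a (cos x) (y x) (z x).
have qE x : q x = a ^+ 2 * (mu * eta mu b * cos x ^+ 2 + a * cp x).
  by rewrite /q u1E' WE nonlin_profile.
pose t := a / s.
have stE : s * t = a by rewrite /t mulrC divfK// gt_eqF.
have gcp : good cp.
  have := good_cubic_part mu b s t gy gz; rewrite stE; exact.
have ccp := good_continuous gcp.
have cwt : continuous (fun x => mu * eta mu b * cos x ^+ 2 + a * cp x).
  apply: good_continuous; apply: good_add.
    by apply: good_mul; [exact: good_cst|apply: good_exp; exact: good_cos].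
  by apply: good_mul => //; exact: good_cst.
have qcE : coef q = a ^+ 2 * (a * coef cp).
  by rewrite (coef_ext qE) coef_scale// coef_weight.
have PhiE : Phi mu b s t y z = - coef cp by rewrite /Phi stE.
have tP : mu = t ^+ 2 * Phi mu b s t y z.
  rewrite PhiE /t.
  have : mu * s ^+ 2 = - (a ^+ 2 * coef cp).
    apply: (mulIf an0); rewrite amp qcE; ring.
  move=> e; apply: (mulIf (_ : s ^+ 2 != 0)); first by rewrite gt_eqF// exprn_gt0.
  by rewrite e; field; rewrite gt_eqF.
have hE : h =1 range_map mu b s h t y z.
  move=> x; have := HE x; rewrite HhE YE ZE qE qcE => e.
  apply: (mulfI (_ : a ^+ 2 != 0)); first by rewrite gt_eqF.
  rewrite [LHS]e /range_map stE PhiE -/(cp x); ring.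
have red : reduced mu b s h t y z by [].
have lcp x : bnd (3 * (2000 * 100)) (cp x).
  rewrite /cp /cubic_part !expr2.
  have ly := by_ x; have lz := bz x; have lc := bcos x.
  have le : bnd (2 * del) (eta mu b) by exact: eta_small sp sc.
  have l4 : bnd (1/4 : R) 4^-1 by rewrite /bnd ger0_norm; clear; lra.
  have lyz : bnd (102 * 1000) (y x - z x) by apply: bnd_le; [repeat bnd_step|clear; lra].
  have dsm : del * (4000 * 4000) <= 1 / 4000 by clear -hdel; lra.
  have ley : bnd (1/4000) (eta mu b * y x).
    by apply: bnd_le; [repeat bnd_step|clear -dsm del0; lra].
  have lw : bnd 4000 (eta mu b * y x - (1 + b / 2) * mu * z x).
    by apply: bnd_le; [repeat bnd_step|clear; lra].
  have lay : bnd (1/1000) (a * y x) by apply: bnd_le; [repeat bnd_step|].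
  have layz : bnd (1/500) (a * (y x - z x)).
    by apply: bnd_le; [repeat bnd_step|clear -abig A0; lra].
  have lA : bnd (1/4000) A by rewrite /bnd ger0_norm//; clear -As dsm del0; lra.
  have law : bnd (1/10) (a * (eta mu b * y x - (1 + b / 2) * mu * z x)).
    by apply: bnd_le; [repeat bnd_step|clear -abig A0; lra].
  have lec : bnd (1/1000) (eta mu b * cos x).
    by apply: bnd_le; [repeat bnd_step|clear -dsm del0; lra].
  apply: bnd_le; [repeat bnd_step|].
  by clear; lra.
(* The bounds available so far are huge but absolute, and every term of the range equation has a
   factor of size [del], chosen small enough to beat them. *)
have bhr x : `|h x| <= rho.
  change (bnd rho (h x)); rewrite hE /range_map stE PhiE -/(cp x).
  have lP : bnd (6 * (2000 * 100)) (coef cp).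
    by apply: bnd_le (coef_bound ccp lcp) _; clear; lra.
  have ly := by_ x; have lz := bz x; have lc := bcos x; have lh := bh x; have lcx := lcp x.
  have le : bnd (2 * del) (eta mu b) by exact: eta_small sp sc.
  have la : bnd (del / 10) a by apply: bnd_le baA As.
  rewrite [cos x ^+ 2]expr2.
  apply: bnd_le; [repeat bnd_step|].
  by clear -hrho del0; nra.
have tb : `|t - 33 / 20| <= 1 / 4.
  (* [Phi] depends on [s] and [t] only through the product [a]. Evaluating it with [s] replaced by
     [a] and [t] by 1 gives [Phi] close to 3/8 before anything is known about [t]. *)
  have sp' : small_params mu b a del.
    by split=> //; rewrite ?bb0 ?bb1 ?(ltW a_gt0)//=; rewrite AE in As; clear -As del0; lra.
  have rr x : `|h x| <= rho by exact: bhr.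
  have z100 := osc_bound oz rr; have y100 := osc_bound oy z100.
  have l1 : lip 0 2 1 (1 : R) 1.
    by split; rewrite ?subrr ?normr0 ?mulr0// normr1; clear; lra.
  have ly x : lip 0 (1/100) (1/100) (y x) (y x).
    by split; rewrite ?subrr ?normr0 ?mulr0//; apply: (le_trans (y100 x)).
  have lz x : lip 0 (1/100) (1/100) (z x) (z x).
    by split; rewrite ?subrr ?normr0 ?mulr0//; apply: (le_trans (z100 x)); clear -rs r0; lra.
  have [P38 _ _] := Phi_lip sp' sc (lexx 0) gy gz gy gz l1 ly lz.
  have PE : Phi mu b a 1 y z = Phi mu b s t y z by rewrite /Phi stE mulr1.
  rewrite PE in P38.
  have t0 : 0 < t by rewrite divr_gt0.
  have [p1 p2] := ler_normlP _ _ P38.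
  move: tP p1 p2; set P := Phi _ _ _ _ _ _ => tP p1 p2.
  have t2a : 196 / 100 <= t ^+ 2.
    rewrite leNgt; apply/negP => lt2.
    have : t ^+ 2 * P <= 196/100 * (4/10).
      by apply: ler_pM; [exact: sqr_ge0|clear -p1; lra|exact: ltW|clear -p2; lra].
    by rewrite -tP; clear -m2 d1e; lra.
  have t2b : t ^+ 2 <= 361 / 100.
    rewrite leNgt; apply/negP => lt2.
    have : 361/100 * (35/100) <= t ^+ 2 * P.
      by apply: ler_pM; [clear; lra|clear; lra|exact: ltW|clear -p1; lra].
    by rewrite -tP; clear -m3 d1e; lra.
  have ta : 14 / 10 <= t by rewrite leNgt; apply/negP => lt1; clear -lt1 t2a t0; nra.
  have tb : t <= 19 / 10 by rewrite leNgt; apply/negP => lt1; clear -lt1 t2b t0; nra.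
  by apply/ler_normlP; split; clear -ta tb; lra.
exists h, t, y, z; split=> // x; rewrite stE.
  by rewrite u1E' /sol1; ring.
have : W x = - (u1 x + 4 * u2 x) by [].
rewrite WE u1E' /sol2 /sol1 => e.
have -> : u2 x = - (a * cos x + a ^+ 2 * y x + mu * (a * cos x + a ^+ 2 * (y x - z x))) / 4.
  by rewrite e; field.
by field.
Qed.

End Profile.

(** * Expansion of the amplitude *)

Ltac bnd_auto := repeat first [bnd_step | exact: lexx].

Section Expansion.
Variable R : realType.
Implicit Types (e m a c t r sh : R).

(* In the expansions every small quantity is written as e times a bounded one:
   mu = 1 + e m, b = e^2, s = e sh, and h, y, z are e times bounded functions. *)
Definition cubic_rem e m a c (y z : R) : R :=
  let mu := 1 + e * m in
  let eta1 := m + e * (mu * 2^-1) in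
  let k := (1 + e * e * 2^-1) * mu in
  let p := mu * a * (y - z) in
  let g := a * y + p in
  mu * (y - z) * (eta1 * c + a * e * (e * eta1 * y - k * z))
  + mu * c * eta1 * y - c * z * (2 * m + e * m * m + e * (mu * mu * 2^-1))
  - ((2 * mu * c * p + e * e * (p * p)) * ((1 + mu) * c + e * e * g)
     + mu * mu * (c * c) * g) * 4^-1
  - m * m * (1 + e * m * 4^-1) * (c * c * c).

Lemma cubic_expansion e m a c (y z : R) :
  cubic_part (1 + e * m) (e ^+ 2) (e * a) c (e * y) (e * z) =
  - c ^+ 3 / 2 + e * (- (c * z) - 5 / 4 * m * c ^+ 3 + e * cubic_rem e m a c y z).
Proof. by rewrite /cubic_part /eta /cubic_rem; field. Qed.

(** The remainder is a polynomial in bounded quantities. The constant is left to unification, which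
    assembles it from [B]; since it is introduced before the variables, it is uniform in them. The
    same device serves for [range_rem_bound]. *)
Lemma cubic_rem_bound (B : R) : exists C, forall e m a c y z, bnd 1 e -> bnd B m ->
  bnd B a -> bnd 1 c -> bnd B y -> bnd B z -> bnd C (cubic_rem e m a c y z).
Proof.
eexists => e m a c y z be bm ba bc by_ bz.
by rewrite /cubic_rem; bnd_auto.
Qed.

Definition range_rem e m a sh phi c (h y z : R) (r : R) : R :=
  let mu := 1 + e * m in
  (m * (m + e * (mu * 2^-1)) + mu * 2^-1) * (c * c)
  + a * (- (c * z) - 5 * 4^-1 * m * (c * c * c) + e * r + phi * c)
  - mu * (e - 2 * m) * z + e * mu * (sh * sh) * y - (2 * m + e * m * m) * h.

Lemma range_expansion e m sh t phi (h y z : R -> R) x :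
  Phi (1 + e * m) (e ^+ 2) (e * sh) t (fun x => e * y x) (fun x => e * z x) = 3 / 8 + e * phi ->
  range_map (1 + e * m) (e ^+ 2) (e * sh) (fun x => e * h x) t
    (fun x => e * y x) (fun x => e * z x) x =
  e * (m * cos x ^+ 2 + sh * t * (3 / 8 * cos x - cos x ^+ 3 / 2)
    + e * range_rem e m (sh * t) sh phi (cos x) (h x) (y x) (z x)
        (cubic_rem e m (sh * t) (cos x) (y x) (z x))).
Proof.
move=> PE; rewrite /range_map PE -[e * sh * t]mulrA cubic_expansion /eta /range_rem.
by set r := cubic_rem _ _ _ _ _ _; field.
Qed.

Lemma range_rem_bound (B : R) : exists C, forall e m a sh phi c h y z r, bnd 1 e -> bnd B m ->
  bnd B a -> bnd 1 sh -> bnd B phi -> bnd 1 c -> bnd B h -> bnd B y -> bnd B z -> bnd B r ->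
  bnd C (range_rem e m a sh phi c h y z r).
Proof.
eexists => e m a sh phi c h y z r be bm ba bs bp bc bh by_ bz br.
by rewrite /range_rem; bnd_auto.
Qed.

(** The functional that reads the critical coefficient of [cos z] off [h = z'' + z], so that [z]
    need not be computed. *)
Definition moment (f : R -> R) : R := pi^-1 * circ (fun x => (2 / 3 - 3^-1 * cos x ^+ 2) * f x).

Let weight_continuous : continuous (fun x : R => 2 / 3 - 3^-1 * cos x ^+ 2).
Proof.
apply: continuous_add; first exact: cst_continuous.
apply/continuous_opp/continuous_mul; first exact: cst_continuous.
exact: good_continuous (good_exp _ (@good_cos R)).
Qed.

Lemma moment_bound (f : R -> R) (M : R) : continuous f -> (forall x, `|f x| <= M) ->
  bnd (2 * M) (moment f).
Proof.
move=> cf fM; rewrite /bnd /moment normrM ger0_norm ?invr_ge0 ?pi_ge0//.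
rewrite ler_pdivrMl ?pi_gt0//; have -> : pi * (2 * M) = 2 * pi * M by ring.
apply: circ_bound; first exact: continuous_mul.
move=> x; rewrite normrM -[leRHS]mul1r; apply: ler_pM => //.
have h0 := sqr_ge0 (cos x); have h1 : cos x ^+ 2 <= 1.
  by rewrite -subr_ge0 -sin2cos2 sqr_ge0.
by apply/ler_normlP; split; clear -h0 h1; lra.
Qed.

Lemma moment_cos2_osc (h z : R -> R) : continuous h -> osc h z ->
  coef (fun x => cos x * z x) = moment h.
Proof.
move=> ch oz; rewrite /coef /moment -(circ_cos2_osc ch oz).
by congr (_ * _); apply: circ_ext => x; ring.
Qed.

(** 5/12 is [2/3 - 1/3 3/4], from the means of [cos^2] and [cos^4]; the amplitude term has only odd
    powers of [cos] and drops out. *)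
Lemma moment_leading m a e (f : R -> R) : continuous f ->
  moment (fun x => m * cos x ^+ 2 + a * (3 / 8 * cos x - cos x ^+ 3 / 2) + e * f x) =
  5 / 12 * m + e * moment f.
Proof.
move=> cf.
have gc n : good (fun x : R => cos x ^+ n) by exact: good_exp (@good_cos R).
have cc (k : R) n : continuous (fun x : R => k * cos x ^+ n).
  by apply: continuous_mul; [exact: cst_continuous|exact: good_continuous].
rewrite /moment.
have -> : circ (fun x => (2 / 3 - 3^-1 * cos x ^+ 2) *
     (m * cos x ^+ 2 + a * (3 / 8 * cos x - cos x ^+ 3 / 2) + e * f x)) =
   circ (fun x => ((2 / 3 * m) * cos x ^+ 2 + (- (3^-1) * m) * cos x ^+ 4)
      + ((a / 4) * cos x ^+ 1 + (- (11 / 24) * a) * cos x ^+ 3 + (a / 6) * cos x ^+ 5)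
      + e * ((2 / 3 - 3^-1 * cos x ^+ 2) * f x)).
  by apply: circ_ext => x; field.
have cwf : continuous (fun x => (2 / 3 - 3^-1 * cos x ^+ 2) * f x) by exact: continuous_mul.
have ck (k : R) n : circ (fun x => k * cos x ^+ n) = k * circ (fun x : R => cos x ^+ n).
  by rewrite circ_scale//; exact: good_continuous.
rewrite circ_add; last 2 first.
- by apply: continuous_add; [exact: continuous_add|apply: continuous_add => //; exact: continuous_add].
- by apply: continuous_mul => // ?; exact: cst_continuous.
rewrite circ_add; [|exact: continuous_add|by apply: continuous_add => //; exact: continuous_add].
rewrite circ_add// circ_add//; last exact: continuous_add.
rewrite circ_add// !ck circ_cos2 circ_cos4 circ_cos3 circ_cos5.
rewrite (@circ_ext _ (fun x => cos x ^+ 1) cos)// circ_cos1 circ_scale//.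
have pn : pi != 0 :> R by rewrite gt_eqF// pi_gt0.
by move: pn; generalize (pi : R) (circ (fun x => (2 / 3 - 3^-1 * cos x ^+ 2) * f x)) => p k pn; field.
Qed.

Lemma good_cubic_rem e m a (y z : R -> R) : good y -> good z ->
  good (fun x => cubic_rem e m a (cos x) (y x) (z x)).
Proof.
move=> gy gz; rewrite /cubic_rem.
by repeat first [exact: gy | exact: gz | exact: good_cos | exact: good_cst |
  apply: good_add | apply: good_opp | apply: good_mul | apply: good_exp].
Qed.

Lemma good_range_rem e m a sh phi (h y z r : R -> R) : good h -> good y -> good z -> good r ->
  good (fun x => range_rem e m a sh phi (cos x) (h x) (y x) (z x) (r x)).
Proof.
move=> gh gy gz gr; rewrite /range_rem.
by repeat first [exact: gh | exact: gy | exact: gz | exact: gr | exact: good_cos | exact: good_cst |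
  apply: good_add | apply: good_opp | apply: good_mul | apply: good_exp].
Qed.

(** The contraction only gives [|h| <= rho] with a fixed [rho]. Inserting this into
    [h = range_map h] once more shows the order [e], since each term of the map carries a factor of
    that size. *)
Lemma reduced_small mu b s del rho e (h : R -> R) t (y z : R -> R) :
  small_params mu b s del -> small_consts del rho -> reduced mu b s h t y z ->
  (forall x, `|h x| <= rho) -> `|t - 33 / 20| <= 1 / 4 ->
  0 <= e <= 1 / 10 -> `|mu - 1| <= 2 * e -> b = e ^+ 2 -> s <= e ->
  [/\ `|Phi mu b s t y z - 3 / 8| <= 22 / 1000 , forall x, `|h x| <= 16 * e,
      forall x, `|z x| <= 48 * (16 * e) & forall x, `|y x| <= 48 * (48 * (16 * e))].
Proof.
move=> sp sc [[gh ch oz oy] [hE tE]] hb tb /andP[e0 e1] me bE se.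
have [r0 rs dr] := sc; have [m1 /andP[bb0 bb1] /andP[s0 s1]] := sp.
have [gz _ _] := oz; have [gy _ _] := oy.
have z100 := osc_bound oz hb; have y100 := osc_bound oy z100.
have [t1 t2] := ler_normlP _ _ tb.
have lt : lip 0 2 1 t t.
  by split; rewrite ?subrr ?normr0 ?mulr0//; apply/ler_normlP; split; clear -t1 t2; lra.
have ly x : lip 0 (1/100) (1/100) (y x) (y x).
  by split; rewrite ?subrr ?normr0 ?mulr0//; apply: (le_trans (y100 x)).
have lz x : lip 0 (1/100) (1/100) (z x) (z x).
  by split; rewrite ?subrr ?normr0 ?mulr0//; apply: (le_trans (z100 x)); clear -rs r0; lra.
have [P38 _ _] := Phi_lip sp sc (lexx 0) gy gz gy gz lt ly lz.
have hb16 x : `|h x| <= 16 * e.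
  have [cpb _ _] := cubic_part_lip sp sc (lexx 0) (cos_max x) lt (ly x) (lz x).
  have lc : bnd 1 (cos x : R) by exact: cos_max.
  have lcp : bnd 1 (cubic_part mu b (s * t) (cos x) (y x) (z x)).
    have l3 : bnd (1/2) (cos x * cos x * cos x * 2^-1 : R).
      have l2 : bnd (1/2 : R) 2^-1 by rewrite /bnd ger0_norm; clear; lra.
      by apply: bnd_le; [repeat bnd_step|clear; lra].
    have lcp' : bnd (11/1000) (cubic_part mu b (s * t) (cos x) (y x) (z x) + cos x ^+ 3 / 2) by exact: cpb.
    rewrite (_ : cubic_part _ _ _ _ _ _ = (cubic_part mu b (s * t) (cos x) (y x) (z x) + cos x ^+ 3 / 2)
      - cos x * cos x * cos x * 2^-1); last by ring.
    by apply: bnd_le; [repeat bnd_step|clear; lra].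
  have lP : bnd 1 (Phi mu b s t y z).
    move: P38 => /ler_normlP[p1 p2]; apply: bnd_itv; clear -p1 p2; lra.
  have [k1 k2] := ler_normlP _ _ me.
  have e2 : e ^+ 2 <= e / 10 by clear -e0 e1; nra.
  have le : bnd (3 * e) (eta mu b).
    by apply: bnd_itv; rewrite /eta bE; apply/andP; split; clear -k1 k2 e2 e0 e1; nra.
  have lmu : bnd (12/10) mu by apply: bnd_itv; clear -k1 k2 e1 e0; lra.
  have lb : bnd (5 * e) (b - 2 * (mu - 1)).
    by apply: bnd_itv; rewrite bE; have := sqr_ge0 e; clear -k1 k2 e2 e0 e1; lra.
  have lm2 : bnd (5 * e) (mu ^+ 2 - 1).
    by apply: bnd_itv; apply/andP; split; clear -k1 k2 e1 e0; nra.
  have ls : bnd e s by rewrite /bnd ger0_norm.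
  have ltt : bnd 2 t by case: lt.
  have ls2 : bnd e (s ^+ 2) by rewrite /bnd ger0_norm ?sqr_ge0//; clear -s0 se e0 e1; nra.
  have lyx : bnd (1/100) (y x) by case: (ly x).
  have lzx : bnd (1/100) (z x) by case: (lz x).
  have lhx : bnd (1/100) (h x) by apply: (le_trans (hb x)); clear -rs r0; lra.
  change (bnd (16 * e) (h x)); rewrite hE /range_map [cos x ^+ 2]expr2.
  by apply: bnd_le; [repeat bnd_step|clear -e0; lra].
have zb := osc_bound oz hb16.
by split=> //; exact: osc_bound oy zb.
Qed.

Definition root23 : R := Num.sqrt (2 / 3).

(** With [w = mu - 1], the equation is [t^2 (3/8 + 65/48 w) = 1 + w] up to order e^2, that is
    [t^2 = 8/3 (1 - 47/18 w)], since 65/18 - 1 = 47/18. The square root is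
    [2 root23 (1 - 47/36 w)]. *)
Lemma amplitude_expansion : exists2 C, 0 <= C & forall e m sh del rho h t (y z : R -> R),
  small_params (1 + e * m) (e ^+ 2) (e * sh) del -> small_consts del rho ->
  reduced (1 + e * m) (e ^+ 2) (e * sh) h t y z ->
  (forall x, `|h x| <= rho) -> `|t - 33 / 20| <= 1 / 4 ->
  0 < e <= 1 / 100 -> `|m| <= 2 -> `|sh| <= 1 ->
  `|t - 2 * root23 * (1 - 47 / 36 * (e * m))| <= C * e ^+ 2.
Proof.
(* The bound of [y / e] in [reduced_small], the largest of the three rescaled functions. *)
pose B : R := 48 * (48 * 16).
have [C1 HC1] := cubic_rem_bound B.
(* One bound for all arguments of [range_rem]; the last summand is that of [phi], the first-order
   correction of [Phi]. *)
pose B2 : R := B + C1 + 2 * (1 * B + 5 / 4 * B * 1 + C1).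
have [C2 HC2] := range_rem_bound B2.
have [C3 HC3] : exists C, forall e m r3 : R, bnd 1 e -> bnd 2 m -> bnd (2 * C2 + 2 * C1) r3 ->
    bnd C ((8 / 3) * ((47 / 36) * (47 / 36) * (m * m) * (3 / 8 + 65 / 48 * (e * m))
      - (47 / 18) * (65 / 48) * (m * m)
      + (1 - 47 / 36 * (e * m)) * (1 - 47 / 36 * (e * m)) * r3)).
  by eexists => e m r3 be bm br; bnd_auto.
exists (3 * `|C3|) => [|e m sh del rho h t y z sp sc red hb tb /andP[e0 e1] m2 sh1].
  by rewrite mulr_ge0.
have [[gh ch oz oy] [hE tE]] := red.
have me : `|1 + e * m - 1| <= 2 * e.
  by rewrite addrC addKr normrM gtr0_norm// mulrC ler_wpM2r// ltW.
have se : e * sh <= e.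
  by rewrite ger_pMr//; exact: le_trans (ler_norm _) sh1.
have e01 : 0 <= e <= 1 / 10 by rewrite (ltW e0) /=; clear -e1; lra.
have [P38 h16 z16 y16] := reduced_small sp sc red hb tb e01 me erefl se.
have en : e != 0 by rewrite gt_eqF.
pose hh x := e^-1 * h x; pose yy x := e^-1 * y x; pose zz x := e^-1 * z x.
have hhE : h = fun x => e * hh x by apply/funext => x; rewrite /hh mulVKf.
have yyE : y = fun x => e * yy x by apply/funext => x; rewrite /yy mulVKf.
have zzE : z = fun x => e * zz x by apply/funext => x; rewrite /zz mulVKf.
have ozz : osc hh zz by exact: osc_scale.
have oyy : osc zz yy by exact: osc_scale.
have [gzz _ _] := ozz; have [gyy _ _] := oyy.
have ghh : good hh by apply: good_mul => //; exact: good_cst.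
have scl (f : R -> R) (k : R) : (forall x, `|f x| <= k * e) -> k <= B -> forall x, bnd B (e^-1 * f x).
  move=> fk kB x; rewrite /bnd normrM gtr0_norm ?invr_gt0// ler_pdivrMl// mulrC.
  by apply: (le_trans (fk x)); rewrite ler_wpM2r// ltW.
have bh : forall x, bnd B (hh x) by apply: (scl _ _ h16); rewrite /B; clear; lra.
have bz : forall x, bnd B (zz x).
  by apply: (scl _ (48 * 16)) => [x|]; [rewrite -mulrA; exact: z16|rewrite /B; clear; lra].
have by_ : forall x, bnd B (yy x).
  by apply: (scl _ B) => // x; apply: le_trans (y16 x) _; rewrite /B; clear -e0; lra.
have [tl tu] := ler_normlP _ _ tb.
have ltt : bnd 2 t by apply: bnd_itv; clear -tl tu; lra.
have le : bnd 1 e by rewrite /bnd gtr0_norm//; clear -e1; lra.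
have lsh : bnd 1 sh by [].
have lm : bnd 2 m by [].
have B16 : 2 <= B by rewrite /B; clear; lra.
have lmB : bnd B m by exact: bnd_le lm B16.
have la : bnd B (sh * t).
  by apply: bnd_le (bnd_mul lsh ltt) _; rewrite mul1r.
have lc x : bnd 1 (cos x : R) by exact: cos_max.
pose r1 x := cubic_rem e m (sh * t) (cos x) (yy x) (zz x).
have br1 x : bnd C1 (r1 x) by exact: HC1.
have gr1 : good r1 by exact: good_cubic_rem.
pose c1 x := - (cos x * zz x) - 5 / 4 * m * cos x ^+ 3 + e * r1 x.
have gcz : good (fun x => cos x * zz x) by apply: good_mul => //; exact: good_cos.
have gc3 (k : R) : good (fun x : R => k * cos x ^+ 3).
  by apply: good_mul; [exact: good_cst|apply: good_exp; exact: good_cos].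
have ger : good (fun x => e * r1 x) by apply: good_mul => //; exact: good_cst.
have gc1 : good c1.
  by apply: good_add => //; apply: good_add; [exact: good_opp|apply: good_opp; exact: gc3].
have bc1 x : bnd (1 * B + 5 / 4 * B * 1 + C1) (c1 x).
  have l5 : bnd (5 / 4 : R) (5 / 4) by rewrite /bnd ger0_norm; clear; lra.
  have lcx := lc x; have lzx := bz x; have lrx := br1 x.
  have l3 : bnd 1 (cos x ^+ 3 : R).
    by rewrite (_ : cos x ^+ 3 = cos x * cos x * cos x); [apply: bnd_le; [bnd_auto|clear; lra]|ring].
  rewrite /c1; apply: bnd_le; [repeat bnd_step|].
  by clear; lra.
pose phi := - coef c1.
have cpE x : cubic_part (1 + e * m) (e ^+ 2) (e * sh * t) (cos x) (y x) (z x) =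
    - 2^-1 * cos x ^+ 3 + e * c1 x.
  by rewrite yyE zzE -mulrA cubic_expansion /c1 /r1; ring.
have PE : Phi (1 + e * m) (e ^+ 2) (e * sh) t y z = 3 / 8 + e * phi.
  rewrite /Phi (coef_ext cpE) coef_add; last 2 first.
  - exact: good_continuous (gc3 _).
  - by apply: good_continuous; apply: good_mul => //; exact: good_cst.
  have cc1 := good_continuous gc1; have cc3 := good_continuous (good_exp 3 (@good_cos R)).
  rewrite (coef_scale _ cc3) (coef_scale _ cc1) coef_cos3.
  by rewrite /phi; field.
have bphi : bnd (2 * (1 * B + 5 / 4 * B * 1 + C1)) phi.
  by apply: bnd_opp; exact: coef_bound (good_continuous gc1) bc1.
pose r2 x := range_rem e m (sh * t) sh phi (cos x) (hh x) (yy x) (zz x) (r1 x).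
have gr2 : good r2 by exact: good_range_rem.
have C10 : 0 <= C1 by exact: bnd_ge0 (br1 0).
have BB2 : B <= B2 by rewrite /B2; clear -C10 B16; lra.
have C1B2 : C1 <= B2 by rewrite /B2; clear -C10 B16; lra.
have phiB2 : 2 * (1 * B + 5 / 4 * B * 1 + C1) <= B2 by rewrite /B2; clear -C10 B16; lra.
have br2 x : bnd C2 (r2 x).
  apply: HC2 => //; try by [exact: bnd_le BB2 | exact: bnd_le phiB2 | exact: bnd_le C1B2].
have hhexp x : hh x = m * cos x ^+ 2 + sh * t * (3 / 8 * cos x - cos x ^+ 3 / 2) + e * r2 x.
  apply: (mulfI en); have := hE x; rewrite yyE zzE hhE => ->.
  by apply: range_expansion; rewrite -yyE -zzE.
have czE : coef (fun x => cos x * zz x) = 5 / 12 * m + e * moment r2.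
  rewrite (moment_cos2_osc (good_continuous ghh) ozz).
  rewrite -(moment_leading m (sh * t) e (good_continuous gr2)).
  by congr (_ * _); apply: circ_ext => x; rewrite hhexp.
have bm2 : bnd (2 * C2) (moment r2) by exact: moment_bound (good_continuous gr2) br2.
have br1c : bnd (2 * C1) (coef r1) by exact: coef_bound (good_continuous gr1) br1.
(* 65/48 is 5/12, from [cos z], plus [5/4 3/4], from the correction of the [cos^3] term. *)
have phiE : phi = 65 / 48 * m + e * (moment r2 - coef r1).
  rewrite /phi /c1 coef_add; [|exact: good_continuous (good_add (good_opp gcz) (good_opp (gc3 _)))|exact: good_continuous].
  rewrite coef_sub; last 2 first.
  - exact: good_continuous (good_opp gcz).
  - exact: good_continuous (gc3 _).
  rewrite (@coef_ext _ (fun x => - (cos x * zz x)) (fun x => -1 * (cos x * zz x))); last by move=> x; rewrite mulN1r.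
  have ccz := good_continuous (good_mul (@good_cos R) gzz).
  have cr1 := good_continuous gr1; have cc3 := good_continuous (good_exp 3 (@good_cos R)).
  rewrite (coef_scale _ ccz) (coef_scale _ cc3) (coef_scale _ cr1).
  by rewrite coef_cos3 czE; field.
have br3 : bnd (2 * C2 + 2 * C1) (moment r2 - coef r1) by exact: bnd_sub.
have {}HC3 := HC3 _ _ _ le lm br3.
set r3 := moment r2 - coef r1 in phiE br3 HC3.
rewrite PE phiE in tE P38.
set w := e * m in tE P38 *.
set P := 3 / 8 + e * (65 / 48 * m + e * r3) in tE P38.
have root2 : root23 ^+ 2 = 2 / 3 by rewrite sqr_sqrtr// divr_ge0.
have root0 : 0 <= root23 by exact: sqrtr_ge0.
set t1 := 2 * root23 * (1 - 47 / 36 * w).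
have w1 : `|w| <= 2 / 100.
  rewrite /w normrM gtr0_norm//; have : e * `|m| <= 1/100 * 2 by apply: ler_pM => //; exact: ltW.
  by clear; lra.
have [w2 w3] := ler_normlP _ _ w1.
have t10 : 0 <= t1 by rewrite mulr_ge0 ?mulr_ge0//; clear -w2 w3; lra.
(* [t^2 P - t1^2 P] with [t^2 P = mu]: the terms of order 0 and 1 cancel by the choice of [t1], and
   [(t + t1) P], bounded below by 1/3, can be divided out. *)
have key : (t - t1) * ((t + t1) * P) = e ^+ 2 * - ((8 / 3) * ((47 / 36) * (47 / 36) * (m * m) * (3 / 8 + 65 / 48 * (e * m))
      - (47 / 18) * (65 / 48) * (m * m)
      + (1 - 47 / 36 * (e * m)) * (1 - 47 / 36 * (e * m)) * r3)).
  transitivity (t ^+ 2 * P - 4 * root23 ^+ 2 * (1 - 47 / 36 * w) ^+ 2 * P).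
    by rewrite /t1; ring.
  by rewrite -tE root2 /P /w; field.
have [p1 p2] := ler_normlP _ _ P38.
have low : 1 / 3 <= (t + t1) * P by clear -t10 p1 p2 tl tu; nra.
have lowp : 0 < (t + t1) * P by apply: lt_le_trans low; clear; lra.
have e2 : 0 <= e ^+ 2 by exact: sqr_ge0.
rewrite -(@ler_pM2r _ ((t + t1) * P))// -[X in _ * X <= _](gtr0_norm lowp) -normrM key.
rewrite normrM normrN (ger0_norm e2).
apply: (@le_trans _ _ (e ^+ 2 * `|C3|)).
  by apply: ler_wpM2l => //; apply: (le_trans HC3); exact: ler_norm.
have C30 : 0 <= `|C3| by exact: normr_ge0.
have : e ^+ 2 * `|C3| * (1 / 3) <= e ^+ 2 * `|C3| * ((t + t1) * P).
  by apply: ler_wpM2l => //; exact: mulr_ge0.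
by clear; lra.
Qed.

End Expansion.

(** * Rolls *)

Section Stationary.
Variable R : realType.
Notation leb := (@lebesgue_measure R).
Implicit Types (f g r : R -> R) (b k : R) (u : R -> R * R).

Lemma is_wderiv_ae_eq j f g g' : is_wderiv j f g -> L2per g' ->
  {ae leb, forall x, period x -> g x = g' x} -> is_wderiv j f g'.
Proof.
move=> [Lg gE] Lg' gg'; split=> // phi sp pp; rewrite gE//; congr (_ * _).
have cphi : continuous phi by exact: (@smooth_continuous R phi 0 sp).
apply: circ_ae.
- by apply: measurable_funM; [exact: L2per_measurable|exact: measurable_continuous].
- by apply: measurable_funM; [exact: L2per_measurable|exact: measurable_continuous].
- by apply: ae_period gg' => x _ ->.
Qed.

Lemma wderiv2_equation f r (c : R) : continuous f -> Hper 2 f -> continuous r ->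
  periodic2pi r -> c != 0 ->
  {ae leb, forall x, period x -> c * wderiv 2 f x + r x = 0} ->
  exists2 f', der f f' & der f' (fun x => - r x / c).
Proof.
move=> cf [_ pf Hf] cr pr c0 E.
have cq : continuous (fun x => - r x / c).
  by apply: continuous_mul; [exact: continuous_opp|move=> ?; exact: cst_continuous].
apply: wderiv2_classical => //; first by move=> x; rewrite pr.
apply: is_wderiv_ae_eq (wderivP (Hf 2%N isT)) (continuous_L2per cq) _.
apply: ae_period E => x _ /eqP; rewrite addr_eq0 => /eqP <-.
by rewrite mulrAC divff// mul1r.
Qed.

Lemma good_reaction b (u1 u2 : R -> R) : good u1 -> good u2 ->
  good (fun x => (reaction b (u1 x, u2 x)).1) /\
  good (fun x => (reaction b (u1 x, u2 x)).2).
Proof.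
move=> g1 g2; have g12 := good_exp 2 g1; rewrite /reaction /=.
by split; repeat first [exact: g1 | exact: g2 | exact: g12 | exact: good_cst
  | apply: good_add | apply: good_opp | apply: good_mul].
Qed.

Lemma stationary_classical b k u : 0 < k -> H2per2 u -> stationary b k u ->
  even_fun u ->
  [/\ good (fst \o u), good (snd \o u) &
      classical ((2 * k) ^+ 2) b (fst \o u) (snd \o u)].
Proof.
move=> k0 [cu H1 H2] st ev.
have g1 : good (fst \o u).
  split; [|by move=> x /=; rewrite ev|by case: H1].
  by move=> x; apply: continuous_comp; [exact: cu|exact: cvg_fst].
have g2 : good (snd \o u).
  split; [|by move=> x /=; rewrite ev|by case: H2].
  by move=> x; apply: continuous_comp; [exact: cu|exact: cvg_snd].
have [r1 r2] := good_reaction b g1 g2.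
have k2 : k ^+ 2 != 0 by rewrite expf_neq0// gt_eqF.
have k4 : k ^+ 2 * 4 != 0 by rewrite mulf_neq0// pnatr_eq0.
have k16 : k ^+ 2 * 16 != 0 by rewrite mulf_neq0// pnatr_eq0.
have E x : Nbr b k u x = 0 ->
    k ^+ 2 * 4 * wderiv 2 (fst \o u) x + (reaction b ((fst \o u) x, (snd \o u) x)).1 = 0 /\
    k ^+ 2 * 16 * wderiv 2 (snd \o u) x + (reaction b ((fst \o u) x, (snd \o u) x)).2 = 0.
  rewrite /Nbr /=; case: (u x) => p q -[/= e1 e2].
  by split; rewrite -mulrA; [exact: e1|exact: e2].
have [d1 D1 D1'] := wderiv2_equation (good_continuous g1) H1 (good_continuous r1)
  (let: And3 _ _ p := r1 in p) k4 (ae_period (fun x _ h => (E x h).1) st).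
have [d2 D2 D2'] := wderiv2_equation (good_continuous g2) H2 (good_continuous r2)
  (let: And3 _ _ p := r2 in p) k16 (ae_period (fun x _ h => (E x h).2) st).
split=> //; exists d1, d2; split=> //.
  by apply: der_ext D1' _ => x; congr (_ / _); ring.
by apply: der_ext D2' _ => x; congr (_ / _); ring.
Qed.

Lemma classical_stationary b k (u1 u2 : R -> R) : 0 < k -> good u1 -> good u2 ->
  classical ((2 * k) ^+ 2) b u1 u2 ->
  let u x := (u1 x, u2 x) in [/\ H2per2 u, stationary b k u & even_fun u].
Proof.
move=> k0 g1 g2 [d1 [d2 [D1 D1' D2 D2']]] u.
have [r1 r2] := good_reaction b g1 g2.
have q1 : continuous (fun x => - (reaction b (u1 x, u2 x)).1 / (2 * k) ^+ 2).
  by apply: continuous_mul; [exact/continuous_opp/good_continuous|move=> ?; exact: cst_continuous].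
have q2 : continuous (fun x => - (reaction b (u1 x, u2 x)).2 / (4 * (2 * k) ^+ 2)).
  by apply: continuous_mul; [exact/continuous_opp/good_continuous|move=> ?; exact: cst_continuous].
have [c1 e1 p1] := g1; have [c2 e2 p2] := g2.
split; last by move=> x; rewrite /u e1 e2.
  split; last 2 first.
  - exact: Hper2_classical D1 D1' q1 p1.
  - exact: Hper2_classical D2 D2' q2 p2.
  by move=> x; exact: (cvg_pair (c1 x) (c2 x)).
have w1 := wderiv_ae (is_wderiv2 D1 D1' q1 p1).
have w2 := wderiv_ae (is_wderiv2 D2 D2' q2 p2).
have kn : k != 0 by rewrite gt_eqF.
rewrite /stationary; move: w1 w2.
apply: (@filterS2 _ _ (ae_filter_ringOfSetsType leb)) => x w1 w2 px.
rewrite /Nbr (_ : fst \o u = u1)// (_ : snd \o u = u2)// w1// w2//.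
rewrite /u; case: (reaction b (u1 x, u2 x)) => p q /=.
have E1 : k ^+ 2 * (4 * (- p / (2 * k) ^+ 2)) + p = 0 by field.
have E2 : k ^+ 2 * (16 * (- q / (4 * (2 * k) ^+ 2))) + q = 0 by field.
exact: (congr2 pair E1 E2).
Qed.

Lemma sup_le_H2norm2 u f1 f1' f1'' f2 f2' f2'' x : fst \o u = f1 -> snd \o u = f2 ->
  der f1 f1' -> der f1' f1'' -> continuous f1'' -> periodic2pi f1 ->
  der f2 f2' -> der f2' f2'' -> continuous f2'' -> periodic2pi f2 ->
  `|f1 x| <= 2 * H2norm2 u /\ `|f2 x| <= 2 * H2norm2 u.
Proof.
move=> E1 E2 D1 D1' c1 p1 D2 D2' c2 p2.
have S1 := sobolev_bound x D1 (der_continuous D1') p1.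
have S2 := sobolev_bound x D2 (der_continuous D2') p2.
have N1 := Hnorm2_sqr D1 D1' c1 p1; have N2 := Hnorm2_sqr D2 D2' c2 p2.
have Hn : 0 <= H2norm2 u by exact: sqrtr_ge0.
have Hs : H2norm2 u ^+ 2 = Hnorm 2 f1 ^+ 2 + Hnorm 2 f2 ^+ 2.
  by rewrite /H2norm2 E1 E2 sqr_sqrtr// addr_ge0// sqr_ge0.
have s1 := sqr_ge0 (L2norm f1''); have s2 := sqr_ge0 (L2norm f2'').
have t1 := sqr_ge0 (Hnorm 2 f1); have t2 := sqr_ge0 (Hnorm 2 f2).
have sq y : y ^+ 2 <= 2 * H2norm2 u ^+ 2 -> `|y| <= 2 * H2norm2 u.
  move=> h; rewrite -(@ler_pXn2r _ 2)// ?nnegrE ?mulr_ge0//.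
  by rewrite real_normK ?num_real// exprMn; have := sqr_ge0 (H2norm2 u); move: h; clear; lra.
split; apply: sq.
  by rewrite Hs; move: S1 N1 s1 t1 t2; clear; lra.
by rewrite Hs; move: S2 N2 s2 t1 t2; clear; lra.
Qed.

(** The two components contribute [27 M^2] each, and [2 27 <= 8^2]. *)
Lemma H2norm2_le (f1 f1' f1'' f2 f2' f2'' : R -> R) (M : R) :
  der f1 f1' -> der f1' f1'' -> continuous f1'' -> periodic2pi f1 ->
  der f2 f2' -> der f2' f2'' -> continuous f2'' -> periodic2pi f2 ->
  (forall x, [/\ `|f1 x| <= M, `|f1' x| <= M & `|f1'' x| <= M]) ->
  (forall x, [/\ `|f2 x| <= M, `|f2' x| <= M & `|f2'' x| <= M]) ->
  H2norm2 (fun x => (f1 x, f2 x)) <= 8 * M.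
Proof.
move=> D1 D1' c1 p1 D2 D2' c2 p2 B1 B2.
have M0 : 0 <= M by have [h _ _] := B1 0; exact: le_trans h.
have H1 : Hnorm 2 f1 ^+ 2 <= 27 * M ^+ 2.
  by apply: Hnorm2_bound D1 D1' c1 p1 _ _ _ => x; case: (B1 x).
have H2 : Hnorm 2 f2 ^+ 2 <= 27 * M ^+ 2.
  by apply: Hnorm2_bound D2 D2' c2 p2 _ _ _ => x; case: (B2 x).
rewrite /H2norm2 (_ : fst \o _ = f1)// (_ : snd \o _ = f2)//.
rewrite -(@ger0_norm _ (8 * M)) ?mulr_ge0// -sqrtr_sqr ler_sqrt ?sqr_ge0//.
by rewrite exprMn; have := sqr_ge0 M; move: H1 H2; clear; lra.
Qed.

End Stationary.

(** * Existence, uniqueness and expansion of the rolls *)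

Section Rolls.
Variable R : realType.
Implicit Types (p q r mu b s t a del rho dl N eps omega : R) (h y z : R -> R) (u : R -> R * R).

(** The components of a roll, and those of its difference from the expansion, all have this form,
    with different coefficients; one norm estimate serves both. *)
Definition comb p q r y z x := p * cos x + q * y x + r * z x.

Lemma comb_der p q r y z y' z' h : der y y' -> der y' (fun x => z x - y x) ->
  der z z' -> der z' (fun x => h x - z x) ->
  der (comb p q r y z) (fun x => p * - sin x + q * y' x + r * z' x) /\
  der (fun x => p * - sin x + q * y' x + r * z' x)
    (fun x => p * - cos x + q * (z x - y x) + r * (h x - z x)).
Proof.
move=> Dy Dy' Dz Dz'; split.
  by apply: der_add; [apply: der_add; apply: der_scale => //; exact: der_cos|exact: der_scale].
apply: der_add; last exact: der_scale.
by apply: der_add; apply: der_scale => //; apply: der_opp; exact: der_sin.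
Qed.

Lemma good_comb p q r y z : good y -> good z -> good (comb p q r y z).
Proof.
move=> gy gz; apply: good_add; [apply: good_add|]; apply: good_mul => //; try exact: good_cst.
exact: good_cos.
Qed.

Lemma comb_H2norm2 p q r p' q' r' h y z N P Q : continuous h ->
  osc h z -> osc z y -> (forall x, `|h x| <= N) -> `|p| <= P -> `|p'| <= P ->
  `|q| <= Q -> `|q'| <= Q -> `|r| <= Q -> `|r'| <= Q ->
  H2norm2 (fun x => (comb p q r y z x, comb p' q' r' y z x)) <=
    8 * (P + 2 * Q * (400 * (48 * N))).
Proof.
move=> gh oz oy hN pP pP' qQ qQ' rQ rQ'.
have [gz _ [z' Dz Dz']] := oz; have [gy _ [y' Dy Dy']] := oy.
have zN := osc_bound oz hN; have yN := osc_bound oy zN.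
have dzN := osc_der_bound oz Dz hN; have dyN := osc_der_bound oy Dy zN.
have N0 : 0 <= N by exact: le_trans (hN 0).
have P0 : 0 <= P by exact: le_trans pP.
have Q0 : 0 <= Q by exact: le_trans qQ.
(* [400 * (48 * N)] is the bound of [y']; it also dominates [y], [z], [z'], [z - y] and [h - z]. *)
have main (c v w k l m : R) : `|c| <= 1 -> `|k| <= P -> `|l| <= Q -> `|m| <= Q ->
    `|v| <= 400 * (48 * N) -> `|w| <= 400 * (48 * N) ->
    `|k * c + l * v + m * w| <= P + 2 * Q * (400 * (48 * N)).
  move=> c1 kP lQ mQ vN wN.
  have -> : P + 2 * Q * (400 * (48 * N)) = P * 1 + Q * (400 * (48 * N)) + Q * (400 * (48 * N)).
    by ring.
  apply: (le_trans (ler_normD _ _)); apply: lerD; last by rewrite normrM; exact: ler_pM.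
  apply: (le_trans (ler_normD _ _)); apply: lerD; by rewrite normrM; exact: ler_pM.
have sub1 (v w A B : R) : `|v| <= A -> `|w| <= B -> A + B <= 400 * (48 * N) -> `|v - w| <= 400 * (48 * N).
  by move=> vA wB AB; apply: le_trans AB; apply: (le_trans (ler_normB _ _)); exact: lerD.
have bounds x k l m : `|k| <= P -> `|l| <= Q -> `|m| <= Q ->
    [/\ `|comb k l m y z x| <= P + 2 * Q * (400 * (48 * N)),
        `|k * - sin x + l * y' x + m * z' x| <= P + 2 * Q * (400 * (48 * N)) &
        `|k * - cos x + l * (z x - y x) + m * (h x - z x)| <= P + 2 * Q * (400 * (48 * N))].
  move=> kP lQ mQ; split; apply: main => //.
  - exact: cos_max.
  - by apply: le_trans (yN x) _; move: N0; clear; lra.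
  - by apply: le_trans (zN x) _; move: N0; clear; lra.
  - by rewrite normrN; exact: sin_max.
  - by apply: le_trans (dzN x) _; move: N0; clear; lra.
  - by rewrite normrN; exact: cos_max.
  - by apply: sub1 (zN x) (yN x) _; move: N0; clear; lra.
  - by apply: sub1 (hN x) (zN x) _; move: N0; clear; lra.
have [D1 D2] := comb_der p q r Dy Dy' Dz Dz'.
have [D1' D2'] := comb_der p' q' r' Dy Dy' Dz Dz'.
have [gy0 _ py] := good_comb p q r gy gz; have [_ _ py'] := good_comb p' q' r' gy gz.
have cc k l m : continuous (fun x => k * - cos x + l * (z x - y x) + m * (h x - z x)).
  have cz := good_continuous gz; have cy := good_continuous gy.
  have c0 (w : R) : continuous (fun _ : R => w) by move=> ?; exact: cst_continuous.
  repeat first [exact: cz | exact: cy | exact: gh | exact: c0 | exact: good_continuous (@good_cos R)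
   | apply: continuous_add | apply: continuous_opp | apply: continuous_mul].
apply: H2norm2_le D1 D2 (cc _ _ _) py D1' D2' (cc _ _ _) py' _ _ => x; exact: bounds.
Qed.

Lemma sol1_comb mu a y z : sol1 mu a y z = comb (mu * a) (mu * a ^+ 2) (- (mu * a ^+ 2)) y z.
Proof. by apply/funext => x; rewrite /sol1 /comb; ring. Qed.

Lemma sol2_comb mu a y z : sol2 mu a y z =
  comb (- ((1 + mu) * a / 4)) (- ((1 + mu) * a ^+ 2 / 4)) (mu * a ^+ 2 / 4) y z.
Proof. by apply/funext => x; rewrite /sol2 /sol1 /comb; field. Qed.

Lemma roll_expansionE eps omega : - (1 / 4) <= omega <= 1 / 4 ->
  roll_expansion eps omega = fun x : R =>
    (root23 R * s_of eps omega * (2 - 22 / 9 * (eps * omega)) * cos x,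
     root23 R * s_of eps omega * (-1 + 29 / 9 * (eps * omega)) * cos x).
Proof.
move=> om; apply/funext => x; rewrite /roll_expansion sqrtrM ?divr_ge0//.
rewrite /s_of -/(root23 R).
set r := root23 R; set w := Num.sqrt (1 - 16 * omega ^+ 2).
have e1 : r * w * cos x * eps * 2 + eps ^+ 2 * (- (4 / 3 * omega * (r * w) * cos x) * 1
    - 5 / 9 * omega * (r * w) * cos x * 2) =
  r * (eps * w) * (2 - 22 / 9 * (eps * omega)) * cos x by field.
have e2 : r * w * cos x * eps * -1 + eps ^+ 2 * (- (4 / 3 * omega * (r * w) * cos x) * -2
    - 5 / 9 * omega * (r * w) * cos x * -1) =
  r * (eps * w) * (-1 + 29 / 9 * (eps * omega)) * cos x by field.
exact: (congr2 pair e1 e2).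
Qed.

(** [rho] is the radius for [h], [del] the size of the parameters, and [dl] the sup-norm radius
    within which a solution is recognised as a roll. *)
Definition consts del rho dl := small_consts del rho /\
  [/\ 0 < dl, 100 * dl <= del, 200 * (500 * (200 * del)) <= rho &
      4000 * (4000 * (4000 * (100 * del))) <= 1].

Lemma consts_exist : exists del rho dl, consts del rho dl.
Proof.
have inv (k c : R) : 0 < k -> 0 < c -> exists2 q, 0 < q & k * q = c.
  by move=> k0 c0; exists (k^-1 * c); rewrite ?mulr_gt0 ?invr_gt0// mulVKf// gt_eqF.
have k0 : 0 < 4000 :> R by clear; lra.
have k1 : 0 < 48 :> R by clear; lra.
have k2 : 0 < 100 :> R by clear; lra.
have k3 : 0 < 1 :> R by [].
have [d1 p1 E1] := inv _ _ k0 k3; have [d2 p2 E2] := inv _ _ k0 p1.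
have [d3 p3 E3] := inv _ _ k0 p2; have [del d0 dE] := inv _ _ k0 p3.
have [r1 q1 F1] := inv _ _ k2 k3; have [r2 q2 F2] := inv _ _ k1 q1.
have [rho r0 rE] := inv _ _ k1 q2; have [dl l0 lE] := inv _ _ k2 d0.
exists del, rho, dl; move: d0 r0 l0 E1 E2 E3 dE F1 F2 rE lE; clear => *.
by split; split; lra.
Qed.

(** Existence and uniqueness both pass through this description: a roll solves the problem, a small
    solution is a roll, and the reduced data of a roll are unique. *)
Definition is_roll rho eps omega u : Prop :=
  if degenerate eps omega then u = cst 0 else
  exists h t y z, [/\ reduced (mu_of eps omega) (eps ^+ 2) (s_of eps omega) h t y z,
    forall x, `|h x| <= rho, `|t - 33 / 20| <= 1 / 4 &
    u = fun x => (sol1 (mu_of eps omega) (s_of eps omega * t) y z x,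
                  sol2 (mu_of eps omega) (s_of eps omega * t) y z x)].

Lemma roll_params del rho dl eps omega : consts del rho dl ->
  0 <= eps <= del / 2 -> - (1 / 4) <= omega <= 1 / 4 ->
  [/\ small_params (mu_of eps omega) (eps ^+ 2) (s_of eps omega) del,
      0 <= eps <= 1 / 100,
      `|mu_of eps omega - 1| <= 2 * eps &
      (mu_of eps omega - 1) ^+ 2 - eps ^+ 2 * mu_of eps omega =
        - (mu_of eps omega * s_of eps omega ^+ 2)].
Proof.
move=> [sc _] /andP[e0 ed] om; have d4 := small_consts_le sc.
have e1 : 0 <= eps <= 1 / 10 by rewrite e0 /=; move: ed d4; clear; lra.
have [m1 _ dis /andP[s0 s1]] := params_facts e1 om.
have e2 : eps ^+ 2 <= del.
  have : eps * eps <= eps * 1 by apply: ler_wpM2l => //; move: ed d4; clear; lra.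
  by rewrite -expr2; move: ed e0; clear; lra.
split=> //; last by rewrite e0 /=; move: ed d4; clear; lra.
split; [|by rewrite sqr_ge0|by rewrite s0 /=; move: s1 ed e0; clear; lra].
by apply: le_trans m1 _; move: ed; clear; lra.
Qed.

Lemma is_roll_exists del rho dl eps omega : consts del rho dl ->
  0 <= eps <= del / 2 -> - (1 / 4) <= omega <= 1 / 4 ->
  exists u, is_roll rho eps omega u.
Proof.
move=> co ed om; rewrite /is_roll; case: (degenerate eps omega); first by exists (cst 0).
have [sp _ _ _] := roll_params co ed om.
by have [h [t [y [z [red hb tb]]]]] := reduced_exists sp co.1; do 5 eexists; split; eauto.
Qed.

Lemma is_roll_uniq del rho dl eps omega u v : consts del rho dl ->
  0 <= eps <= del / 2 -> - (1 / 4) <= omega <= 1 / 4 ->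
  is_roll rho eps omega u -> is_roll rho eps omega v -> u = v.
Proof.
move=> co ed om; rewrite /is_roll; case: ifP => _; first by move=> -> ->.
have [sp _ _ _] := roll_params co ed om.
move=> [h [t [y [z [red hb tb ->]]]]] [h' [t' [y' [z' [red' hb' tb' ->]]]]].
by have [_ -> -> ->] := reduced_uniq sp co.1 red hb tb red' hb' tb'.
Qed.

Lemma zero_solution b k : 0 < k ->
  [/\ H2per2 (cst 0 : R -> R * R), stationary b k (cst 0) & even_fun (cst 0 : R -> R * R)].
Proof.
move=> k0; apply: (@classical_stationary R b k (fun=> 0) (fun=> 0)) => //; try exact: good_cst.
have E1 : - (reaction b (0, 0)).1 / (2 * k) ^+ 2 = 0 by rewrite /reaction /=; ring.
have E2 : - (reaction b (0, 0)).2 / (4 * (2 * k) ^+ 2) = 0 by rewrite /reaction /=; ring.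
exists (fun=> 0), (fun=> 0); rewrite E1 E2.
by split; exact: der_cst.
Qed.

Lemma H2norm2_zero : H2norm2 (cst 0 : R -> R * R) <= 0.
Proof.
have D : der (fun _ : R => 0 : R) (fun=> 0) by exact: der_cst.
have c : continuous (fun _ : R => 0 : R) by move=> ?; exact: cst_continuous.
have B : forall x : R, [/\ `|(0 : R)| <= 0, `|(0 : R)| <= 0 & `|(0 : R)| <= 0].
  by move=> _; rewrite normr0.
have := H2norm2_le D D c (fun=> erefl) D D c (fun=> erefl) B B.
by rewrite mulr0.
Qed.

Lemma is_roll_solution del rho dl eps omega u : consts del rho dl ->
  0 <= eps <= del / 2 -> - (1 / 4) <= omega <= 1 / 4 ->
  is_roll rho eps omega u -> H2per2 u /\ roll_solution eps omega u.
Proof.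
move=> co ed om; have [sp e01 m1 dis] := roll_params co ed om.
have e1 : 0 <= eps <= 1 / 10 by case/andP: e01 => -> /=; clear; lra.
have [_ _ k0] := kappa_bounds e1 om.
rewrite /is_roll /roll_solution /normalized; case: ifP => dg.
  by move=> ->; have [] := zero_solution (eps ^+ 2) k0.
have e0 : 0 <= eps by case/andP: e01.
have s0 : 0 < s_of eps omega by apply: s_of_gt0 => //; rewrite dg.
move=> [h [t [y [z [red hb tb ->]]]]].
have mu0 : 0 < mu_of eps omega by rewrite /mu_of exprn_gt0// mulr_gt0.
have [[gh ch oz oy] _] := red.
have [gz _ _] := oz; have [gy _ _] := oy.
have cl := reduced_classical mu0 dis red.
have [H2 st ev] := classical_stationary k0 (good_sol1 _ _ gy gz) (good_sol2 _ _ gy gz) cl.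
split=> //; split=> //=; rewrite /sol1 cos0.
have zb := osc_bound oz hb; have yb := osc_bound oy zb.
have [[rho0 r48 _] _] := co.
have [tl tu] := ler_normlP _ _ tb.
have [_ _ /andP[_ sd]] := sp; have d4 := small_consts_le co.1.
have t0 : 0 < t by move: tl; clear; lra.
have a0 : 0 < s_of eps omega * t by exact: mulr_gt0.
have a1 : s_of eps omega * t <= 1.
  have : s_of eps omega * t <= 1 / 4 * 4.
    apply: ler_pM; try exact: ltW; last by move: tu; clear; lra.
    by move: sd d4; clear; lra.
  by clear; lra.
apply: mulr_gt0; first exact: mulr_gt0.
have yz : `|y 0 - z 0| <= 1 / 50.
  apply: (le_trans (ler_normB _ _)); have := zb 0; have := yb 0.
  by move: rho0 r48; clear; lra.
have : `|s_of eps omega * t * (y 0 - z 0)| <= 1 * (1 / 50).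
  by rewrite normrM (gtr0_norm a0); apply: ler_pM => //; exact: ltW.
by move=> /ler_normlP[]; clear; lra.
Qed.

Lemma roll_solution_is_roll del rho dl eps omega v : consts del rho dl ->
  0 <= eps <= del / 2 -> - (1 / 4) <= omega <= 1 / 4 ->
  H2per2 v -> 2 * H2norm2 v <= dl -> roll_solution eps omega v ->
  is_roll rho eps omega v.
Proof.
move=> co ed om H2 Hs [st ev]; have [sp e01 m1 dis] := roll_params co ed om.
have e1 : 0 <= eps <= 1 / 10 by case/andP: e01 => -> /=; clear; lra.
have [_ _ k0] := kappa_bounds e1 om.
have e0 : 0 <= eps by case/andP: e01.
rewrite /is_roll /normalized; case: ifP => dg // v0.
have s0 : 0 < s_of eps omega by apply: s_of_gt0 => //; rewrite dg.
have [sc [dl0 dl1 dl2 dl3]] := co.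
have [g1 g2 cl] := stationary_classical k0 H2 st ev.
have [[c1 _ p1] [c2 _ p2]] := conj g1 g2.
have [gr1 gr2] := good_reaction (eps ^+ 2) g1 g2.
have [d1 [d2 [D1 D1' D2 D2']]] := cl.
have q1 : continuous (fun x => - (reaction (eps ^+ 2) ((fst \o v) x, (snd \o v) x)).1 / (2 * wavenumber eps omega) ^+ 2).
  by apply: continuous_mul; [exact/continuous_opp/good_continuous|move=> ?; exact: cst_continuous].
have q2 : continuous (fun x => - (reaction (eps ^+ 2) ((fst \o v) x, (snd \o v) x)).2 / (4 * (2 * wavenumber eps omega) ^+ 2)).
  by apply: continuous_mul; [exact/continuous_opp/good_continuous|move=> ?; exact: cst_continuous].
have sup x := sup_le_H2norm2 x (erefl (fst \o v)) (erefl (snd \o v)) D1 D1' q1 p1 D2 D2' q2 p2.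
have b1 x : `|(fst \o v) x| <= dl by apply: le_trans Hs; case: (sup x).
have b2 x : `|(snd \o v) x| <= dl by apply: le_trans Hs; case: (sup x).
have [h [t [y [z [red hb tb E1 E2]]]]] :=
  classical_reduced sp sc s0 dl0 dl1 dl2 dl3 dis g1 g2 b1 b2 v0 cl.
exists h, t, y, z; split=> //; apply/funext => x.
by rewrite -E1 -E2 /= -surjective_pairing.
Qed.

Lemma amplitude_bounds mu s t eps : `|mu - 1| <= 2 * eps -> 0 <= s <= eps -> 0 <= eps <= 1 / 100 ->
  `|t - 33 / 20| <= 1 / 4 ->
  [/\ `|mu * (s * t)| <= 4 * eps, `|- ((1 + mu) * (s * t) / 4)| <= 4 * eps,
      `|mu * (s * t) ^+ 2| <= 8 * eps ^+ 2, `|- ((1 + mu) * (s * t) ^+ 2 / 4)| <= 8 * eps ^+ 2 &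
      `|mu * (s * t) ^+ 2 / 4| <= 8 * eps ^+ 2].
Proof.
move=> /ler_normlP[m1 m2] /andP[s0 s1] /andP[e0 e1] /ler_normlP[t1 t2].
have mu0 : 0 <= mu by move: m1 e1; clear; lra.
have mu2 : mu <= 2 by move: m2 e1; clear; lra.
have t0 : 0 <= t by move: t1; clear; lra.
have tt2 : t <= 2 by move: t2; clear; lra.
have a0 : 0 <= s * t by exact: mulr_ge0.
have a1 : s * t <= eps * 2 by exact: ler_pM.
have a2 : (s * t) ^+ 2 <= 4 * eps ^+ 2.
  by rewrite (_ : 4 * eps ^+ 2 = (eps * 2) ^+ 2); [rewrite ler_pXn2r ?nnegrE ?mulr_ge0|ring].
have a20 : 0 <= (s * t) ^+ 2 by exact: sqr_ge0.
have P1 : mu * (s * t) <= 2 * (eps * 2) by exact: ler_pM.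
have P2 : mu * (s * t) ^+ 2 <= 2 * (4 * eps ^+ 2) by exact: ler_pM.
have Q1 : 0 <= mu * (s * t) by exact: mulr_ge0.
have Q2 : 0 <= mu * (s * t) ^+ 2 by exact: mulr_ge0.
have ee : 0 <= eps ^+ 2 by exact: sqr_ge0.
move: (s * t) a0 a1 a2 a20 P1 P2 Q1 Q2 => a a0 a1 a2 a20 P1 P2 Q1 Q2.
split; rewrite ler_norml; move: a0 a1 a2 a20 P1 P2 Q1 Q2 ee e0; clear; move=> *; lra.
Qed.

Lemma is_roll_H2norm2 del rho dl eps omega u : consts del rho dl ->
  0 <= eps <= del / 2 -> - (1 / 4) <= omega <= 1 / 4 -> is_roll rho eps omega u ->
  H2norm2 u <= 8 * (4 * eps + 2 * (8 * eps ^+ 2) * (400 * (48 * (16 * eps)))).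
Proof.
move=> co ed om; have [sp e01 m1 dis] := roll_params co ed om.
have e1 : 0 <= eps <= 1 / 10 by case/andP: e01 => -> /=; clear; lra.
have e0 : 0 <= eps by case/andP: e01.
have [_ _ _ sE] := params_facts e1 om.
rewrite /is_roll; case: ifP => _.
  move=> ->; apply: (le_trans H2norm2_zero).
  by rewrite !(mulr_ge0, addr_ge0)// sqr_ge0.
move=> [h [t [y [z [red hb tb ->]]]]].
have [_ hN _ _] := reduced_small sp co.1 red hb tb e1 m1 erefl (proj2 (andP sE)).
have [p1 p2 q1 q2 q3] := amplitude_bounds m1 sE e01 tb.
have [[gh _ oz oy] _] := red.
rewrite sol1_comb sol2_comb; apply: (comb_H2norm2 (good_continuous gh) oz oy hN p1 p2 q1 q2 _ q3).
by rewrite normrN.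
Qed.

(** To first order in [mu - 1], [mu t] is [root23 (2 - 11/18 (mu - 1))] and [- (1 + mu) t / 4] is
    [root23 (-1 + 29/36 (mu - 1))]; then [mu - 1] is [4 eps omega] up to eps^2. *)
Lemma leading_amplitudes mu t eps omega C : `|mu - 1| <= 2 * eps ->
  `|mu - 1 - 4 * eps * omega| <= eps ^+ 2 -> 0 <= C -> 0 <= eps <= 1 / 100 ->
  `|t - 2 * root23 R * (1 - 47 / 36 * (mu - 1))| <= C * eps ^+ 2 ->
  `|mu * t - root23 R * (2 - 22 / 9 * (eps * omega))| <= (2 * C + 12) * eps ^+ 2 /\
  `|- ((1 + mu) * t / 4) - root23 R * (-1 + 29 / 9 * (eps * omega))| <= (2 * C + 12) * eps ^+ 2.
Proof.
move=> m1 m2 C0 /andP[e0 e1] tb; set r := root23 R in tb *.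
have r0 : 0 <= r by exact: sqrtr_ge0.
have r2 : r ^+ 2 = 2 / 3 by rewrite sqr_sqrtr// divr_ge0.
have r1 : r <= 1 by move: r0 r2; clear; nra.
set d := t - _ in tb; set th := mu - 1 - _ in m2.
have -> : mu * t - r * (2 - 22 / 9 * (eps * omega)) =
    (1 + (mu - 1)) * d - r * (11 / 18 * th + 47 / 18 * (mu - 1) ^+ 2).
  by rewrite /d /th; field.
have -> : - ((1 + mu) * t / 4) - r * (-1 + 29 / 9 * (eps * omega)) =
    r * (29 / 36 * th + 47 / 72 * (mu - 1) ^+ 2) - (2 + (mu - 1)) / 4 * d.
  by rewrite /d /th; field.
have mm : (mu - 1) ^+ 2 <= 4 * eps ^+ 2.
  have -> : 4 * eps ^+ 2 = (2 * eps) ^+ 2 by ring.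
  by rewrite -real_normK ?num_real// ler_pXn2r ?nnegrE ?mulr_ge0.
have mm0 := sqr_ge0 (mu - 1).
have prod (A B w v : R) : `|w| <= A -> `|v| <= B -> `|w * v| <= A * B.
  by move=> wA vB; rewrite normrM; exact: ler_pM.
have [u1 u2] := ler_normlP _ _ m1; have [v1 v2] := ler_normlP _ _ m2.
have rn : `|r| <= 1 by rewrite ger0_norm.
have Ce : 0 <= C * eps ^+ 2 by rewrite mulr_ge0// sqr_ge0.
have h1 : `|(1 + (mu - 1)) * d| <= 2 * (C * eps ^+ 2).
  by apply: prod => //; rewrite ler_norml; move: u1 u2 e1; clear; lra.
have h2 : `|(2 + (mu - 1)) / 4 * d| <= 1 * (C * eps ^+ 2).
  by apply: prod => //; rewrite ler_norml; move: u1 u2 e1; clear; lra.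
have h3 : `|r * (11 / 18 * th + 47 / 18 * (mu - 1) ^+ 2)| <= 1 * (12 * eps ^+ 2).
  by apply: prod => //; rewrite ler_norml; move: v1 v2 mm mm0; clear; lra.
have h4 : `|r * (29 / 36 * th + 47 / 72 * (mu - 1) ^+ 2)| <= 1 * (12 * eps ^+ 2).
  by apply: prod => //; rewrite ler_norml; move: v1 v2 mm mm0; clear; lra.
by split; apply: (le_trans (ler_normB _ _)); move: h1 h2 h3 h4 Ce; clear; lra.
Qed.

Lemma degenerate_expansion eps omega : - (1 / 4) <= omega <= 1 / 4 -> degenerate eps omega ->
  roll_expansion eps omega = cst 0.
Proof.
move=> om dg; rewrite roll_expansionE//.
have -> : s_of eps omega = 0.
  rewrite /s_of; case/or3P: dg => /eqP ->; rewrite ?mul0r//.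
    by rewrite (_ : 1 - _ = 0) ?sqrtr0 ?mulr0//; field.
  by rewrite (_ : 1 - _ = 0) ?sqrtr0 ?mulr0//; field.
by apply/funext => x; rewrite mulr0 !mul0r.
Qed.

(** The error has two sources of order eps^3: along [cos], [s <= eps] times the eps^2 error of the
    amplitudes; off [cos], coefficients of order [a^2] times [y] and [z], which are of order eps. *)
Lemma is_roll_expansion : exists C, forall del rho dl eps omega u, consts del rho dl ->
  0 <= eps <= del / 2 -> - (1 / 4) <= omega <= 1 / 4 -> is_roll rho eps omega u ->
  H2norm2 (u \- roll_expansion eps omega) <= C * eps ^+ 3.
Proof.
have [C C0 HC] := amplitude_expansion R.
exists (8 * ((2 * C + 12) + 2 * 8 * (400 * (48 * 16)))).
move=> del rho dl eps omega u co ed om.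
have [sp e01 m1 dis] := roll_params co ed om.
have e1 : 0 <= eps <= 1 / 10 by case/andP: e01 => -> /=; clear; lra.
have e0 : 0 <= eps by case/andP: e01.
have [_ m2 _ sE] := params_facts e1 om.
rewrite /is_roll; case: ifP => dg.
  move=> ->; rewrite degenerate_expansion// (_ : _ \- _ = cst 0); last first.
    by apply/funext => x; rewrite /= subr0.
  apply: (le_trans H2norm2_zero).
  by rewrite !(mulr_ge0, addr_ge0)// exprn_ge0.
move=> [h [t [y [z [red hb tb ->]]]]].
have ep : 0 < eps.
  by rewrite lt_neqAle e0 andbT eq_sym; move: dg; rewrite /degenerate; case: eqP.
have [_ hN _ _] := reduced_small sp co.1 red hb tb e1 m1 erefl (proj2 (andP sE)).
have [p1 p2 q1 q2 q3] := amplitude_bounds m1 sE e01 tb.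
have [[gh _ oz oy] _] := red.
pose m := (mu_of eps omega - 1) / eps; pose sh := s_of eps omega / eps.
have en : eps != 0 by rewrite gt_eqF.
have em : eps * m = mu_of eps omega - 1 by rewrite /m mulrC divfK.
have es : eps * sh = s_of eps omega by rewrite /sh mulrC divfK.
have mE : mu_of eps omega = 1 + eps * m by rewrite em addrC subrK.
have mb : `|m| <= 2 by rewrite /m normrM normfV (gtr0_norm ep) ler_pdivrMr.
have shb : `|sh| <= 1.
  have [s0 s1] := andP sE.
  by rewrite /sh normrM normfV (gtr0_norm ep) ler_pdivrMr// mul1r ger0_norm.
have tE : `|t - 2 * root23 R * (1 - 47 / 36 * (mu_of eps omega - 1))| <= C * eps ^+ 2.
  rewrite -em; apply: (HC eps m sh del rho h t y z) => //; rewrite -?mE ?es//; first exact: co.1.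
  by rewrite ep /=; case/andP: e01.
have [A1 A2] := leading_amplitudes m1 m2 C0 e01 tE.
have [s0 s1] := andP sE.
have scale (w : R) : `|w| <= (2 * C + 12) * eps ^+ 2 -> `|s_of eps omega * w| <= (2 * C + 12) * eps ^+ 3.
  move=> hw; rewrite normrM (ger0_norm s0) exprS mulrCA; exact: ler_pM.
have {}A1 := scale _ A1; have {}A2 := scale _ A2.
rewrite sol1_comb sol2_comb roll_expansionE//.
set P1 := s_of eps omega * (_ - _) in A1; set P2 := s_of eps omega * (_ - _) in A2.
set q := mu_of eps omega * (s_of eps omega * t) ^+ 2 in q1 *.
set q' := - ((1 + mu_of eps omega) * (s_of eps omega * t) ^+ 2 / 4) in q2 *.
rewrite (_ : _ \- _ = fun x => (comb P1 q (- q) y z x, comb P2 q' (q / 4) y z x)); last first.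
  by apply/funext => x; rewrite /comb /P1 /P2; congr pair => /=; field.
apply: (le_trans (comb_H2norm2 (good_continuous gh) oz oy hN A1 A2 q1 q2 _ q3)).
  by rewrite normrN.
by rewrite le_eqVlt; apply/orP; left; apply/eqP; ring.
Qed.

End Rolls.

Theorem theorem1p2 (R : realType) :
  exists (eps0 : R) (U : set (R -> R * R)) (ut : R -> R -> R -> R * R),
    [/\ 0 < eps0,
        nbhs0_H2per2 U,
        forall eps omega : R,
          0 <= eps < eps0 -> - (1 / 4) <= omega <= 1 / 4 ->
          [/\ U (ut eps omega), roll_solution eps omega (ut eps omega) &
              forall v, U v -> roll_solution eps omega v -> v = ut eps omega],
        exists C : R, forall eps omega : R,
          0 <= eps < eps0 -> - (1 / 4) <= omega <= 1 / 4 ->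
          H2norm2 (ut eps omega \- roll_expansion eps omega) <= C * eps ^+ 3 &
        forall eps omega : R,
          0 <= eps < eps0 -> omega = 1 / 4 \/ omega = - (1 / 4) ->
          ut eps omega = cst 0].
Proof.
have [del [rho [dl co]]] := consts_exist R.
have [sc [dl0 dl1 dl2 dl3]] := co.
(* The sup norm is at most twice the H^2 norm, so the ball of radius [dl / 2] consists of functions
   of sup norm at most [dl]. The bound [dl / 100] on eps puts the rolls, of H^2 norm at most about
   [35 eps], into that ball. *)
exists (dl / 100), [set u | H2per2 u /\ H2norm2 u < dl / 2],
  (fun eps omega => xget (cst 0) (is_roll rho eps omega)).
have small eps : 0 <= eps < dl / 100 -> 0 <= eps <= del / 2.
  by case/andP=> -> /=; move: dl0 dl1; clear; lra.
have roll eps omega : 0 <= eps < dl / 100 -> - (1 / 4) <= omega <= 1 / 4 ->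
    is_roll rho eps omega (xget (cst 0) (is_roll rho eps omega)).
  move=> /small ed om; have [u Hu] := is_roll_exists co ed om.
  exact: (xgetPex (cst 0) (ex_intro _ u Hu)).
split; first by rewrite divr_gt0.
- split; first by move=> u [].
  by exists (dl / 2); [rewrite divr_gt0|].
- move=> eps omega ed om; have ed' := small _ ed; have Hr := roll _ _ ed om.
  have [H2 sol] := is_roll_solution co ed' om Hr.
  split=> //; last first.
    move=> v [H2v sv] solv; apply: (is_roll_uniq co ed' om _ Hr).
    by apply: (roll_solution_is_roll co ed' om H2v _ solv); move: sv; clear; lra.
  split=> //; apply: le_lt_trans (is_roll_H2norm2 co ed' om Hr) _.
  have [_ e01 _ _] := roll_params co ed' om; have d4 := small_consts_le sc.
  (* Smallness of eps^2 absorbs the cubic term of the norm bound, leaving little more than [32 eps],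
     below [50 eps < dl / 2]. *)
  have e2 : 4000 * (4000 * eps ^+ 2) <= 1.
    have h0 : 0 <= eps * 4000 by case/andP: ed; clear; lra.
    have h1 : eps * 4000 <= 1 by case/andP: ed => _; move: d4 dl1 dl0; clear; lra.
    by have := ler_pM h0 h0 h1 h1; clear; lra.
  have e3 : eps * (4000 * (4000 * eps ^+ 2)) <= eps * 1.
    by apply: ler_wpM2l e2; case/andP: ed.
  by case/andP: ed; move: e3; clear; lra.
- have [C HC] := is_roll_expansion R; exists C => eps omega ed om.
  exact: HC co (small _ ed) om (roll _ _ ed om).
- move=> eps omega ed om.
  have om' : - (1 / 4) <= omega <= 1 / 4 by case: om => ->; apply/andP; split; clear; lra.
  have := roll _ _ ed om'; rewrite /is_roll /degenerate.
  by case: om => ->; rewrite eqxx ?orbT.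
Qed.
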